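(* Let $N\ge1$, $k\ge3$, $v\in(\mathbb Z/N\mathbb Z)^2$. Then $$\mathcal G_k^v(\tau)=-\frac{2\pi}{k-1}\sum_{\substack{r,s\ge0\\ r+s=k-2}}G_{r,s}^v(\tau)\,(X-\tau Y)^r(X-\bar\tau Y)^s,$$ where $\mathcal G_k^v(\tau)=P_{G_k^v}+\Re\int_{\vec1_\infty}^\tau\underline{G_k^v}(z)$.
   Context: $\mu_N=e^{2\pi i/N}$, $q_N=e^{2\pi i\tau/N}$, $(u|v)=md-nc$ for $u=(m,n)$, $v=(c,d)$. For $v\in(\mathbb Z/N\mathbb Z)^2$: $G_k^v(\tau)=\sum_{(m,n)\ne(0,0),(m,n)\equiv v\bmod N}(m\tau+n)^{-k}$, and for integers $r,s\ge0$ with $r+s\ge1$ the non-holomorphic Eisenstein series $G_{r,s}^v(\tau)=\sum_{(m,n)\ne(0,0),(m,n)\equiv v\bmod N}\frac{\Im\tau}{(m\tau+n)^{r+1}(m\bar\tau+n)^{s+1}}$. $V_{k-2}$: homogeneous degree-$(k-2)$ polynomials in $X,Y$ over $\mathbb C$; $\Re$ takes real parts of coefficients. $\underline f(z)=2\pi if(z)(X-zY)^{k-2}dz$. For $f=a_0+\sum_{n\ge1}a_nq_N^n$, $\int_\tau^{\vec1_\infty}f(z)z^pdz:=-\frac{a_0\tau^{p+1}}{p+1}+\int_\tau^{i\infty}(f(z)-a_0)z^pdz$ for $0\le p\le k-2$, and $\int_{\vec1_\infty}^\tau=-\int_\tau^{\vec1_\infty}$. For $u=(a,b)$, $0\le a,b<N$,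 $A_{\xi_k^u}=(-1)^{k-1+\lceil k/2\rceil}\delta_{a,0}\frac{(k-2)!}{(2\pi)^{k-2}}\mathrm{Cl}_{k-1}(\tfrac{2\pi b}{N})$ with $\mathrm{Cl}_m(x)=\Re\,\mathrm{Li}_m(e^{ix})$ ($m$ odd), $\Im\,\mathrm{Li}_m(e^{ix})$ ($m$ even); $A_{G_k^v}=\frac{(-1)^{\lfloor k/2\rfloor}(2\pi)^k}{N^2(k-1)!}\sum_{u\in(\mathbb Z/N\mathbb Z)^2}A_{\xi_k^u}\cdot c_u$ with $c_u=\cos\frac{2\pi(u|v)}N$ for $k$ even and $c_u=\sin\frac{2\pi(u|v)}N$ for $k$ odd; $P_{G_k^v}=A_{G_k^v}Y^{k-2}$. *)

(* Defs.v *)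
(* Stdlib reals with Coquelicot. *)
From Stdlib Require Import Reals ZArith List Factorial.
From Coquelicot Require Import Coquelicot.

Open Scope C_scope.

Definition cexp (z : C) : C :=
  ((exp (Re z) * cos (Im z))%R, (exp (Re z) * sin (Im z))%R).

Definition C_iota (P : C -> Prop) : C :=
  iota (T := CompleteNormedModule.CompleteSpace _ C_CompleteNormedModule) P.

(** * Lattice sums and Eisenstein series *)

(* Unordered summation over [Z * Z], as a limit over the directed set of
   finite subsets. *)
Definition is_lattice_sum (F : Z * Z -> C) (S : C) : Prop :=
  forall eps : posreal, exists l0 : list (Z * Z),
  forall l : list (Z * Z), NoDup l -> incl l0 l ->
    (Cmod (fold_right Cplus (RtoC 0) (map F l) - S) < eps)%R.

Definition lattice_sum (F : Z * Z -> C) : C := C_iota (is_lattice_sum F).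

(* An element of (Z/NZ)^2 is given by any pair of integers representing it. *)
Definition in_class (N : nat) (v u : Z * Z) : bool :=
  (((fst u - fst v) mod Z.of_nat N =? 0)%Z
   && ((snd u - snd v) mod Z.of_nat N =? 0)%Z
   && negb ((fst u =? 0)%Z && (snd u =? 0)%Z))%bool.

Definition lin (u : Z * Z) (z : C) : C :=
  RtoC (IZR (fst u)) * z + RtoC (IZR (snd u)).

Definition G_hol (N k : nat) (v : Z * Z) (tau : C) : C :=
  lattice_sum (fun u =>
    if in_class N v u then / (lin u tau ^ k) else RtoC 0).

Definition G_rs (N r s : nat) (v : Z * Z) (tau : C) : C :=
  lattice_sum (fun u =>
    if in_class N v u then
      RtoC (Im tau) / (lin u tau ^ (r + 1) * lin u (Cconj tau) ^ (s + 1))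
    else RtoC 0).

(** * Polynomials in X, Y *)

(* [P a b] is the coefficient of X^a Y^b.  Finite support is not imposed, so
   this is C[[X, Y]], into which C[X, Y] embeds. *)
Definition poly2 := nat -> nat -> C.

Definition pmono (a b : nat) : poly2 :=
  fun i j => if (Nat.eqb i a && Nat.eqb j b)%bool then RtoC 1 else RtoC 0.
Definition padd (P Q : poly2) : poly2 := fun i j => P i j + Q i j.
Definition pscal (c : C) (P : poly2) : poly2 := fun i j => c * P i j.
Definition pmul (P Q : poly2) : poly2 := fun i j =>
  sum_n (fun a => sum_n (fun b => P a b * Q (i - a)%nat (j - b)%nat) j) i.
Fixpoint ppow (P : poly2) (n : nat) : poly2 :=
  match n with O => pmono 0 0 | S n' => pmul P (ppow P n') end.
(* The sum includes both endpoints 0 and n. *)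
Definition psum (P : nat -> poly2) (n : nat) : poly2 :=
  fun i j => sum_n (fun r => P r i j) n.
Definition pRe (P : poly2) : poly2 := fun i j => RtoC (Re (P i j)).

Definition X_minus (z : C) : poly2 := padd (pmono 1 0) (pscal (- z) (pmono 0 1)).

(** * Integrals regularised at the cusp *)

Definition qN (N : nat) (z : C) : C :=
  cexp (RtoC (2 * PI) * Ci * z / RtoC (INR N)).

Definition is_q_expansion (N : nat) (f : C -> C) (a : nat -> C) : Prop :=
  forall z : C, (0 < Im z)%R -> is_series (fun n => a n * qN N z ^ n) (f z).

Definition const_term (N : nat) (f : C -> C) : C :=
  C_iota (fun a0 : C => exists a, is_q_expansion N f a /\ a O = a0).

(* The integral of g(z) dz along the vertical half-line z = tau + i t, t >= 0. *)
Definition int_to_ioo (g : C -> C) (tau : C) : C :=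
  RInt_gen (V := C_R_CompleteNormedModule)
    (fun t : R => Ci * g (tau + Ci * RtoC t)) (at_point 0%R) (Rbar_locally p_infty).

Definition int_to_cusp (N : nat) (f : C -> C) (p : nat) (tau : C) : C :=
  - (const_term N f * tau ^ (p + 1) / RtoC (INR (p + 1)))
  + int_to_ioo (fun z => (f z - const_term N f) * z ^ p) tau.

Definition int_from_cusp (N : nat) (f : C -> C) (p : nat) (tau : C) : C :=
  - int_to_cusp N f p tau.

(* The integral from the tangential base point at infinity to tau of
   2 pi i f(z) (X - z Y)^(k-2) dz.  The binomial expansion of (X - z Y)^(k-2)
   reduces it to the integrals of f(z) z^p dz. *)
Definition int_form_from_cusp (N k : nat) (f : C -> C) (tau : C) : poly2 :=
  psum (fun p =>
    pscal (RtoC (2 * PI) * Ci * RtoC ((-1) ^ p * Binomial.C (k - 2) p)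
           * int_from_cusp N f p tau)
          (pmono (k - 2 - p) p)) (k - 2).

(** * Clausen values and the polynomial P *)

Definition polylog (m : nat) (z : C) : C :=
  C_iota (is_series (fun n : nat => z ^ S n / RtoC (INR (S n) ^ m))).

Definition Clausen (m : nat) (x : R) : R :=
  if Nat.odd m then Re (polylog m (cexp (Ci * RtoC x)))
  else Im (polylog m (cexp (Ci * RtoC x))).

(* [Nat.div2 (k + 1)] is the ceiling of k/2. *)
Definition A_xi (N k a b : nat) : R :=
  ((-1) ^ (k - 1 + Nat.div2 (k + 1)) * (if Nat.eqb a 0 then 1 else 0)
   * (INR (fact (k - 2)) / (2 * PI) ^ (k - 2))
   * Clausen (k - 1) (2 * PI * INR b / INR N))%R.

Definition pairing (u v : Z * Z) : Z := (fst u * snd v - snd u * fst v)%Z.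

Definition A_G (N k : nat) (v : Z * Z) : R :=
  let c (a b : nat) : R :=
    let x := (2 * PI * IZR (pairing (Z.of_nat a, Z.of_nat b) v) / INR N)%R in
    if Nat.even k then cos x else sin x in
  ((-1) ^ Nat.div2 k * (2 * PI) ^ k / (INR N ^ 2 * INR (fact (k - 1)))
   * sum_n (fun a => sum_n (fun b => A_xi N k a b * c a b)%R (N - 1)) (N - 1))%R.

Definition P_G (N k : nat) (v : Z * Z) : poly2 :=
  pscal (RtoC (A_G N k v)) (pmono 0 (k - 2)).

Definition calG (N k : nat) (v : Z * Z) (tau : C) : poly2 :=
  padd (P_G N k v) (pRe (int_form_from_cusp N k (G_hol N k v) tau)).

(* Main.v *)
(** Write l = m z + n, w = (x - z) / l for a lattice point (m, n) and a real x, and put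
    X = x, Y = 1. Each term of the right-hand side telescopes to the harmonic function
    - Im (w^(k-1)) / (m x + n), whose derivative along the vertical line through tau is
    (k-1) Re ((x - z)^(k-2) / l^k). Summing over the lattice, both sides of the theorem have
    the same derivative along that line, so it remains to compare them as Im z tends to
    infinity. The row m = 0 is cancelled by the regularisation of the integral. A row m <> 0
    is a combination of the sums of (m (z - x))^j / (m z + n)^(j+1) over n: by the Lipschitz formula
    those with j > 0 are exponentially small, while the sum of Im (1 / (m z + n)) tends to
    - pi sgn(m) / N (Poisson kernel). The rows add up to a multiple of the sum of
    sgn(m) m^(1-k) over m congruent to the first coordinate of v, which is the finite Fourier
    transform of the Clausen values in A_G.

    The Lipschitz formula also yields the q-expansion of G_k^v, hence the convergence of the
    regularised integral. Its case k = 2 follows because the difference D of the two sides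
    is bounded on the upper half plane and 4 D(z) = D(z/2) + D((z+1)/2), which forces D = 0;
    the other cases follow by differentiation. *)

Require Import Defs.
From Stdlib Require Import Reals ZArith List Permutation Lra Lia Classical
  ClassicalEpsilon FunctionalExtensionality PropExtensionality.
From Coquelicot Require Import Coquelicot.

Open Scope R_scope.

(** * Unordered summation *)

(** Taking real parts of coefficients commutes with evaluation at real X only; this is why the
    comparison is made at real x, and homogeneity then allows Y = 1. The obstacle is the limit at
    the cusp. Every single term with m <> 0 tends to 0 there, while a whole row tends to a nonzero
    multiple of sgn(m) m^(1-k), so no dominated convergence over the lattice can give the limit.
    Each row is therefore summed first, with an error of at most a constant times 1 / Im z that is
    uniform in m; the weights |m|^(1-k), summable for k >= 3, then allow the sum over the rows.
    Expanding a row into powers destroys absolute convergence: the sum of 1 / (m z + n) over n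
    converges only conditionally, but its imaginary parts are absolutely summable, and the harmonic
    form of the terms asks for nothing else. The constants of the Lipschitz formulas are not
    tracked. They enter only the q-coefficients with n > 0 and bounds that vanish at the cusp, so
    the constant of the theorem comes from the Poisson kernel alone. *)

Definition lsum {T : Type} (F : T -> C) (l : list T) : C :=
  fold_right Cplus (RtoC 0) (map F l).

Definition rsum {T : Type} (f : T -> R) (l : list T) : R :=
  fold_right Rplus 0 (map f l).

(** [is_lattice_sum] is the case [T = Z * Z], up to conversion. The index type is general because
    rows of the lattice, q-series and families of pairs are all summed in this sense. *)
Definition usum {T : Type} (F : T -> C) (S : C) : Prop :=
  forall eps : posreal, exists l0 : list T,
  forall l : list T, NoDup l -> incl l0 l -> Cmod (lsum F l - S)%C < eps.

(** The dominating families. Bounded finite sums, instead of a given value, make comparison and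
    products of families free of limits. *)
Definition rsummable {T : Type} (M : T -> R) : Prop :=
  (forall t, 0 <= M t) /\ exists B, forall l, NoDup l -> rsum M l <= B.

Lemma exists_nodup {T : Type} (l : list T) :
  exists l', NoDup l' /\ forall x, In x l' <-> In x l.
Proof.
  induction l as [|a l [l' [H1 H2]]].
  - exists nil. split. constructor. tauto.
  - destruct (classic (In a l)) as [Ha|Ha].
    + exists l'. split; auto. intros x. rewrite H2. simpl. split; auto.
      intros [<-|?]; auto.
    + exists (a :: l'). split. constructor; auto. rewrite H2; auto.
      intros x. simpl. rewrite H2. tauto.
Qed.

Lemma nodup_extends {T : Type} (l0 l : list T) :
  NoDup l0 -> NoDup l -> incl l0 l ->
  exists l1, Permutation l (l0 ++ l1) /\ NoDup l1 /\ (forall x, In x l1 -> ~ In x l0).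
Proof.
  intros H0 Hl Hi.
  (* Membership is decided classically, since [T] carries no decidable equality. *)
  set (g := fun x => if excluded_middle_informative (In x l0) then false else true).
  assert (Hg : forall x, In x (filter g l) -> ~ In x l0).
  { intros x Hx. apply filter_In in Hx. destruct Hx as [_ Hx]. unfold g in Hx.
    destruct (excluded_middle_informative (In x l0)); [discriminate|assumption]. }
  exists (filter g l). split; [|split; auto using NoDup_filter].
  apply NoDup_Permutation; auto.
  - apply NoDup_app; auto using NoDup_filter.
    intros a Ha Hb. exact (Hg a Hb Ha).
  - intros x. rewrite in_app_iff, filter_In. unfold g.
    destruct (excluded_middle_informative (In x l0)); split; intros H; auto;
      destruct H as [H|[H _]]; auto.
Qed.

Lemma lsum_cons {T} (F : T -> C) a l : lsum F (a :: l) = (F a + lsum F l)%C.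
Proof. reflexivity. Qed.
Lemma rsum_cons {T} (F : T -> R) a l : rsum F (a :: l) = F a + rsum F l.
Proof. reflexivity. Qed.

Lemma lsum_app {T} (F : T -> C) l l' : lsum F (l ++ l') = (lsum F l + lsum F l')%C.
Proof.
  induction l; simpl.
  - unfold lsum at 2. simpl. ring.
  - rewrite !lsum_cons, IHl. ring.
Qed.

Lemma rsum_app {T} (F : T -> R) l l' : rsum F (l ++ l') = rsum F l + rsum F l'.
Proof.
  induction l; simpl.
  - unfold rsum at 2. simpl. ring.
  - rewrite !rsum_cons, IHl. ring.
Qed.

Lemma lsum_perm {T} (F : T -> C) l l' : Permutation l l' -> lsum F l = lsum F l'.
Proof.
  induction 1; rewrite ?lsum_cons; try congruence. ring.
Qed.

Lemma rsum_ge0 {T} (M : T -> R) l : (forall t, 0 <= M t) -> 0 <= rsum M l.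
Proof.
  intros H. induction l. unfold rsum; simpl; lra. rewrite rsum_cons. specialize (H a). lra.
Qed.

Lemma rsum_le {T} (f g : T -> R) l : (forall t, In t l -> f t <= g t) -> rsum f l <= rsum g l.
Proof.
  induction l; intros H. unfold rsum; simpl; lra. rewrite !rsum_cons.
  assert (f a <= g a) by (apply H; simpl; auto).
  assert (rsum f l <= rsum g l) by (apply IHl; intros; apply H; simpl; auto). lra.
Qed.

Lemma rsum_scal {T} c (f : T -> R) l : rsum (fun t => c * f t) l = c * rsum f l.
Proof. induction l. unfold rsum; simpl; ring. rewrite !rsum_cons, IHl. ring. Qed.

Lemma lsum_scal {T} c (f : T -> C) l : lsum (fun t => c * f t)%C l = (c * lsum f l)%C.
Proof. induction l. unfold lsum; simpl; ring. rewrite !lsum_cons, IHl. ring. Qed.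

Lemma lsum_plus {T} (f g : T -> C) l : lsum (fun t => f t + g t)%C l = (lsum f l + lsum g l)%C.
Proof. induction l. unfold lsum; simpl; ring. rewrite !lsum_cons, IHl. ring. Qed.

Lemma lsum_RtoC {T} (f : T -> R) l : lsum (fun t => RtoC (f t)) l = RtoC (rsum f l).
Proof.
  induction l. reflexivity. rewrite lsum_cons, rsum_cons, IHl, RtoC_plus. reflexivity.
Qed.

Lemma lsum_ext {T} (f g : T -> C) l : (forall t, In t l -> f t = g t) -> lsum f l = lsum g l.
Proof.
  induction l; intros H. reflexivity. rewrite !lsum_cons, (H a), IHl; simpl; auto.
  intros; apply H; simpl; auto.
Qed.

Lemma lsum_map {T U} (phi : U -> T) (F : T -> C) l :
  lsum F (map phi l) = lsum (fun u => F (phi u)) l.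
Proof. unfold lsum. rewrite map_map. reflexivity. Qed.

Lemma rsum_map {T U} (phi : U -> T) (F : T -> R) l :
  rsum F (map phi l) = rsum (fun u => F (phi u)) l.
Proof. unfold rsum. rewrite map_map. reflexivity. Qed.

Lemma Cmod_lsum {T} (F : T -> C) (M : T -> R) l :
  (forall t, In t l -> Cmod (F t) <= M t) -> Cmod (lsum F l) <= rsum M l.
Proof.
  induction l; intros H.
  - unfold lsum, rsum; simpl. rewrite Cmod_0. lra.
  - rewrite lsum_cons, rsum_cons.
    eapply Rle_trans. apply Cmod_triangle. apply Rplus_le_compat.
    apply H; simpl; auto. apply IHl. intros; apply H; simpl; auto.
Qed.

Lemma rsum_incl {T} (M : T -> R) l l' :
  (forall t, 0 <= M t) -> NoDup l -> incl l l' -> rsum M l <= rsum M l'.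
Proof.
  intros HM. revert l'. induction l as [|a l IH]; intros l' Hn Hi.
  - unfold rsum at 1; simpl. apply rsum_ge0; auto.
  - inversion Hn; subst.
    destruct (in_split a l') as [l1 [l2 E]]. apply Hi; simpl; auto. subst.
    rewrite rsum_app, !rsum_cons.
    assert (rsum M l <= rsum M (l1 ++ l2)).
    { apply IH; auto. intros x Hx. assert (x <> a) by congruence.
      assert (In x (l1 ++ a :: l2)) as K by (apply Hi; simpl; auto).
      rewrite in_app_iff in *. simpl in K. destruct K as [|[|]]; auto. congruence. }
    rewrite rsum_app in H. lra.
Qed.

Lemma incl_common {T : Type} (l1 l2 : list T) :
  exists l, NoDup l /\ incl l1 l /\ incl l2 l.
Proof.
  destruct (exists_nodup (l1 ++ l2)) as [l [H1 H2]]. exists l. split; auto.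
  split; intros x Hx; apply H2, in_app_iff; auto.
Qed.

Lemma usum_unique {T} (F : T -> C) S S' : usum F S -> usum F S' -> S = S'.
Proof.
  intros H H'. apply NNPP. intros Hne.
  assert (Hp : 0 < Cmod (S - S')%C) by (apply Cmod_gt_0; intros E; apply Hne, Ceq_minus; auto).
  assert (Hp2 : 0 < Cmod (S - S')%C / 2) by lra.
  destruct (H (mkposreal _ Hp2)) as [l1 H1]. destruct (H' (mkposreal _ Hp2)) as [l2 H2].
  destruct (incl_common l1 l2) as [l [Hl [Ha Hb]]].
  specialize (H1 l Hl Ha). specialize (H2 l Hl Hb). simpl in *.
  assert (E : (S - S' = (lsum F l - S') + - (lsum F l - S))%C) by ring.
  assert (Cmod (S - S')%C <= Cmod (lsum F l - S')%C + Cmod (lsum F l - S)%C).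
  { rewrite E at 1. eapply Rle_trans. apply Cmod_triangle. rewrite Cmod_opp. lra. }
  lra.
Qed.

Lemma usum_ext {T} (F G : T -> C) S : (forall t, F t = G t) -> usum F S -> usum G S.
Proof. intros H. replace G with F; auto. apply functional_extensionality; auto. Qed.

Lemma usum_plus {T} (F G : T -> C) S S' :
  usum F S -> usum G S' -> usum (fun t => F t + G t)%C (S + S')%C.
Proof.
  intros H H' eps. destruct (H (pos_div_2 eps)) as [l1 H1].
  destruct (H' (pos_div_2 eps)) as [l2 H2].
  exists (l1 ++ l2). intros l Hl Hi. rewrite lsum_plus.
  assert (A1 := H1 l Hl (fun x h => Hi x (in_or_app _ _ _ (or_introl h)))).
  assert (A2 := H2 l Hl (fun x h => Hi x (in_or_app _ _ _ (or_intror h)))).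
  simpl in *.
  replace (lsum F l + lsum G l - (S + S'))%C with ((lsum F l - S) + (lsum G l - S'))%C by ring.
  eapply Rle_lt_trans. apply Cmod_triangle. lra.
Qed.

Lemma usum_scal {T} (F : T -> C) S c : usum F S -> usum (fun t => c * F t)%C (c * S)%C.
Proof.
  intros H eps.
  assert (Hc := Cmod_ge_0 c).
  assert (Hp : 0 < eps / (Cmod c + 1)) by (apply Rdiv_lt_0_compat; [apply cond_pos|lra]).
  destruct (H (mkposreal _ Hp)) as [l1 H1].
  exists l1. intros l Hl Hi. rewrite lsum_scal. specialize (H1 l Hl Hi). simpl in H1.
  replace (c * lsum F l - c * S)%C with (c * (lsum F l - S))%C by ring.
  rewrite Cmod_mult. assert (Hq := Cmod_ge_0 (lsum F l - S)%C).
  apply Rmult_lt_compat_r with (r := Cmod c + 1) in H1; [|lra].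
  replace (eps / (Cmod c + 1) * (Cmod c + 1)) with (pos eps) in H1 by (field; lra).
  nra.
Qed.

Lemma usum_minus {T} (F G : T -> C) S S' :
  usum F S -> usum G S' -> usum (fun t => F t - G t)%C (S - S')%C.
Proof.
  intros H H'. apply (usum_scal _ _ (RtoC (-1))) in H'.
  replace (S - S')%C with (S + RtoC (-1) * S')%C by ring.
  eapply usum_ext; [|apply (usum_plus _ _ _ _ H H')]. intros; simpl; ring.
Qed.

Lemma usum_zero {T} : usum (fun _ : T => RtoC 0) (RtoC 0).
Proof.
  intros eps. exists nil. intros l _ _.
  replace (lsum (fun _ : T => RtoC 0) l) with (RtoC 0).
  replace (0 - 0)%C with (RtoC 0) by ring. rewrite Cmod_0. apply cond_pos.
  induction l. reflexivity. rewrite lsum_cons, <- IHl. ring.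
Qed.

Lemma usum_bound {T} (F : T -> C) S B :
  usum F S -> (forall l, NoDup l -> Cmod (lsum F l) <= B) -> Cmod S <= B.
Proof.
  intros H HB. apply Rnot_lt_le. intros Hlt.
  assert (Hp : 0 < Cmod S - B) by lra.
  destruct (H (mkposreal _ Hp)) as [l0 H0]. destruct (exists_nodup l0) as [l [Hl Hi]].
  specialize (H0 l Hl (fun x h => proj2 (Hi x) h)). simpl in H0. specialize (HB l Hl).
  assert (Cmod S <= Cmod (lsum F l) + Cmod (lsum F l - S)%C).
  { replace S with (lsum F l + - (lsum F l - S))%C at 1 by ring.
    eapply Rle_trans. apply Cmod_triangle. rewrite Cmod_opp. lra. }
  lra.
Qed.

Lemma rsummable_sum {T} (M : T -> R) : rsummable M ->
  exists S, usum (fun t => RtoC (M t)) (RtoC S) /\ 0 <= S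
    /\ (forall l, NoDup l -> rsum M l <= S)
    /\ (forall B, (forall l, NoDup l -> rsum M l <= B) -> S <= B).
Proof.
  intros [H0 [B HB]].
  destruct (completeness (fun s => exists l, NoDup l /\ rsum M l = s)) as [S [HS1 HS2]].
  - exists B. intros s [l [Hl <-]]. auto.
  - exists 0, nil. split. constructor. reflexivity.
  - assert (U : forall l, NoDup l -> rsum M l <= S).
    { intros l Hl. apply HS1. exists l; auto. }
    exists S. split; [|split; [|split]]; auto.
    + intros eps.
      destruct (classic (exists l, NoDup l /\ S - eps < rsum M l)) as [[l0 [A1 A2]]|N].
      * exists l0. intros l Hl Hi. rewrite lsum_RtoC, <- RtoC_minus, Cmod_R.
        assert (rsum M l0 <= rsum M l) by (apply rsum_incl; auto).
        specialize (U l Hl). apply Rabs_def1; assert (0 < eps) by apply cond_pos; lra.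
      * exfalso. assert (S <= S - eps).
        { apply HS2. intros s [l [Hl <-]]. apply Rnot_lt_le. intros Hlt.
          apply N. exists l; auto. }
        assert (0 < eps) by apply cond_pos. lra.
    + apply (U nil). constructor.
    + intros B' HB'. apply HS2. intros s [l [Hl <-]]. auto.
Qed.

Lemma rsummable_le {T} (f g : T -> R) :
  (forall t, 0 <= f t <= g t) -> rsummable g -> rsummable f.
Proof.
  intros H [_ [B HB]]. split. intros t; apply H.
  exists B. intros l Hl. eapply Rle_trans; [|apply (HB l Hl)].
  apply rsum_le. intros; apply H.
Qed.

Lemma rsummable_scal {T} c (f : T -> R) : 0 <= c -> rsummable f -> rsummable (fun t => c * f t).
Proof.
  intros Hc [H0 [B HB]]. split. intros t. apply Rmult_le_pos; auto.
  exists (c * B). intros l Hl. rewrite rsum_scal. apply Rmult_le_compat_l; auto.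
Qed.

Lemma Re_le_Cmod z : Rabs (Re z) <= Cmod z.
Proof. eapply Rle_trans; [|apply Rmax_Cmod]. apply Rmax_l. Qed.
Lemma Im_le_Cmod z : Rabs (Im z) <= Cmod z.
Proof. eapply Rle_trans; [|apply Rmax_Cmod]. apply Rmax_r. Qed.

Lemma usum_exists {T} (F : T -> C) (M : T -> R) :
  (forall t, Cmod (F t) <= M t) -> rsummable M -> exists S, usum F S.
Proof.
  intros HF HM.
  assert (A : forall f : T -> R, (forall t, Rabs (f t) <= M t) ->
    exists S, usum (fun t => RtoC (f t)) S).
  { intros f Hf.
    (* [M + f] is nonnegative and at most [2 * M], so it has a sum as a nonnegative family;
       subtracting the sum of [M] settles a signed [f]. *)
    assert (G : rsummable (fun t => M t + f t)).
    { apply (rsummable_le _ (fun t => 2 * M t)); [|apply rsummable_scal; auto; lra].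
      intros t. specialize (Hf t). apply Rabs_le_between in Hf. lra. }
    destruct (rsummable_sum _ G) as [S1 [U1 _]]. destruct (rsummable_sum _ HM) as [S2 [U2 _]].
    exists (RtoC S1 - RtoC S2)%C.
    eapply usum_ext; [|apply (usum_minus _ _ _ _ U1 U2)].
    intros t; simpl. rewrite <- RtoC_minus. f_equal. ring. }
  destruct (A (fun t => Re (F t))) as [S1 U1].
  { intros t. eapply Rle_trans. apply Re_le_Cmod. auto. }
  destruct (A (fun t => Im (F t))) as [S2 U2].
  { intros t. eapply Rle_trans. apply Im_le_Cmod. auto. }
  exists (S1 + Ci * S2)%C.
  eapply usum_ext; [|apply (usum_plus _ _ _ _ U1 (usum_scal _ _ Ci U2))].
  intros t. simpl. destruct (F t) as [a b]. simpl. apply injective_projections; simpl; ring.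
Qed.

Lemma usum_norm {T} (F : T -> C) (M : T -> R) S B :
  usum F S -> (forall t, Cmod (F t) <= M t) ->
  (forall l, NoDup l -> rsum M l <= B) -> Cmod S <= B.
Proof.
  intros H HM HB. apply (usum_bound F S B H). intros l Hl.
  eapply Rle_trans; [|apply (HB l Hl)]. apply Cmod_lsum; auto.
Qed.

Lemma rsummable_tail {T} (M : T -> R) : rsummable M -> forall eps : posreal,
  exists l0, NoDup l0 /\ forall l, NoDup l -> (forall x, In x l -> ~ In x l0) -> rsum M l < eps.
Proof.
  intros HM eps. destruct (rsummable_sum _ HM) as [S [U [_ [HS _]]]].
  destruct (U eps) as [l1 H1]. destruct (exists_nodup l1) as [l0 [Hn Hi]].
  exists l0. split; auto. intros l Hl Hd.
  specialize (H1 l0 Hn (fun x h => proj2 (Hi x) h)).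
  rewrite lsum_RtoC, <- RtoC_minus, Cmod_R in H1. apply Rabs_def2 in H1.
  assert (rsum M (l0 ++ l) <= S).
  { apply HS. apply NoDup_app; auto. intros a Ha Hb. exact (Hd a Hb Ha). }
  rewrite rsum_app in H. lra.
Qed.

Lemma usum_tail {T} (F : T -> C) (M : T -> R) S l0 B :
  usum F S -> (forall t, Cmod (F t) <= M t) -> NoDup l0 ->
  (forall l, NoDup l -> (forall x, In x l -> ~ In x l0) -> rsum M l <= B) ->
  Cmod (S - lsum F l0)%C <= B.
Proof.
  intros H HM H0 HB. apply Rle_plus_epsilon. intros e He.
  destruct (H (mkposreal e He)) as [l1 H1]. destruct (incl_common l0 l1) as [l [Hl [Ha Hb]]].
  specialize (H1 l Hl Hb). simpl in H1.
  destruct (nodup_extends l0 l H0 Hl Ha) as [l2 [P [N2 D2]]].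
  rewrite (lsum_perm _ _ _ P), lsum_app in H1.
  replace (S - lsum F l0)%C with (lsum F l2 + - (lsum F l0 + lsum F l2 - S))%C by ring.
  eapply Rle_trans. apply Cmod_triangle. rewrite Cmod_opp.
  apply Rplus_le_compat; [|lra].
  eapply Rle_trans; [|apply (HB l2 N2 D2)]. apply Cmod_lsum. auto.
Qed.

Lemma usum_inj {T U} (phi : T -> U) (F : U -> C) S :
  (forall a b, phi a = phi b -> a = b) ->
  (forall u, F u <> RtoC 0 -> exists t, phi t = u) ->
  usum (fun t => F (phi t)) S <-> usum F S.
Proof.
  intros Hinj Hsup.
  assert (A : forall l : list U, NoDup l -> exists l' : list T, NoDup l' /\
      (forall t, In t l' <-> In (phi t) l) /\ lsum F l = lsum (fun t => F (phi t)) l').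
  { induction l as [|u l IH]; intros Hl.
    - exists nil. split; [constructor|split; [simpl; tauto|reflexivity]].
    - inversion Hl; subst. destruct (IH H2) as [l' [N' [I' E']]].
      destruct (classic (exists t, phi t = u)) as [[t Ht]|Hno].
      + exists (t :: l'). split; [|split].
        * constructor; auto. rewrite I', Ht. auto.
        * intros t'. simpl. rewrite I', <- Ht. split; intros [H|H]; auto. left; congruence.
        * rewrite !lsum_cons, E', Ht. reflexivity.
      + exists l'. split; auto. split.
        * intros t'. simpl. rewrite I'. split; auto. intros [H|H]; auto.
          exfalso. eauto.
        * rewrite lsum_cons, <- E'. replace (F u) with (RtoC 0). ring.
          destruct (classic (F u = RtoC 0)); auto. exfalso; auto. }
  split; intros H eps; destruct (H eps) as [l0 H0].
  - exists (map phi l0). intros l Hl Hi. destruct (A l Hl) as [l' [N' [I' E']]].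
    rewrite E'. apply H0; auto. intros t Ht. apply I', Hi, in_map; auto.
  - destruct (exists_nodup l0) as [l1 [N1 I1]].
    destruct (A l1 N1) as [l1' [N1' [I1' _]]].
    exists l1'. intros l Hl Hi. rewrite <- (lsum_map phi F).
    (* [l2] adds to [map phi l] the missing points of [l1]. Such a point is no [phi t] with
       [F (phi t)] nonzero, because [l] already contains [l1']; so the additions contribute 0. *)
    destruct (exists_nodup (map phi l ++ l1)) as [l2 [N2 I2]].
    assert (Hnm : NoDup (map phi l)) by (apply FinFun.Injective_map_NoDup; auto).
    destruct (nodup_extends (map phi l) l2 Hnm N2) as [l3 [P3 [N3 D3]]].
    { intros x Hx. apply I2, in_app_iff; auto. }
    replace (lsum F (map phi l)) with (lsum F l2).
    { apply H0; auto. intros x Hx. apply I2, in_app_iff. right. apply I1; auto. }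
    rewrite (lsum_perm _ _ _ P3), lsum_app.
    replace (lsum F l3) with (RtoC 0). ring.
    rewrite (lsum_ext F (fun _ => RtoC 0)).
    { clear. induction l3. reflexivity. rewrite lsum_cons, <- IHl3. ring. }
    intros u Hu. destruct (classic (F u = RtoC 0)) as [|Hne]; auto. exfalso.
    destruct (Hsup u Hne) as [t Ht].
    assert (In u (map phi l ++ l1)).
    { apply I2. apply (Permutation_in u (Permutation_sym P3)). apply in_app_iff; auto. }
    apply in_app_iff in H1. destruct H1 as [H1|H1]. exact (D3 u Hu H1).
    apply (D3 u Hu). subst u. apply in_map, Hi, I1'. auto.
Qed.

Lemma usum_bij {T U} (phi : T -> U) (psi : U -> T) (F : U -> C) S :
  (forall t, psi (phi t) = t) -> (forall u, phi (psi u) = u) ->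
  usum (fun t => F (phi t)) S <-> usum F S.
Proof.
  intros H1 H2. apply usum_inj; [|intros u _; exists (psi u); auto].
  intros a b E. rewrite <- (H1 a), E. auto.
Qed.

Lemma rsummable_inj {T U} (phi : T -> U) (M : U -> R) :
  (forall a b, phi a = phi b -> a = b) -> rsummable M -> rsummable (fun t => M (phi t)).
Proof.
  intros Hi [H0 [B HB]]. split. intros; apply H0. exists B. intros l Hl.
  rewrite <- (rsum_map phi M). apply HB. apply FinFun.Injective_map_NoDup; auto.
Qed.

Lemma rsummable_prod {T U} (f : T -> R) (g : U -> R) :
  rsummable f -> rsummable g -> rsummable (fun p => f (fst p) * g (snd p)).
Proof.
  intros [Hf [B HB]] [Hg [B' HB']]. split. intros p. apply Rmult_le_pos; auto.
  exists (B * B'). intros l Hl.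
  destruct (exists_nodup (map fst l)) as [la [Na Ia]].
  destruct (exists_nodup (map snd l)) as [lb [Nb Ib]].
  apply Rle_trans with (rsum (fun p => f (fst p) * g (snd p)) (list_prod la lb)).
  - apply rsum_incl; auto. intros p; apply Rmult_le_pos; auto.
    intros [a b] Hp. apply in_prod. apply Ia. apply (in_map fst _ _ Hp).
    apply Ib. apply (in_map snd _ _ Hp).
  - replace (rsum (fun p => f (fst p) * g (snd p)) (list_prod la lb))
      with (rsum f la * rsum g lb).
    + apply Rmult_le_compat; auto using rsum_ge0.
    + clear. induction la; simpl. unfold rsum; simpl; ring.
      rewrite rsum_app, <- IHla, rsum_cons, rsum_map. simpl.
      rewrite (rsum_scal (f a) g). ring.
Qed.

(** Finitely many rows are approximated together by one finite set of pairs, chosen large enough to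
    contain the part of [l0] over them; the sum over that set is close to [S]. *)
Lemma usum_fubini {A B} (F : A * B -> C) (M : A * B -> R) S (s : A -> C) :
  (forall p, Cmod (F p) <= M p) -> rsummable M -> usum F S ->
  (forall a, usum (fun b => F (a, b)) (s a)) -> usum s S.
Proof.
  intros HF HM HS Hs eps.
  destruct (HS (pos_div_2 eps)) as [l0 H0].
  exists (map fst l0). intros la Hla Hia.
  (* The share of one row in the tolerance [eps / 2]; the added 1 covers the empty list. *)
  set (d := eps / 2 / (INR (length la) + 1)).
  assert (Hd : 0 < d).
  { unfold d. apply Rdiv_lt_0_compat. apply (cond_pos (pos_div_2 eps)).
    assert (h := pos_INR (length la)). lra. }
  assert (K : forall l1, NoDup l1 -> incl l1 la -> exists L : list (A * B),
    NoDup L /\ (forall p, In p L -> In (fst p) l1)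
    /\ (forall p, In p l0 -> In (fst p) l1 -> In p L)
    /\ Cmod (lsum F L - lsum s l1)%C <= INR (length l1) * d).
  { induction l1 as [|a l1 IH]; intros N1 I1.
    - exists nil. split; [constructor|split; [simpl; tauto|split; [simpl; tauto|]]].
      unfold lsum; simpl. replace (0-0)%C with (RtoC 0) by ring. rewrite Cmod_0. lra.
    - inversion N1; subst.
      destruct IH as [L [NL [L1 [L2 L3]]]]; auto. { intros x Hx; apply I1; simpl; auto. }
      destruct (Hs a (mkposreal d Hd)) as [b0 Hb0].
      set (bl := map snd (filter (fun p => if excluded_middle_informative (fst p = a) then true else false) l0)).
      destruct (incl_common b0 bl) as [lb [Nb [Ib1 Ib2]]].
      specialize (Hb0 lb Nb Ib1). simpl in Hb0.
      exists (map (pair a) lb ++ L). split; [|split; [|split]].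
      + apply NoDup_app; auto.
        * apply FinFun.Injective_map_NoDup; auto. intros x y E; congruence.
        * intros p Hp Hq. apply in_map_iff in Hp. destruct Hp as [b [<- _]].
          apply L1 in Hq. simpl in Hq. auto.
      + intros p Hp. apply in_app_iff in Hp. destruct Hp as [Hp|Hp].
        * apply in_map_iff in Hp. destruct Hp as [b [<- _]]. simpl; auto.
        * simpl. auto.
      + intros p Hp [Ha|Hp']; apply in_app_iff; [left|right; auto].
        destruct p as [a' b]. simpl in Ha. subst a'. apply in_map. apply Ib2.
        unfold bl. apply in_map_iff. exists (a, b). split; auto. apply filter_In. split; auto.
        simpl. destruct (excluded_middle_informative (a = a)); auto.
      + rewrite lsum_app, lsum_map, lsum_cons.
        replace (lsum (fun u => F (a, u)) lb + lsum F L - (s a + lsum s l1))%C with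
          ((lsum (fun u => F (a, u)) lb - s a) + (lsum F L - lsum s l1))%C by ring.
        eapply Rle_trans. apply Cmod_triangle.
        change (length (a :: l1)) with (Datatypes.S (length l1)). rewrite S_INR.
        lra. }
  destruct (K la Hla (incl_refl la)) as [L [NL [_ [L2 L3]]]].
  assert (E0 : Cmod (lsum F L - S)%C < pos_div_2 eps).
  { apply H0; auto. intros p Hp. apply L2; auto. apply Hia, in_map; auto. }
  simpl in E0.
  assert (INR (length la) * d <= eps / 2).
  { unfold d. assert (h := pos_INR (length la)).
    apply Rmult_le_reg_r with (INR (length la) + 1). lra.
    replace (INR (length la) * (eps / 2 / (INR (length la) + 1)) * (INR (length la) + 1))
      with (INR (length la) * (eps / 2)) by (field; lra).
    assert (0 < eps) by apply cond_pos. nra. }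
  replace (lsum s la - S)%C with ((lsum F L - S) + - (lsum F L - lsum s la))%C by ring.
  eapply Rle_lt_trans. apply Cmod_triangle. rewrite Cmod_opp. lra.
Qed.

(** Dominated convergence along a filter: outside one finite set both tails are at most [eps / 4],
    and on that set convergence is termwise. It is applied to punctured neighbourhoods of 0, to
    differentiate under the sum. *)
Lemma usum_tannery {K T} (Fl : (K -> Prop) -> Prop) {FF : Filter Fl}
  (F : K -> T -> C) (f : T -> C) (M : T -> R) (S : K -> C) (L : C) :
  rsummable M -> (forall t, Cmod (f t) <= M t) ->
  Fl (fun k => forall t, Cmod (F k t) <= M t) ->
  (forall t (eps : posreal), Fl (fun k => Cmod (F k t - f t)%C < eps)) ->
  Fl (fun k => usum (F k) (S k)) -> usum f L ->
  forall eps : posreal, Fl (fun k => Cmod (S k - L)%C < eps).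
Proof.
  intros HM Hf HF Hlim HS HL eps.
  assert (He : 0 < eps / 4). { assert (h := cond_pos eps). lra. }
  destruct (rsummable_tail M HM (mkposreal _ He)) as [l0 [N0 Ht]]. simpl in Ht.
  assert (Hfin : forall l : list T, forall e : posreal,
     Fl (fun k => Cmod (lsum (F k) l - lsum f l)%C < e)).
  { induction l as [|t l IH]; intros e.
    - eapply filter_imp; [|apply filter_true]. intros k _. unfold lsum; simpl.
      replace (0-0)%C with (RtoC 0) by ring. rewrite Cmod_0. apply cond_pos.
    - generalize (filter_and _ _ (Hlim t (pos_div_2 e)) (IH (pos_div_2 e))).
      apply filter_imp. intros k [H1 H2]. simpl in *. rewrite !lsum_cons.
      replace (F k t + lsum (F k) l - (f t + lsum f l))%C with
        ((F k t - f t) + (lsum (F k) l - lsum f l))%C by ring.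
      eapply Rle_lt_trans. apply Cmod_triangle. lra. }
  generalize (filter_and _ _ HF (filter_and _ _ HS (Hfin l0 (mkposreal _ He)))).
  apply filter_imp. intros k [H1 [H2 H3]]. simpl in H3.
  assert (A : Cmod (S k - lsum (F k) l0)%C <= eps / 4).
  { apply (usum_tail (F k) M); auto. intros l Hl Hd. left. auto. }
  assert (A' : Cmod (L - lsum f l0)%C <= eps / 4).
  { apply (usum_tail f M); auto. intros l Hl Hd. left. auto. }
  replace (S k - L)%C with ((S k - lsum (F k) l0) + (lsum (F k) l0 - lsum f l0) + - (L - lsum f l0))%C by ring.
  eapply Rle_lt_trans. apply Cmod_triangle. rewrite Cmod_opp.
  eapply Rle_lt_trans. apply Rplus_le_compat_r. apply Cmod_triangle.
  assert (h := cond_pos eps). lra.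
Qed.

(** * Complex-valued functions of a real variable *)

(** Functions on the half-plane are differentiated along straight lines only, so a pair of real
    derivatives suffices, and real tools such as the mean value theorem apply to each component. *)
Definition cder (f : R -> C) (t : R) (d : C) : Prop :=
  is_derive (fun s => Re (f s)) t (Re d) /\ is_derive (fun s => Im (f s)) t (Im d).

Lemma C_eq (z w : C) : Re z = Re w -> Im z = Im w -> z = w.
Proof. destruct z, w; simpl; intros; subst; reflexivity. Qed.

Lemma Cmod_le_abs z : Cmod z <= Rabs (Re z) + Rabs (Im z).
Proof.
  replace z with (RtoC (Re z) + Ci * RtoC (Im z))%C at 1 by (apply C_eq; simpl; ring).
  eapply Rle_trans. apply Cmod_triangle. rewrite Cmod_mult, Cmod_Ci, !Cmod_R. lra.
Qed.

Lemma Re_plus z w : Re (z + w)%C = Re z + Re w. Proof. reflexivity. Qed.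
Lemma Im_plus z w : Im (z + w)%C = Im z + Im w. Proof. reflexivity. Qed.
Lemma Re_minus z w : Re (z - w)%C = Re z - Re w. Proof. reflexivity. Qed.
Lemma Im_minus z w : Im (z - w)%C = Im z - Im w. Proof. reflexivity. Qed.

Lemma cder_ext f g t d : (forall s, f s = g s) -> cder f t d -> cder g t d.
Proof. intros H. replace g with f; auto. apply functional_extensionality; auto. Qed.

Lemma cder_eq f t d d' : d = d' -> cder f t d -> cder f t d'.
Proof. intros ->; auto. Qed.

Lemma cder_unique f t d d' : cder f t d -> cder f t d' -> d = d'.
Proof.
  intros [H1 H2] [H3 H4]. apply is_derive_unique in H1, H2, H3, H4.
  apply C_eq; congruence.
Qed.

Lemma cder_const c t : cder (fun _ => c) t (RtoC 0).
Proof. split; simpl; apply @is_derive_const. Qed.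

Lemma cder_plus f g t d d' : cder f t d -> cder g t d' -> cder (fun s => f s + g s)%C t (d + d')%C.
Proof.
  intros [H1 H2] [H3 H4]. split; simpl; [apply (is_derive_plus _ _ _ _ _ H1 H3)|apply (is_derive_plus _ _ _ _ _ H2 H4)].
Qed.

Lemma cder_mult f g t d d' :
  cder f t d -> cder g t d' -> cder (fun s => f s * g s)%C t (d * g t + f t * d')%C.
Proof.
  intros [H1 H2] [H3 H4].
  split.
  - generalize (is_derive_minus _ _ _ _ _ (Derive.is_derive_mult _ _ _ _ _ H1 H3)
      (Derive.is_derive_mult _ _ _ _ _ H2 H4)).
    unfold minus, plus, opp; simpl. unfold Re, Im.
    match goal with |- is_derive _ _ ?a -> is_derive _ _ ?b => replace a with b by ring end.
    apply is_derive_ext. intros; simpl; ring.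
  - generalize (is_derive_plus _ _ _ _ _ (Derive.is_derive_mult _ _ _ _ _ H1 H4)
      (Derive.is_derive_mult _ _ _ _ _ H2 H3)).
    unfold minus, plus, opp; simpl. unfold Re, Im.
    match goal with |- is_derive _ _ ?a -> is_derive _ _ ?b => replace a with b by ring end.
    apply is_derive_ext. intros; simpl; ring.
Qed.

Lemma cder_scal c f t d : cder f t d -> cder (fun s => c * f s)%C t (c * d)%C.
Proof.
  intros H. eapply cder_eq; [|apply (cder_mult _ _ _ _ _ (cder_const c t) H)]. ring.
Qed.

Lemma cder_opp f t d : cder f t d -> cder (fun s => - f s)%C t (- d)%C.
Proof.
  intros H. apply (cder_scal (RtoC (-1))) in H.
  eapply cder_eq; [|eapply cder_ext; [|apply H]]; intros; simpl; ring.
Qed.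

Lemma cder_minus f g t d d' : cder f t d -> cder g t d' -> cder (fun s => f s - g s)%C t (d - d')%C.
Proof. intros H H'. apply cder_plus; auto. apply cder_opp; auto. Qed.

Lemma cder_pow f t d n :
  cder f t d -> cder (fun s => f s ^ S n)%C t (RtoC (INR (S n)) * f t ^ n * d)%C.
Proof.
  intros H. induction n.
  - eapply cder_eq; [|eapply cder_ext; [|apply H]]; intros; simpl; ring.
  - eapply cder_eq; [|eapply cder_ext; [|apply (cder_mult _ _ _ _ _ H IHn)]].
    + rewrite (S_INR (S n)), RtoC_plus, (Cpow_S _ n). ring.
    + intros; simpl. reflexivity.
Qed.

Lemma Cnz_norm2 z : z <> RtoC 0 -> fst z ^ 2 + snd z ^ 2 <> 0.
Proof.
  intros Hz E. apply Hz. destruct z as [a b]. simpl in E.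
  assert (a = 0) by nra. assert (b = 0) by nra. subst. reflexivity.
Qed.

(** The real part of 1 / (u + i v); with u and v exchanged and the sign changed it is also the
    imaginary part. *)
Lemma is_derive_inv_parts (u v : R -> R) t du dv :
  u t ^ 2 + v t ^ 2 <> 0 -> is_derive u t du -> is_derive v t dv ->
  is_derive (fun s => u s / (u s ^ 2 + v s ^ 2)) t
    ((du * (v t ^ 2 - u t ^ 2) - 2 * u t * v t * dv) / (u t ^ 2 + v t ^ 2) ^ 2).
Proof.
  intros Hn H1 H2.
  assert (E1 := is_derive_unique _ _ _ H1). assert (E2 := is_derive_unique _ _ _ H2).
  auto_derive.
  - repeat split; try (eexists; eassumption). intros E; apply Hn. rewrite <- E. ring.
  - change (Derive (fun x : R => u x) t) with (Derive u t);
    change (Derive (fun x : R => v x) t) with (Derive v t).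
    rewrite E1, E2. field. intros E; apply Hn. rewrite <- E. ring.
Qed.

Lemma cder_inv f t d :
  f t <> RtoC 0 -> cder f t d -> cder (fun s => / f s)%C t (- (d * / (f t) ^ 2))%C.
Proof.
  intros Hz [H1 H2].
  assert (Hn := Cnz_norm2 _ Hz).
  assert (Hq : (f t ^ 2)%C <> RtoC 0) by (apply Cpow_nz; auto).
  eapply cder_eq with (d := (- (d * (/ f t) * (/ f t)))%C).
  { field. auto. }
  assert (Hn' : Im (f t) ^ 2 + Re (f t) ^ 2 <> 0) by (rewrite Rplus_comm; exact Hn).
  split.
  - generalize (is_derive_inv_parts _ _ _ _ _ Hn H1 H2).
    match goal with |- is_derive _ _ ?a -> is_derive _ _ ?b => replace a with b; [auto|] end.
    unfold Re, Im; simpl. field. intros E; apply Hn; rewrite <- E; ring.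
  - generalize (is_derive_opp _ _ _ (is_derive_inv_parts _ _ _ _ _ Hn' H2 H1)).
    match goal with |- is_derive _ _ ?a -> is_derive _ _ ?b => replace a with b end.
    + apply is_derive_ext. intros s. unfold opp, Re, Im; simpl. unfold Rdiv. rewrite Ropp_mult_distr_l.
      f_equal. f_equal. ring.
    + unfold opp, Re, Im; simpl. field. intros E; apply Hn; rewrite <- E; ring.
Qed.

Lemma is_derive_exp_trig (u v : R -> R) t du dv :
  is_derive u t du -> is_derive v t dv ->
  is_derive (fun s => exp (u s) * cos (v s)) t (du * (exp (u t) * cos (v t)) - dv * (exp (u t) * sin (v t)))
  /\ is_derive (fun s => exp (u s) * sin (v s)) t (du * (exp (u t) * sin (v t)) + dv * (exp (u t) * cos (v t))).
Proof.
  intros H1 H2.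
  assert (E1 := is_derive_unique _ _ _ H1). assert (E2 := is_derive_unique _ _ _ H2).
  split; auto_derive; try (repeat split; try (eexists; eassumption));
    change (Derive (fun x : R => u x) t) with (Derive u t);
    change (Derive (fun x : R => v x) t) with (Derive v t);
    rewrite E1, E2; ring.
Qed.

Lemma cder_cexp f t d : cder f t d -> cder (fun s => cexp (f s)) t (d * cexp (f t))%C.
Proof.
  intros [H1 H2]. destruct (is_derive_exp_trig _ _ _ _ _ H1 H2) as [A B]. split; simpl; auto.
Qed.

Lemma cder_RtoC g t d : is_derive g t d -> cder (fun s => RtoC (g s)) t (RtoC d).
Proof. intros H. split; simpl; auto. apply @is_derive_const. Qed.

Lemma cder_line a b t : cder (fun s => a + b * RtoC s)%C t b.
Proof.
  eapply cder_eq; [|apply cder_plus; [apply cder_const|apply cder_scal, cder_RtoC, is_derive_id]].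
  unfold one; simpl. ring.
Qed.

(** The form of the derivative to which [usum_tannery] applies. *)
Lemma cder_quot f t d :
  cder f t d <->
  forall eps : posreal, locally' 0 (fun h => Cmod ((f (t + h)%R - f t) * RtoC (/ h) - d)%C < eps).
Proof.
  unfold cder. rewrite !is_derive_Reals. split.
  - intros [H1 H2] eps.
    destruct (H1 _ (cond_pos (pos_div_2 eps))) as [d1 D1].
    destruct (H2 _ (cond_pos (pos_div_2 eps))) as [d2 D2].
    assert (Hd : 0 < Rmin d1 d2) by (apply Rmin_pos; apply cond_pos).
    exists (mkposreal _ Hd). intros h Hh Hn.
    assert (Hb : Rabs h < Rmin d1 d2).
    { replace h with (minus h 0). exact Hh. unfold minus, plus, opp; simpl; ring. }
    specialize (D1 h Hn (Rlt_le_trans _ _ _ Hb (Rmin_l _ _))).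
    specialize (D2 h Hn (Rlt_le_trans _ _ _ Hb (Rmin_r _ _))).
    eapply Rle_lt_trans. apply Cmod_le_abs.
    simpl in *. unfold Rdiv, Rminus in *.
    replace ((Re (f (t + h)%R) + - Re (f t)) * / h + - (Im (f (t + h)%R) + - Im (f t)) * 0)
      with ((Re (f (t + h)%R) + - Re (f t)) * / h) by ring.
    match goal with |- Rabs ?a + Rabs ?b < _ =>
      replace a with ((Re (f (t + h)%R) + - Re (f t)) * / h + - Re d) by (unfold Re, Im; ring);
      replace b with ((Im (f (t + h)%R) + - Im (f t)) * / h + - Im d) by (unfold Re, Im; ring) end.
    lra.
  - intros H. split; intros eps He; destruct (H (mkposreal eps He)) as [dl Hd];
    exists dl; intros h Hn Hb;
    (assert (Hh : ball 0 dl h) by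
      (unfold ball; simpl; unfold AbsRing_ball, abs, minus, plus, opp; simpl;
       replace (h + - 0) with h by ring; exact Hb));
    specialize (Hd h Hh Hn); simpl in Hd; (eapply Rle_lt_trans; [|apply Hd]).
    + eapply Rle_trans; [|apply Re_le_Cmod]. right. f_equal. simpl. unfold Rdiv, Re, Im; ring.
    + eapply Rle_trans; [|apply Im_le_Cmod]. right. f_equal. simpl. unfold Rdiv, Re, Im; ring.
Qed.

(** The mean value theorem fails for complex values; applying it to the real and the imaginary part
    costs the factor 2. *)
Lemma cmean_value f df t0 t M :
  (forall s, Rabs (s - t0) <= Rabs (t - t0) -> cder f s (df s) /\ Cmod (df s) <= M) ->
  Cmod (f t - f t0)%C <= 2 * M * Rabs (t - t0).
Proof.
  intros H. eapply Rle_trans. apply Cmod_le_abs.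
  assert (A1 : Rabs (Re (f t) - Re (f t0)) <= M * Rabs (t - t0)).
  { apply (bounded_variation (fun s => Re (f s)) (fun s => Re (df s))).
    intros s Hs. destruct (H s Hs) as [[D1 D2] B]. split; auto.
    eapply Rle_trans; [apply Re_le_Cmod|auto]. }
  assert (A2 : Rabs (Im (f t) - Im (f t0)) <= M * Rabs (t - t0)).
  { apply (bounded_variation (fun s => Im (f s)) (fun s => Im (df s))).
    intros s Hs. destruct (H s Hs) as [[D1 D2] B]. split; auto.
    eapply Rle_trans; [apply Im_le_Cmod|auto]. }
  rewrite Re_minus, Im_minus. lra.
Qed.

(** Dominated convergence for the difference quotients, which [cmean_value] bounds by [2 * M]. *)
Lemma cder_usum {T} (phi F : R -> T -> C) (M : T -> R) (Phi : R -> C) t0 delta f :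
  0 < delta -> rsummable M ->
  (forall t, Rabs (t - t0) < delta -> forall u, cder (fun s => phi s u) t (F t u) /\ Cmod (F t u) <= M u) ->
  (forall t, Rabs (t - t0) < delta -> usum (phi t) (Phi t)) ->
  usum (F t0) f -> cder Phi t0 f.
Proof.
  intros Hd HM HF HP Hf. apply cder_quot. intros eps.
  assert (H00 : Rabs (t0 - t0) < delta) by (replace (t0 - t0) with 0 by ring; rewrite Rabs_R0; auto).
  assert (Loc : forall h, ball 0 (mkposreal _ Hd) h -> Rabs (t0 + h - t0) < delta).
  { intros h Hh. replace (t0 + h - t0) with (minus h 0) by (unfold minus, plus, opp; simpl; ring). exact Hh. }
  apply (usum_tannery (locally' 0)
    (fun h u => ((phi (t0 + h)%R u - phi t0 u) * RtoC (/ h))%C) (F t0) (fun u => 2 * M u)); auto.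
  - apply rsummable_scal; auto; lra.
  - intros u. destruct (HF t0 H00 u) as [_ H].
    assert (0 <= Cmod (F t0 u)) by apply Cmod_ge_0. lra.
  - exists (mkposreal _ Hd). intros h Hh Hn u.
    rewrite Cmod_mult, Cmod_R, Rabs_inv.
    assert (A : Cmod (phi (t0 + h)%R u - phi t0 u)%C <= 2 * M u * Rabs (t0 + h - t0)).
    { apply (cmean_value (fun s => phi s u) (fun s => F s u)). intros s Hs. apply HF.
      eapply Rle_lt_trans. apply Hs. apply Loc; auto. }
    rewrite (Rplus_minus_l t0 h) in A.
    apply Rabs_pos_lt in Hn. apply Rmult_le_reg_r with (Rabs h); auto.
    rewrite Rmult_assoc, Rinv_l, Rmult_1_r; lra.
  - intros u. destruct (HF t0 H00 u) as [H _]. exact (proj1 (cder_quot (fun s => phi s u) t0 (F t0 u)) H).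
  - exists (mkposreal _ Hd). intros h Hh Hn.
    eapply usum_ext; [|replace ((Phi (t0 + h)%R - Phi t0) * RtoC (/ h))%C with
      (RtoC (/ h) * (Phi (t0 + h)%R - Phi t0))%C by ring;
      apply usum_scal, usum_minus; apply HP; auto].
    intros; simpl; ring.
Qed.

(** * Basic summable families *)

Lemma seq_rsum_telescope (f b : nat -> R) n :
  (forall i, f i <= b i - b (S i)) -> rsum f (seq 0 n) <= b 0%nat - b n.
Proof.
  intros H. induction n. unfold rsum; simpl; lra.
  rewrite seq_S, rsum_app. simpl. unfold rsum at 2; simpl. specialize (H n). lra.
Qed.

Lemma rsummable_telescope (f b : nat -> R) :
  (forall i, 0 <= f i) -> (forall i, 0 <= b i) -> (forall i, f i <= b i - b (S i)) -> rsummable f.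
Proof.
  intros H0 Hb H. split; auto. exists (b 0%nat). intros l Hl.
  assert (Hin : incl l (seq 0 (S (list_max l)))).
  { intros x Hx. apply in_seq. split. lia. simpl.
    assert (h := proj1 (list_max_le l (list_max l)) (Nat.le_refl _)).
    rewrite Forall_forall in h. specialize (h x Hx). lia. }
  eapply Rle_trans. apply (rsum_incl f l _ H0 Hl Hin).
  eapply Rle_trans. apply (seq_rsum_telescope f b); auto. specialize (Hb (S (list_max l))). lra.
Qed.

Lemma rsummable_Z (f : Z -> R) :
  rsummable (fun n => f (Z.of_nat n)) -> rsummable (fun n => f (- Z.of_nat n)%Z) -> rsummable f.
Proof.
  intros [H0 [B HB]] [H0' [B' HB']].
  assert (Hf : forall z, 0 <= f z).
  { intros z. destruct (Z_le_dec 0 z).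
    - rewrite <- (Z2Nat.id z) by auto. auto.
    - replace z with (- Z.of_nat (Z.to_nat (- z)))%Z by (rewrite Z2Nat.id; lia). auto. }
  split; auto. exists (B + B'). intros l Hl.
  destruct (exists_nodup (map Z.abs_nat l)) as [l' [N' I']].
  eapply Rle_trans. apply (rsum_incl f l (map Z.of_nat l' ++ map (fun n => (- Z.of_nat n)%Z) l')); auto.
  - intros z Hz. apply in_app_iff.
    assert (K : In (Z.abs_nat z) l') by (apply I', in_map; auto).
    destruct (Z_le_dec 0 z); [left|right]; apply in_map_iff; exists (Z.abs_nat z); split; auto; lia.
  - rewrite rsum_app, !rsum_map. specialize (HB l' N'). specialize (HB' l' N'). lra.
Qed.

(** The exponent 3/2 exceeds 1, so the weight is summable, and its double is 3, the least weight k: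
    products of two such weights dominate the lattice terms. *)
Definition wN (n : nat) : R := / (INR (S n) * sqrt (INR (S n))).
Definition wZ (n : Z) : R := / ((1 + Rabs (IZR n)) * sqrt (1 + Rabs (IZR n))).

Lemma rsummable_wN : rsummable wN.
Proof.
  assert (P : forall n, 0 < INR (S n)) by (intros; apply lt_0_INR; lia).
  assert (Q : forall n, 0 < sqrt (INR (S n))) by (intros; apply sqrt_lt_R0, P).
  assert (G : forall n, 0 < wN n) by (intros; unfold wN; apply Rinv_0_lt_compat, Rmult_lt_0_compat; auto).
  assert (S1 : rsummable (fun n => wN (S n))).
  { apply rsummable_telescope with (b := fun n => 2 * / sqrt (INR (S n))).
    - intros; left; auto.
    - intros n. specialize (Q n). apply Rinv_0_lt_compat in Q. lra.
    (* Integral comparison for x^(-3/2): since b^2 = a^2 + 1, one has 1 / b^3 <= 2 / a - 2 / b. It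
       covers the terms from the second on; the first is added below. *)
    - intros n. unfold wN. set (a := sqrt (INR (S n))). set (b := sqrt (INR (S (S n)))).
      assert (Ha : 0 < a) by apply Q. assert (Hb : 0 < b) by apply Q.
      assert (Ea : a * a = INR (S n)) by (apply sqrt_sqrt; left; auto).
      assert (Eb : b * b = INR (S (S n))) by (apply sqrt_sqrt; left; auto).
      rewrite <- Eb. rewrite (S_INR (S n)), <- Ea in Eb.
      assert (Hab : a < b) by nra.
      replace (2 * / a - 2 * / b) with (2 * (b - a) / (a * b)) by (field; lra).
      apply Rmult_le_reg_r with (b * b * b * a). repeat apply Rmult_lt_0_compat; auto.
      replace (/ (b * b * b) * (b * b * b * a)) with a by (field; lra).
      replace (2 * (b - a) / (a * b) * (b * b * b * a)) with (2 * (b - a) * (b * b)) by (field; lra).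
      assert ((b - a) * (b + a) = 1) by lra.
      assert (a <= b * b * (2 * (b - a))) by nra. lra. }
  destruct S1 as [_ [B HB]]. split. intros; left; auto.
  exists (wN 0 + B). intros l Hl.
  assert (exists l', NoDup l' /\ incl l (0%nat :: map S l')).
  { destruct (exists_nodup (map pred l)) as [l' [N' I']]. exists l'. split; auto.
    intros [|x] Hx; simpl; auto. right. apply in_map. apply I'. apply (in_map pred _ _ Hx). }
  destruct H as [l' [N' I']]. eapply Rle_trans. apply (rsum_incl wN l (0%nat :: map S l')); auto.
  intros; left; auto. rewrite rsum_cons, rsum_map. specialize (HB l' N'). lra.
Qed.

Lemma wZ_pos n : 0 < wZ n.
Proof.
  unfold wZ. assert (h := Rabs_pos (IZR n)). apply Rinv_0_lt_compat, Rmult_lt_0_compat.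
  lra. apply sqrt_lt_R0. lra.
Qed.

Lemma rsummable_wZ : rsummable wZ.
Proof.
  apply rsummable_Z; (apply (rsummable_le _ wN); [|apply rsummable_wN]);
    intros n; split; try (left; apply wZ_pos); right; unfold wZ, wN; rewrite ?opp_IZR, ?Rabs_Ropp;
    rewrite <- INR_IZR_INZ, Rabs_pos_eq, S_INR by apply pos_INR;
    rewrite (Rplus_comm 1); reflexivity.
Qed.

(* Dominates the terms of absolutely convergent Eisenstein series, by
   (1 + |m|)(1 + |n|) <= (1 + |m| + |n|)^2. *)
Definition wL (u : Z * Z) : R := wZ (fst u) * wZ (snd u).

Lemma rsummable_wL : rsummable wL.
Proof. apply (rsummable_prod wZ wZ); apply rsummable_wZ. Qed.

Lemma wL_pos u : 0 < wL u.
Proof. apply Rmult_lt_0_compat; apply wZ_pos. Qed.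

(** Source of the constant 8 in [inv_pow_le_wL]: it is 4^(3/2). *)
Lemma sqrt_cube_le a b : 0 < a -> 0 < b -> a * b <= 4 ->  (a * sqrt a) * (b * sqrt b) <= 8.
Proof.
  intros Ha Hb H. assert (Ea := sqrt_sqrt a (Rlt_le _ _ Ha)). assert (Eb := sqrt_sqrt b (Rlt_le _ _ Hb)).
  assert (0 < sqrt a) by (apply sqrt_lt_R0; auto). assert (0 < sqrt b) by (apply sqrt_lt_R0; auto).
  assert (sqrt a * sqrt b <= 2) by nra.
  replace (a * sqrt a * (b * sqrt b)) with ((a * b) * (sqrt a * sqrt b)) by ring.
  replace 8 with (4 * 2) by ring. apply Rmult_le_compat; auto; apply Rlt_le, Rmult_lt_0_compat; auto.
Qed.

Lemma inv_pow_le_wL (u : Z * Z) (k : nat) c L :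
  (3 <= k)%nat -> u <> (0, 0)%Z -> 0 < c ->
  c * (Rabs (IZR (fst u)) + Rabs (IZR (snd u))) <= L -> / L ^ k <= 8 / c ^ k * wL u.
Proof.
  intros Hk Hu Hc HL. destruct u as [m n]. unfold wL, wZ. simpl fst in *; simpl snd in *.
  set (A := Rabs (IZR m)) in *. set (B := Rabs (IZR n)) in *.
  assert (HA : 0 <= A) by apply Rabs_pos. assert (HB : 0 <= B) by apply Rabs_pos.
  assert (H1 : 1 <= A + B).
  { unfold A, B. rewrite <- !abs_IZR, <- plus_IZR. apply IZR_le.
    assert (m <> 0 \/ n <> 0)%Z by (destruct (Z.eq_dec m 0), (Z.eq_dec n 0); subst; auto; congruence). lia. }
  set (D := A + B) in *.
  assert (Hcd : 0 < c * D) by (apply Rmult_lt_0_compat; lra).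
  apply Rle_trans with (/ (c * D) ^ k).
  { apply Rinv_le_contravar. apply pow_lt; auto. apply pow_incr. lra. }
  rewrite Rpow_mult_distr, Rinv_mult.
  assert (Hck : 0 < / c ^ k) by (apply Rinv_0_lt_compat, pow_lt; auto).
  replace (8 / c ^ k * (/ ((1 + A) * sqrt (1 + A)) * / ((1 + B) * sqrt (1 + B)))) with
    (/ c ^ k * (8 * / (((1 + A) * sqrt (1 + A)) * ((1 + B) * sqrt (1 + B))))).
  2:{ rewrite (Rinv_mult ((1 + A) * sqrt (1 + A))). unfold Rdiv. ring. }
  apply Rmult_le_compat_l. lra.
  apply Rle_trans with (/ D ^ 3).
  { apply Rinv_le_contravar. apply pow_lt; lra. apply Rle_pow; auto. }
  (* After scaling by [D >= 1] the two factors have product at most 4, as (1 + A)(1 + B) <= 4 D^2;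
     the scaling itself produces exactly D^3. *)
  set (a := (1 + A) / D). set (b := (1 + B) / D).
  assert (Pa : 0 < a) by (apply Rdiv_lt_0_compat; lra).
  assert (Pb : 0 < b) by (apply Rdiv_lt_0_compat; lra).
  assert (Ea : 1 + A = a * D) by (unfold a; field; lra).
  assert (Eb : 1 + B = b * D) by (unfold b; field; lra).
  assert (Hab : a * b <= 4).
  { apply Rmult_le_reg_r with (D * D). nra.
    replace (a * b * (D * D)) with ((a * D) * (b * D)) by ring. rewrite <- Ea, <- Eb.
    unfold D in *. nra. }
  assert (K := sqrt_cube_le a b Pa Pb Hab).
  rewrite Ea, Eb, !sqrt_mult by lra.
  assert (Sa : 0 < sqrt a) by (apply sqrt_lt_R0; auto). assert (Sb : 0 < sqrt b) by (apply sqrt_lt_R0; auto).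
  replace (a * D * (sqrt a * sqrt D) * (b * D * (sqrt b * sqrt D))) with
    ((a * sqrt a * (b * sqrt b)) * (D * D * (sqrt D * sqrt D))) by ring.
  rewrite sqrt_sqrt by lra. replace (D * D * D) with (D ^ 3) by ring.
  set (q := a * sqrt a * (b * sqrt b)) in *.
  assert (Hq : 0 < q) by (unfold q; apply Rmult_lt_0_compat; apply Rmult_lt_0_compat; assumption).
  assert (HD : 0 < D ^ 3) by (apply pow_lt; lra).
  rewrite Rinv_mult, <- Rmult_assoc. rewrite <- (Rmult_1_l (/ D ^ 3)) at 1.
  apply Rmult_le_compat_r. left; apply Rinv_0_lt_compat; auto.
  apply Rmult_le_reg_r with q; auto. rewrite Rmult_assoc, Rinv_l; lra.
Qed.

(** The imaginary part of a z + b controls a, and subtracting a z then controls b. The constant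
    depends on [y0] and [K] only, which gives bounds uniform near a point of the half-plane. *)
Lemma lin_lower y0 K : 0 < y0 -> exists c, 0 < c <= 1 /\
  forall z : C, y0 <= Im z -> Cmod z <= K -> forall a b : R,
  c * (Rabs a + Rabs b) <= Cmod (RtoC a * z + RtoC b)%C.
Proof.
  intros Hy. set (K' := Rmax K 1).
  assert (HK : 1 <= K') by apply Rmax_r.
  exists (/ (1 + (1 + K') / y0)).
  assert (Hp : 0 < (1 + K') / y0) by (apply Rdiv_lt_0_compat; lra).
  split. { split. apply Rinv_0_lt_compat; lra. rewrite <- Rinv_1. apply Rinv_le_contravar; lra. }
  intros z Hz Hk a b. set (L := Cmod (RtoC a * z + RtoC b)%C).
  assert (H1 : Rabs a * y0 <= L).
  { apply Rle_trans with (Rabs (Im (RtoC a * z + RtoC b)%C)); [|apply Im_le_Cmod].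
    simpl. replace (a * snd z + 0 * fst z + 0) with (a * Im z) by (unfold Im; ring).
    rewrite Rabs_mult. apply Rmult_le_compat_l. apply Rabs_pos.
    eapply Rle_trans; [apply Hz|apply Rle_abs]. }
  assert (H2 : Rabs b <= L + Rabs a * K').
  { rewrite <- (Cmod_R b). replace (RtoC b) with ((RtoC a * z + RtoC b) + - (RtoC a * z))%C by ring.
    eapply Rle_trans. apply Cmod_triangle. rewrite Cmod_opp, Cmod_mult, Cmod_R.
    apply Rplus_le_compat. apply Rle_refl.
    apply Rmult_le_compat_l. apply Rabs_pos. eapply Rle_trans; [apply Hk|apply Rmax_l]. }
  assert (Ha : Rabs a <= L / y0) by (apply Rle_div_r; auto).
  apply Rmult_le_reg_l with (1 + (1 + K') / y0). lra.
  rewrite <- Rmult_assoc, Rinv_r, Rmult_1_l by lra.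
  assert (0 <= Rabs a) by apply Rabs_pos.
  replace ((1 + (1 + K') / y0) * L) with (L + (L / y0) * (1 + K')) by (field; lra). nra.
Qed.

(** * Series and unordered sums *)

Lemma Cball (z w : C) (eps : posreal) : Cmod (w - z)%C < eps -> ball z eps w.
Proof.
  intros H. split.
  - change (Rabs (fst w - fst z) < eps). eapply Rle_lt_trans; [|apply H].
    apply (Re_le_Cmod (w - z)%C).
  - change (Rabs (snd w - snd z) < eps). eapply Rle_lt_trans; [|apply H].
    apply (Im_le_Cmod (w - z)%C).
Qed.

Lemma lsum_seq (F : nat -> C) n : lsum F (seq 0 (S n)) = sum_n F n.
Proof.
  induction n.
  - rewrite sum_O. unfold lsum; simpl. ring.
  - rewrite seq_S, lsum_app, IHn, sum_Sn. unfold lsum; simpl. unfold plus; simpl. ring.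
Qed.

Lemma usum_is_series (F : nat -> C) (S : C) : usum F S -> is_series F S.
Proof.
  intros H. apply filterlim_locally. intros eps. destruct (H eps) as [l0 H0].
  exists (list_max l0). intros n Hn. apply Cball.
  change (Cmod (sum_n F n - S)%C < eps). rewrite <- lsum_seq. apply H0.
  apply seq_NoDup. intros x Hx. apply in_seq. split. lia.
  assert (h := proj1 (list_max_le l0 (list_max l0)) (Nat.le_refl _)).
  rewrite Forall_forall in h. specialize (h x Hx). lia.
Qed.

Lemma is_series_C_unique (F : nat -> C) (S S' : C) : is_series F S -> is_series F S' -> S = S'.
Proof. intros H H'. exact (filterlim_locally_unique _ _ _ H H'). Qed.

Lemma C_iota_eq (P : C -> Prop) x : (forall y, P y -> y = x) -> P x -> C_iota P = x.
Proof. intros H Hx. apply (@iota_unique _ C_CompleteNormedModule P x H Hx). Qed.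

Lemma lattice_sum_eq F S : usum F S -> lattice_sum F = S.
Proof.
  intros H. apply C_iota_eq; auto. intros y Hy. exact (usum_unique F y S Hy H).
Qed.

(** * The Lipschitz formula *)

Definition tsum {T : Type} (F : T -> C) : C := C_iota (usum F).

Lemma tsum_eq {T} (F : T -> C) S : usum F S -> tsum F = S.
Proof. intros H. apply C_iota_eq; auto. intros y Hy. exact (usum_unique F y S Hy H). Qed.

Lemma tsum_spec {T} (F : T -> C) (M : T -> R) :
  (forall t, Cmod (F t) <= M t) -> rsummable M -> usum F (tsum F).
Proof. intros H1 H2. destruct (usum_exists F M H1 H2) as [S HS]. rewrite (tsum_eq F S); auto. Qed.

Lemma tsum_ext {T} (F G : T -> C) : (forall t, F t = G t) -> tsum F = tsum G.
Proof. intros H. f_equal. apply functional_extensionality; auto. Qed.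

Lemma usum_single {T} (F : T -> C) t0 : (forall t, t <> t0 -> F t = RtoC 0) -> usum F (F t0).
Proof.
  intros H. apply (usum_inj (fun _ : unit => t0) F).
  - intros [] []; auto.
  - intros u Hu. exists tt. apply NNPP. intros N. apply Hu, H. congruence.
  - intros eps. exists (tt :: nil). intros l Hl Hi.
    replace (lsum (fun _ => F t0) l) with (F t0).
    replace (F t0 - F t0)%C with (RtoC 0) by ring. rewrite Cmod_0. apply cond_pos.
    destruct l as [|[] [|[] l]].
    + destruct (Hi tt); simpl; auto.
    + unfold lsum; simpl. ring.
    + inversion Hl; subst. exfalso. apply H2. simpl; auto.
Qed.

(** * The complex exponential and exponential bounds *)

Lemma cexp_add z w : cexp (z + w)%C = (cexp z * cexp w)%C.
Proof.
  unfold cexp. apply C_eq; simpl; unfold Re, Im; simpl.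
  - rewrite exp_plus, cos_plus. ring.
  - rewrite exp_plus, sin_plus. ring.
Qed.

Lemma cexp_0 : cexp (RtoC 0) = RtoC 1.
Proof. unfold cexp. simpl. rewrite exp_0, cos_0, sin_0. apply C_eq; simpl; ring. Qed.

Lemma Cmod_cexp z : Cmod (cexp z) = exp (Re z).
Proof.
  unfold cexp, Cmod. simpl.
  replace (_ + _) with ((exp (Re z)) ^ 2 * ((cos (Im z))² + (sin (Im z))²))
    by (unfold Rsqr; ring).
  rewrite Rplus_comm, sin2_cos2, Rmult_1_r. apply sqrt_pow2. left; apply exp_pos.
Qed.

Lemma cexp_nz z : cexp z <> RtoC 0.
Proof. intros E. assert (h := exp_pos (Re z)). rewrite <- Cmod_cexp, E, Cmod_0 in h. lra. Qed.

Lemma cexp_opp z : cexp (- z)%C = (/ cexp z)%C.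
Proof.
  assert (H : (cexp (- z) * cexp z = 1)%C).
  { rewrite <- cexp_add, <- cexp_0. f_equal. ring. }
  assert (N := cexp_nz z). replace (cexp (- z)%C) with (cexp (- z) * cexp z * / cexp z)%C by (field; auto).
  rewrite H. ring.
Qed.

Lemma cexp_INR n z : cexp (RtoC (INR n) * z)%C = (cexp z ^ n)%C.
Proof.
  induction n.
  - simpl. rewrite <- cexp_0. f_equal. ring.
  - rewrite Cpow_S, <- IHn, <- cexp_add, S_INR, RtoC_plus. f_equal. ring.
Qed.

Lemma cexp_2PI_Z (n : Z) : cexp (RtoC (2 * PI) * Ci * RtoC (IZR n))%C = RtoC 1.
Proof.
  unfold cexp. simpl.
  replace ((2 * PI * 0 - 0 * 1) * IZR n - (2 * PI * 1 + 0 * 0) * 0) with 0 by ring.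
  replace ((2 * PI * 0 - 0 * 1) * 0 + (2 * PI * 1 + 0 * 0) * IZR n) with (2 * IZR n * PI) by ring.
  rewrite exp_0.
  assert (cos (2 * IZR n * PI) = 1 /\ sin (2 * IZR n * PI) = 0) as [-> ->].
  { assert (S0 : sin (IZR n * PI) = 0) by (apply sin_eq_0_1; exists n; auto).
    replace (2 * IZR n * PI) with (2 * (IZR n * PI)) by ring. split.
    - rewrite cos_2a_sin, S0. ring.
    - rewrite sin_2a, S0. ring. }
  apply C_eq; simpl; ring.
Qed.

Definition ec (z : C) : C := cexp (RtoC (2 * PI) * Ci * z).

Lemma ec_add z w : ec (z + w)%C = (ec z * ec w)%C.
Proof. unfold ec. rewrite <- cexp_add. f_equal. ring. Qed.

Lemma ec_Z n : ec (RtoC (IZR n)) = RtoC 1.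
Proof. apply cexp_2PI_Z. Qed.

Lemma Cmod_ec z : Cmod (ec z) = exp (- (2 * PI * Im z)).
Proof. unfold ec. rewrite Cmod_cexp. f_equal. simpl. unfold Re, Im; simpl. ring. Qed.

Lemma Cmod_ec_lt z : 0 < Im z -> Cmod (ec z) < 1.
Proof.
  intros H. rewrite Cmod_ec, <- exp_0. apply exp_increasing.
  assert (h := PI_RGT_0). assert (0 < PI * Im z) by (apply Rmult_lt_0_compat; auto). lra.
Qed.

Lemma exp_mono x y : x <= y -> exp x <= exp y.
Proof. intros [H| ->]; [left; apply exp_increasing; auto|right; auto]. Qed.

Lemma pow_exp_bound (a : nat) c : 0 < c -> exists B, 0 < B /\
  forall x, 0 <= x -> x ^ a * exp (- (c * x)) <= B.
Proof.
  revert c. induction a; intros c Hc.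
  - exists 1. split. lra. intros x Hx. rewrite pow_O, Rmult_1_l, <- exp_0.
    assert (0 <= c * x) by (apply Rmult_le_pos; lra).
    destruct (Req_dec (c * x) 0) as [->|]. rewrite Ropp_0; lra. left; apply exp_increasing; lra.
  (* Half of the exponential absorbs one factor x, by t < exp t; the other half serves the induction
     hypothesis. *)
  - destruct (IHa (c / 2)) as [B [HB H]]. lra.
    exists (2 / c * B). assert (0 < 2 / c) by (apply Rdiv_lt_0_compat; lra).
    split. apply Rmult_lt_0_compat; auto.
    intros x Hx. specialize (H x Hx).
    replace (- (c * x)) with (- (c / 2 * x) + - (c / 2 * x)) by field.
    rewrite exp_plus.
    replace (x ^ S a * (exp (- (c / 2 * x)) * exp (- (c / 2 * x)))) with
      ((x * exp (- (c / 2 * x))) * (x ^ a * exp (- (c / 2 * x)))) by (simpl; ring).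
    apply Rmult_le_compat; auto.
    + apply Rmult_le_pos; auto. left; apply exp_pos.
    + apply Rmult_le_pos. apply pow_le; auto. left; apply exp_pos.
    + rewrite exp_Ropp. set (t := c / 2 * x).
      assert (Ht : 0 <= t) by (unfold t; apply Rmult_le_pos; lra).
      assert (He : t < exp t).
      { assert (h := exp_ineq1_le t). lra. }
      replace x with (2 / c * t) by (unfold t; field; lra).
      rewrite Rmult_assoc. rewrite <- (Rmult_1_r (2 / c)) at 2. apply Rmult_le_compat_l. lra.
      apply Rmult_le_reg_r with (exp t). apply exp_pos. rewrite Rmult_assoc, Rinv_l; lra.
Qed.

Lemma wN_ge n : / (INR (S n) ^ 2) <= wN n.
Proof.
  assert (1 <= INR (S n)) by (rewrite S_INR; assert (h := pos_INR n); lra).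
  assert (1 <= sqrt (INR (S n))) by (rewrite <- sqrt_1; apply sqrt_le_1_alt; auto).
  assert (E := sqrt_sqrt (INR (S n)) ltac:(lra)).
  unfold wN. set (x := INR (S n)) in *. apply Rinv_le_contravar. apply Rmult_lt_0_compat; lra.
  rewrite <- Rsqr_pow2. unfold Rsqr. apply Rmult_le_compat_l; nra.
Qed.

Lemma wZ_ge n : / ((1 + Rabs (IZR n)) ^ 2) <= wZ n.
Proof.
  assert (h := Rabs_pos (IZR n)). set (a := 1 + Rabs (IZR n)). unfold wZ. fold a.
  assert (1 <= a) by (unfold a; lra).
  assert (1 <= sqrt a) by (rewrite <- sqrt_1; apply sqrt_le_1_alt; auto).
  assert (E := sqrt_sqrt a ltac:(lra)).
  apply Rinv_le_contravar. apply Rmult_lt_0_compat; lra.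
  rewrite <- Rsqr_pow2. unfold Rsqr. apply Rmult_le_compat_l; nra.
Qed.

(** The terms of the two sides of the Lipschitz formula. The index [d] of [Lterm] stands for the
    positive integer d + 1, and the formula of weight j + 1 pairs [Sterm (j + 1)] with [Lterm j]. *)
Definition Lterm (j : nat) (z : C) (d : nat) : C := (RtoC (INR (S d) ^ j) * ec z ^ S d)%C.
Definition Sterm (j : nat) (z : C) (n : Z) : C := (/ (z + RtoC (IZR n)) ^ j)%C.

Lemma RtoC_pow x n : RtoC (x ^ n) = (RtoC x ^ n)%C.
Proof. induction n. reflexivity. simpl pow. rewrite RtoC_mult, IHn. reflexivity. Qed.

(** The bound keeps one full factor [exp (- (2 * PI * Im z))] for the decay at the cusp and is still
    summable in [d]. *)
Lemma Lterm_bound j y0 : 0 < y0 -> exists B, 0 < B /\ forall z d, y0 <= Im z ->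
  Cmod (Lterm j z d) <= B * exp (- (2 * PI * Im z)) * wN d.
Proof.
  intros Hy. assert (hp := PI_RGT_0).
  assert (Hc : 0 < 2 * PI * y0) by (apply Rmult_lt_0_compat; lra).
  (* [j] powers come from the term and two more from the comparison of 1 / x^2 with [wN]. *)
  destruct (pow_exp_bound (j + 2) _ Hc) as [B [HB H]].
  exists (B * exp (2 * PI * y0)). split. apply Rmult_lt_0_compat; auto; apply exp_pos.
  intros z d Hz. unfold Lterm. rewrite Cmod_mult, Cmod_R, Cmod_pow, Cmod_ec.
  set (x := INR (S d)). assert (Hx : 1 <= x) by (unfold x; rewrite S_INR; assert (h := pos_INR d); lra).
  rewrite Rabs_pos_eq by (apply pow_le; lra).
  (* This is (x - 1) (Im z - y0) >= 0: one factor stays at height Im z and the others are bounded by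
     their value at height y0. *)
  assert (E : exp (- (2 * PI * Im z)) ^ S d <=
     exp (2 * PI * y0) * exp (- (2 * PI * Im z)) * exp (- (2 * PI * y0 * x))).
  { rewrite <- !exp_plus.
    assert (forall t n, exp t ^ n = exp (INR n * t)) as ->.
    { intros t n. induction n. simpl. rewrite Rmult_0_l, exp_0. reflexivity.
      simpl pow. rewrite IHn, <- exp_plus, S_INR. f_equal. ring. }
    fold x. apply exp_mono.
    assert (0 <= (x - 1) * (2 * PI * (Im z - y0))).
    { apply Rmult_le_pos. lra. apply Rmult_le_pos; lra. } nra. }
  apply Rle_trans with (x ^ j * (exp (2 * PI * y0) * exp (- (2 * PI * Im z)) * exp (- (2 * PI * y0 * x)))).
  { apply Rmult_le_compat_l; auto. apply pow_le; lra. }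
  specialize (H x ltac:(lra)).
  apply Rle_trans with (exp (2 * PI * y0) * exp (- (2 * PI * Im z)) * (B * / x ^ 2)).
  - replace (x ^ j * (exp (2 * PI * y0) * exp (- (2 * PI * Im z)) * exp (- (2 * PI * y0 * x)))) with
      (exp (2 * PI * y0) * exp (- (2 * PI * Im z)) * ((x ^ (j + 2) * exp (- (2 * PI * y0 * x))) * / x ^ 2)).
    2:{ rewrite pow_add. field. lra. }
    apply Rmult_le_compat_l. apply Rmult_le_pos; left; apply exp_pos.
    apply Rmult_le_compat_r; auto. left; apply Rinv_0_lt_compat, pow_lt; lra.
  - replace (B * exp (2 * PI * y0) * exp (- (2 * PI * Im z)) * wN d) with
      (exp (2 * PI * y0) * exp (- (2 * PI * Im z)) * (B * wN d)) by ring.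
    apply Rmult_le_compat_l. apply Rmult_le_pos; left; apply exp_pos.
    apply Rmult_le_compat_l. lra. apply wN_ge.
Qed.

Lemma Lterm_bound_unif j y0 : 0 < y0 -> exists B, 0 < B /\ forall z d, y0 <= Im z ->
  Cmod (Lterm j z d) <= B * wN d.
Proof.
  intros Hy. destruct (Lterm_bound j y0 Hy) as [B [HB H]]. exists B. split; auto.
  intros z d Hz. eapply Rle_trans. apply (H z d Hz).
  rewrite Rmult_assoc. apply Rmult_le_compat_l. lra.
  rewrite <- (Rmult_1_l (wN d)) at 2. apply Rmult_le_compat_r.
  apply (proj1 rsummable_wN). rewrite <- Cmod_ec. left. apply Cmod_ec_lt. lra.
Qed.

Lemma Lterm_usum j z : 0 < Im z -> usum (Lterm j z) (tsum (Lterm j z)).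
Proof.
  intros Hz. destruct (Lterm_bound_unif j (Im z) Hz) as [B [HB H]].
  apply (tsum_spec _ (fun d => B * wN d)). intros; apply H; lra.
  apply rsummable_scal. lra. apply rsummable_wN.
Qed.

Lemma Sterm_bound j y0 K : (2 <= j)%nat -> 0 < y0 -> exists B, 0 < B /\ forall z n,
  y0 <= Im z -> Cmod z <= K -> Cmod (Sterm j z n) <= B * wZ n.
Proof.
  intros Hj Hy. destruct (lin_lower y0 K Hy) as [c [[Hc Hc1] H]].
  assert (0 < c ^ j) by (apply pow_lt; auto).
  exists (/ c ^ j). split. apply Rinv_0_lt_compat; auto.
  intros z n Hz Hk. unfold Sterm.
  specialize (H z Hz Hk 1 (IZR n)). rewrite Rabs_R1, Cmult_1_l in H.
  assert (hn := Rabs_pos (IZR n)). set (a := 1 + Rabs (IZR n)) in *.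
  assert (Ha : 1 <= a) by (unfold a; lra).
  assert (Hca : 0 < c * a) by (apply Rmult_lt_0_compat; lra).
  assert (Hnz : (z + RtoC (IZR n))%C <> RtoC 0) by (apply Cmod_gt_0; lra).
  rewrite Cmod_inv, Cmod_pow by (apply Cpow_nz; auto).
  apply Rle_trans with (/ (c * a) ^ j).
  { apply Rinv_le_contravar. apply pow_lt; auto. apply pow_incr; lra. }
  rewrite Rpow_mult_distr, Rinv_mult. apply Rmult_le_compat_l.
  left; apply Rinv_0_lt_compat; auto.
  eapply Rle_trans; [|apply wZ_ge]. fold a.
  apply Rinv_le_contravar. apply pow_lt; lra. apply Rle_pow; auto.
Qed.

Lemma Sterm_usum j z : (2 <= j)%nat -> 0 < Im z -> usum (Sterm j z) (tsum (Sterm j z)).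
Proof.
  intros Hj Hz. destruct (Sterm_bound j (Im z) (Cmod z) Hj Hz) as [B [HB H]].
  apply (tsum_spec _ (fun d => B * wZ d)). intros; apply H; lra.
  apply rsummable_scal. lra. apply rsummable_wZ.
Qed.

Lemma shift_nz z n : 0 < Im z -> (z + RtoC (IZR n))%C <> RtoC 0.
Proof. intros Hz E. apply (f_equal Im) in E. rewrite Im_plus in E. simpl in E. lra. Qed.

Lemma cder_ec z t : cder (fun s => ec (z + RtoC s)) t (RtoC (2 * PI) * Ci * ec (z + RtoC t))%C.
Proof.
  unfold ec. apply (cder_cexp (fun s => (RtoC (2 * PI) * Ci * (z + RtoC s))%C)).
  eapply cder_eq; [|apply cder_scal; eapply cder_ext; [|apply (cder_line z (RtoC 1))]].
  simpl; ring. intros; simpl. ring.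
Qed.

Lemma cder_Lterm j z t d :
  cder (fun s => Lterm j (z + RtoC s) d) t (RtoC (2 * PI) * Ci * Lterm (S j) (z + RtoC t) d)%C.
Proof.
  unfold Lterm. eapply cder_eq; [|apply cder_scal, cder_pow, cder_ec].
  change (INR (S d) ^ S j) with (INR (S d) * INR (S d) ^ j).
  rewrite (RtoC_mult (INR (S d)) (INR (S d) ^ j)). rewrite Cpow_S. ring.
Qed.

Lemma cder_Sterm j z t n : 0 < Im z ->
  cder (fun s => Sterm (S j) (z + RtoC s) n) t (RtoC (- INR (S j)) * Sterm (S (S j)) (z + RtoC t) n)%C.
Proof.
  intros Hz. unfold Sterm.
  assert (N : forall s, (z + RtoC s + RtoC (IZR n))%C <> RtoC 0).
  { intros s. apply shift_nz. rewrite Im_plus. simpl. lra. }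
  eapply cder_eq; [|apply cder_inv].
  3:{ apply (cder_pow (fun s => z + RtoC s + RtoC (IZR n))%C).
      eapply cder_ext; [|apply (cder_line (z + RtoC (IZR n)) (RtoC 1))]. intros; simpl; ring. }
  2:{ apply Cpow_nz. auto. }
  simpl. set (u := (z + RtoC t + RtoC (IZR n))%C). assert (Nu : u <> RtoC 0) by apply N.
  assert (NP : (u ^ j)%C <> RtoC 0) by (apply Cpow_nz; auto).
  rewrite RtoC_opp. set (x := RtoC _). field. auto.
Qed.

Lemma cder_tsum_L j z : 0 < Im z ->
  cder (fun s => tsum (Lterm j (z + RtoC s))) 0 (RtoC (2 * PI) * Ci * tsum (Lterm (S j) z))%C.
Proof.
  intros Hz. destruct (Lterm_bound_unif (S j) (Im z) Hz) as [B [HB H]].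
  assert (I : forall t, Im (z + RtoC t)%C = Im z) by (intros; rewrite Im_plus; simpl; ring).
  apply (cder_usum (fun s => Lterm j (z + RtoC s))
    (fun s d => RtoC (2 * PI) * Ci * Lterm (S j) (z + RtoC s) d)%C
    (fun d => Cmod (RtoC (2 * PI) * Ci)%C * (B * wN d)) _ _ 1).
  - lra.
  - apply rsummable_scal. apply Cmod_ge_0. apply rsummable_scal. lra. apply rsummable_wN.
  - intros t _ d. split. apply cder_Lterm. rewrite Cmod_mult.
    apply Rmult_le_compat_l. apply Cmod_ge_0. apply H. rewrite I. lra.
  - intros t _. apply Lterm_usum. rewrite I. auto.
  - apply usum_scal. replace (z + RtoC 0)%C with z by ring. apply Lterm_usum; auto.
Qed.

Lemma cder_tsum_S j z : (1 <= j)%nat -> 0 < Im z ->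
  cder (fun s => tsum (Sterm (S j) (z + RtoC s))) 0 (RtoC (- INR (S j)) * tsum (Sterm (S (S j)) z))%C.
Proof.
  intros Hj Hz. destruct (Sterm_bound (S (S j)) (Im z) (Cmod z + 1) ltac:(lia) Hz) as [B [HB H]].
  assert (I : forall t, Im (z + RtoC t)%C = Im z) by (intros; rewrite Im_plus; simpl; ring).
  apply (cder_usum (fun s => Sterm (S j) (z + RtoC s))
    (fun s d => RtoC (- INR (S j)) * Sterm (S (S j)) (z + RtoC s) d)%C
    (fun d => Cmod (RtoC (- INR (S j))) * (B * wZ d)) _ _ 1).
  - lra.
  - apply rsummable_scal. apply Cmod_ge_0. apply rsummable_scal. lra. apply rsummable_wZ.
  - intros t Ht d. split. apply cder_Sterm; auto. rewrite Cmod_mult.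
    apply Rmult_le_compat_l. apply Cmod_ge_0. apply H. rewrite I. lra.
    eapply Rle_trans. apply Cmod_triangle. rewrite Cmod_R. rewrite Rminus_0_r in Ht. lra.
  - intros t _. apply Sterm_usum. lia. rewrite I. auto.
  - apply usum_scal. replace (z + RtoC 0)%C with z by ring. apply Sterm_usum; auto. lia.
Qed.

(** Geometric series: removing the term of index 0 and shifting the index multiplies the sum by
    [ec z]. *)
Lemma tsum_Lterm_0 z : 0 < Im z -> (tsum (Lterm 0 z) * (1 - ec z) = ec z)%C.
Proof.
  intros Hz. assert (U := Lterm_usum 0 z Hz).
  set (S0 := tsum (Lterm 0 z)) in *.
  assert (A := usum_minus _ _ _ _ U (usum_scal _ _ (ec z) U)). cbv beta in A.
  assert (SG : usum (fun d => if Nat.eqb d 0 then ec z else RtoC 0) (ec z)).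
  { apply (usum_single (fun d => if Nat.eqb d 0 then ec z else RtoC 0) 0%nat).
    intros [|t] Ht; simpl; auto. congruence. }
  assert (Bq : usum (fun d => Lterm 0 z d - (if Nat.eqb d 0 then ec z else RtoC 0))%C (S0 - ec z)%C)
    by (apply usum_minus; auto).
  assert (C1 : usum (fun d => ec z * Lterm 0 z d)%C (S0 - ec z)%C).
  { apply (usum_inj S) in Bq.
    - eapply usum_ext; [|apply Bq]. intros d. unfold Lterm; simpl. ring.
    - intros; lia.
    - intros [|d] Hd. exfalso. apply Hd. unfold Lterm; simpl. ring. exists d; auto. }
  assert (E := usum_unique _ _ _ C1 (usum_scal _ _ (ec z) U)).
  replace (S0 * (1 - ec z))%C with (S0 - ec z * S0)%C by ring. rewrite <- E. ring.
Qed.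

Lemma ec_ne1 z : 0 < Im z -> (1 - ec z)%C <> RtoC 0.
Proof.
  intros Hz E. assert (h := Cmod_ec_lt z Hz).
  replace (ec z) with (1 - (1 - ec z))%C in h by ring. rewrite E in h.
  replace (1 - 0)%C with (RtoC 1) in h by ring. rewrite Cmod_1 in h. lra.
Qed.

(** The derivative of the geometric series along the horizontal line through z, computed in two
    ways. *)
Lemma tsum_Lterm_1 z : 0 < Im z -> tsum (Lterm 1 z) = (ec z / (1 - ec z) ^ 2)%C.
Proof.
  intros Hz. assert (D := cder_tsum_L 0 z Hz).
  assert (I : forall t, Im (z + RtoC t)%C = Im z) by (intros; rewrite Im_plus; simpl; ring).
  assert (N : forall t, (1 - ec (z + RtoC t))%C <> RtoC 0) by (intros; apply ec_ne1; rewrite I; auto).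
  apply (cder_ext _ (fun s => ec (z + RtoC s) * / (1 - ec (z + RtoC s)))%C) in D.
  2:{ intros s. assert (E := tsum_Lterm_0 (z + RtoC s)%C ltac:(rewrite I; auto)).
      specialize (N s). set (q := ec (z + RtoC s)) in *. set (L := tsum (Lterm 0 (z + RtoC s))) in *.
      replace L with (L * (1 - q) * / (1 - q))%C by (field; auto). rewrite E. reflexivity. }
  assert (D' := cder_mult _ _ _ _ _ (cder_ec z 0)
     (cder_inv _ _ _ (N 0) (cder_minus _ _ _ _ _ (cder_const (RtoC 1) 0) (cder_ec z 0)))).
  assert (E := cder_unique _ _ _ _ D D'). cbv beta in E.
  replace (z + RtoC 0)%C with z in E by ring.
  assert (Nz := ec_ne1 z Hz).
  assert (N2 : (RtoC (2 * PI) * Ci)%C <> RtoC 0).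
  { apply Cmult_neq_0. intros X. apply RtoC_inj in X. assert (h := PI_RGT_0). lra. apply Ci_nz. }
  set (a := (RtoC (2 * PI) * Ci)%C) in *.
  replace (tsum (Lterm 1 z)) with (/ a * (a * tsum (Lterm 1 z)))%C by (field; auto).
  rewrite E. field. split; auto.
Qed.

Lemma tsum_bij {T U} (phi : T -> U) (psi : U -> T) (F : U -> C) :
  (forall t, psi (phi t) = t) -> (forall u, phi (psi u) = u) ->
  tsum (fun t => F (phi t)) = tsum F.
Proof.
  intros H1 H2. unfold tsum. f_equal. apply functional_extensionality. intros S.
  apply propositional_extensionality, (usum_bij phi psi); auto.
Qed.

Lemma Sterm_shift j z m : tsum (Sterm j (z + RtoC (IZR m))%C) = tsum (Sterm j z).
Proof.
  rewrite <- (tsum_bij (fun n => (n + m)%Z) (fun n => (n - m)%Z) (Sterm j z)) by (intros; lia).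
  apply tsum_ext. intros n. unfold Sterm. f_equal. f_equal. rewrite plus_IZR, RtoC_plus. ring.
Qed.

Lemma usum_Z_parity (F : Z -> C) A B :
  usum (fun n => F (2 * n)%Z) A -> usum (fun n => F (2 * n + 1)%Z) B -> usum F (A + B)%C.
Proof.
  intros HA HB.
  assert (UA : usum (fun n => if Z.even n then F n else RtoC 0) A).
  { apply (usum_inj (fun n => (2 * n)%Z)).
    - intros; lia.
    - intros u Hu. destruct (Z.even u) eqn:E; [|congruence].
      apply Z.even_spec in E. destruct E as [m ->]. exists m; auto.
    - eapply usum_ext; [|apply HA]. intros n. cbv beta. rewrite Z.even_mul. reflexivity. }
  assert (UB : usum (fun n => if Z.even n then RtoC 0 else F n) B).
  { apply (usum_inj (fun n => (2 * n + 1)%Z)).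
    - intros; lia.
    - intros u Hu. destruct (Z.even u) eqn:E; [congruence|].
      assert (O : Z.odd u = true) by (rewrite <- Z.negb_even, E; auto).
      apply Z.odd_spec in O. destruct O as [m ->]. exists m; auto.
    - eapply usum_ext; [|apply HB]. intros n. cbv beta. rewrite Z.even_add, Z.even_mul. reflexivity. }
  eapply usum_ext; [|apply (usum_plus _ _ _ _ UA UB)]. intros n. cbv beta.
  destruct (Z.even n); ring.
Qed.

(* 4 pi^2 q / (1 - q)^2 = - pi^2 / sin(pi z)^2, so [LD] is the difference of the two
   sides of the Lipschitz formula of weight 2. *)
Definition LD (z : C) : C :=
  (tsum (Sterm 2 z) + RtoC (4 * PI ^ 2) * (ec z / (1 - ec z) ^ 2))%C.

Lemma LD_shift z m : LD (z + RtoC (IZR m))%C = LD z.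
Proof. unfold LD. rewrite Sterm_shift, ec_add, ec_Z, Cmult_1_r. reflexivity. Qed.

Lemma Im_half z m : Im ((z + RtoC m) / RtoC 2)%C = Im z / 2.
Proof. unfold Cdiv. simpl. unfold Im. field. Qed.

(** Even and odd n separate the lattice sum at z into those at z/2 and (z+1)/2, since z + 2 n = 2
    (z/2 + n). On the other side [ec] takes the values s and -s at these points, with s^2 = [ec z],
    and 4 s^2 / (1 - s^2)^2 = s / (1 - s)^2 - s / (1 + s)^2. *)
Lemma LD_double z : 0 < Im z ->
  (RtoC 4 * LD z = LD ((z + RtoC 0) / RtoC 2) + LD ((z + RtoC 1) / RtoC 2))%C.
Proof.
  intros Hz. unfold LD.
  assert (H2 : RtoC 2 <> RtoC 0) by (intros E; apply RtoC_inj in E; lra).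
  assert (P0 : 0 < Im ((z + RtoC 0) / RtoC 2)%C) by (rewrite Im_half; lra).
  assert (P1 : 0 < Im ((z + RtoC 1) / RtoC 2)%C) by (rewrite Im_half; lra).
  assert (E1 : (RtoC 4 * tsum (Sterm 2 z) =
    tsum (Sterm 2 ((z + RtoC 0) / RtoC 2)) + tsum (Sterm 2 ((z + RtoC 1) / RtoC 2)))%C).
  { apply (usum_unique (fun n => RtoC 4 * Sterm 2 z n)%C).
    - apply usum_scal, Sterm_usum; auto.
    - apply usum_Z_parity.
      + eapply usum_ext; [|apply (Sterm_usum 2 _ ltac:(lia) P0)].
        intros n. unfold Sterm. rewrite mult_IZR, RtoC_mult.
        assert (N := shift_nz z (2 * n) Hz). rewrite mult_IZR, RtoC_mult in N.
        replace ((z + RtoC 0) / RtoC 2 + RtoC (IZR n))%C with ((z + RtoC 2 * RtoC (IZR n)) * / RtoC 2)%C by (field; auto).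
        set (a := (z + RtoC 2 * RtoC (IZR n))%C) in *.
        replace (RtoC 4) with (RtoC 2 * RtoC 2)%C by (rewrite <- RtoC_mult; f_equal; ring).
        field. auto.
      + eapply usum_ext; [|apply (Sterm_usum 2 _ ltac:(lia) P1)].
        intros n. unfold Sterm. rewrite plus_IZR, mult_IZR, RtoC_plus, RtoC_mult.
        assert (N := shift_nz z (2 * n + 1) Hz). rewrite plus_IZR, mult_IZR, RtoC_plus, RtoC_mult in N.
        replace ((z + RtoC 1) / RtoC 2 + RtoC (IZR n))%C with ((z + (RtoC 2 * RtoC (IZR n) + RtoC 1)) * / RtoC 2)%C by (field; auto).
        set (a := (z + (RtoC 2 * RtoC (IZR n) + RtoC 1))%C) in *.
        replace (RtoC 4) with (RtoC 2 * RtoC 2)%C by (rewrite <- RtoC_mult; f_equal; ring).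
        field. auto. }
  set (s := ec ((z + RtoC 0) / RtoC 2)%C).
  assert (Es : (s * s = ec z)%C).
  { unfold s. rewrite <- ec_add. f_equal. field. }
  assert (Es' : ec ((z + RtoC 1) / RtoC 2)%C = (- s)%C).
  { replace ((z + RtoC 1) / RtoC 2)%C with ((z + RtoC 0) / RtoC 2 + RtoC (/ 2))%C.
    2:{ rewrite RtoC_inv by lra. field. }
    rewrite ec_add. fold s. unfold ec, cexp. simpl.
    replace ((2 * PI * 0 - 0 * 1) * / 2 - (2 * PI * 1 + 0 * 0) * 0) with 0 by ring.
    replace ((2 * PI * 0 - 0 * 1) * 0 + (2 * PI * 1 + 0 * 0) * / 2) with PI by field.
    rewrite exp_0, cos_PI, sin_PI. apply C_eq; simpl; ring. }
  assert (N1 := ec_ne1 _ P0). assert (N2 := ec_ne1 _ P1). assert (N3 := ec_ne1 _ Hz).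
  rewrite Es' in *. fold s in N1. rewrite <- Es in *.
  rewrite Cmult_plus_distr_l, E1. fold s.
  set (q := RtoC (4 * PI ^ 2)).
  replace (RtoC 4) with (RtoC 2 * RtoC 2)%C by (rewrite <- RtoC_mult; f_equal; ring).
  replace (RtoC 2) with (RtoC 1 + RtoC 1)%C by (rewrite <- RtoC_plus; f_equal; ring).
  set (A := tsum _). set (B := tsum _).
  replace (1 - - s)%C with (1 + s)%C in * by ring.
  field. repeat split; auto.
Qed.

(** * Cancellation of the double pole *)

Lemma sin_ge_third b : Rabs b <= PI / 2 -> b ^ 2 / 9 <= sin b ^ 2.
Proof.
  assert (hp := PI_RGT_0). assert (hp4 := PI_4).
  assert (K : forall b, 0 <= b <= PI / 2 -> b ^ 2 / 9 <= sin b ^ 2).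
  { intros c Hc. destruct (sin_bound c 0) as [H _]; try lra.
    unfold sin_approx, sin_term in H. simpl in H.
    assert (H' : c - c ^ 3 / 6 <= sin c) by (eapply Rle_trans; [|apply H]; right; field).
    (* As c <= 2, the cubic term takes away at most two thirds of c. *)
    assert (c / 3 <= sin c).
    { eapply Rle_trans; [|apply H']. assert (c * c <= 4) by nra.
      replace (c - c ^ 3 / 6) with (c * (1 - c * c / 6)) by field. nra. }
    replace (c ^ 2 / 9) with ((c / 3) ^ 2) by field. apply pow_incr. lra. }
  intros Hb. destruct (Rle_dec 0 b).
  - apply K. rewrite Rabs_pos_eq in Hb by auto. lra.
  - replace (b ^ 2) with ((- b) ^ 2) by ring. replace (sin b ^ 2) with (sin (- b) ^ 2) by (rewrite sin_neg; ring).
    apply K. rewrite Rabs_left in Hb by lra. lra.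
Qed.

(** This is 2 sinh w. With w = pi i z one has q / (1 - q)^2 = 1 / (csh w)^2 for q = [ec z], which
    exhibits the pole at z = 0. *)
Definition csh (w : C) : C := (cexp w - cexp (- w))%C.

(** For w = a + i b, |csh w|^2 = (e^a - e^(-a))^2 + 4 sin(b)^2, where the first square is at least
    a^2 and the second summand at least 4 b^2 / 9. *)
Lemma csh_lower w : Rabs (Im w) <= PI / 2 -> 2 / 3 * Cmod w <= Cmod (csh w).
Proof.
  intros Hb. assert (Hs := sin_ge_third _ Hb). destruct w as [a b]. simpl in Hs, Hb.
  assert (E : Cmod (csh (a, b)) ^ 2 = (exp a - exp (- a)) ^ 2 + 4 * sin b ^ 2).
  { unfold Cmod. rewrite pow2_sqrt by nra.
    unfold csh, cexp. simpl. rewrite cos_neg, sin_neg.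
    assert (H := sin2_cos2 b). unfold Rsqr in H.
    assert (X : exp a * exp (- a) = 1) by (rewrite <- exp_plus, Rplus_opp_r, exp_0; auto).
    set (u := exp a) in *. set (v := exp (- a)) in *. set (c := cos b) in *. set (s := sin b) in *.
    transitivity ((u - v) ^ 2 * (s * s + c * c) + 4 * (u * v) * (s * s)). ring.
    rewrite H, X. ring. }
  assert (E2 : Cmod (a, b) ^ 2 = a ^ 2 + b ^ 2).
  { unfold Cmod. rewrite pow2_sqrt; auto. simpl. nra. }
  assert (Ha : a ^ 2 <= (exp a - exp (- a)) ^ 2).
  { assert (K : forall t, 0 <= t -> t ^ 2 <= (exp t - exp (- t)) ^ 2).
    { intros t Ht. apply pow_incr. split; auto.
      assert (h1 := exp_ineq1_le t). assert (exp (- t) <= 1) by (rewrite <- exp_0; apply exp_mono; lra). lra. }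
    destruct (Rle_dec 0 a). apply K; auto.
    replace (a ^ 2) with ((- a) ^ 2) by ring.
    replace ((exp a - exp (- a)) ^ 2) with ((exp (- a) - exp (- - a)) ^ 2) by (rewrite Ropp_involutive; ring).
    apply K. lra. }
  assert (P1 := Cmod_ge_0 (a, b)). assert (P2 := Cmod_ge_0 (csh (a, b))).
  apply Rsqr_incr_0; auto. unfold Rsqr. nra. apply Rmult_le_pos; lra.
Qed.

(** A Taylor bound by three mean value estimates on [0, 1]: for E - E', for E + E' - 2 and for E -
    E' - 2 w t, where E = e^(w t) and E' = e^(-w t). Each derivative is w times the quantity
    estimated before, and each step costs a factor 2, so that 6 becomes 12, 24 and 48. *)
Lemma csh_approx w : Cmod w <= 1 -> Cmod (csh w - RtoC 2 * w)%C <= 48 * Cmod w ^ 3.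
Proof.
  intros Hw. set (r := Cmod w) in *. assert (Hr : 0 <= r) by apply Cmod_ge_0.
  set (E := fun t : R => cexp (w * RtoC t)). set (E' := fun t : R => cexp (- w * RtoC t)).
  assert (E0 : E 0 = RtoC 1) by (unfold E; rewrite <- cexp_0; f_equal; ring).
  assert (E0' : E' 0 = RtoC 1) by (unfold E'; rewrite <- cexp_0; f_equal; ring).
  assert (DE : forall t, cder E t (w * E t)%C).
  { intros t. apply (cder_cexp (fun t => w * RtoC t)%C).
    eapply cder_ext; [|apply (cder_line (RtoC 0) w)]. intros; simpl; ring. }
  assert (DE' : forall t, cder E' t (- w * E' t)%C).
  { intros t. apply (cder_cexp (fun t => - w * RtoC t)%C).
    eapply cder_ext; [|apply (cder_line (RtoC 0) (- w)%C)]. intros; simpl; ring. }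
  assert (B : forall t, Rabs t <= 1 -> Cmod (E t) <= 3 /\ Cmod (E' t) <= 3).
  { intros t Ht.
    assert (K : forall x : C, Cmod x <= 1 -> Cmod (cexp x) <= 3).
    { intros x Hx. rewrite Cmod_cexp. eapply Rle_trans; [|apply exp_le_3]. apply exp_mono.
      eapply Rle_trans. apply Rle_abs. eapply Rle_trans; [apply Re_le_Cmod|auto]. }
    assert (0 <= Rabs t) by apply Rabs_pos.
    split; apply K; rewrite Cmod_mult, ?Cmod_opp, Cmod_R; fold r; nra. }
  assert (A1 : forall t, Rabs t <= 1 -> Cmod (E t - E' t)%C <= 12 * r).
  { intros t Ht.
    assert (K : Cmod ((E t - E' t) - (E 0%R - E' 0%R))%C <= 2 * (6 * r) * Rabs (t - 0)).
    { apply (cmean_value (fun s => E s - E' s)%C (fun s => w * E s - - w * E' s)%C).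
      intros s Hs. rewrite !Rminus_0_r in Hs. split. apply cder_minus; auto.
      destruct (B s) as [B1 B2]. lra.
      replace (w * E s - - w * E' s)%C with (w * (E s + E' s))%C by ring.
      rewrite Cmod_mult. fold r.
      assert (Cmod (E s + E' s)%C <= 6) by (eapply Rle_trans; [apply Cmod_triangle|lra]). nra. }
    replace (E t - E' t - (E 0%R - E' 0%R))%C with (E t - E' t)%C in K.
    rewrite Rminus_0_r in K. nra.
    rewrite E0, E0'. ring. }
  assert (A2 : forall t, Rabs t <= 1 -> Cmod (E t + E' t - RtoC 2)%C <= 24 * r * r).
  { intros t Ht.
    assert (K : Cmod ((E t + E' t) - (E 0%R + E' 0%R))%C <= 2 * (r * (12 * r)) * Rabs (t - 0)).
    { apply (cmean_value (fun s => E s + E' s)%C (fun s => w * E s + - w * E' s)%C).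
      intros s Hs. rewrite !Rminus_0_r in Hs. split. apply cder_plus; auto.
      replace (w * E s + - w * E' s)%C with (w * (E s - E' s))%C by ring.
      rewrite Cmod_mult. fold r. apply Rmult_le_compat_l; auto. apply A1. lra. }
    replace (E t + E' t - (E 0%R + E' 0%R))%C with (E t + E' t - RtoC 2)%C in K.
    rewrite Rminus_0_r in K. assert (0 <= Rabs t) by apply Rabs_pos. nra.
    rewrite E0, E0'.
    replace (RtoC 2) with (RtoC 1 + RtoC 1)%C by (rewrite <- RtoC_plus; f_equal; ring). ring. }
  assert (K : Cmod ((E 1%R - E' 1%R - RtoC 2 * w * RtoC 1) - (E 0%R - E' 0%R - RtoC 2 * w * RtoC 0))%C
     <= 2 * (r * (24 * r * r)) * Rabs (1 - 0)).
  { apply (cmean_value (fun s => E s - E' s - RtoC 2 * w * RtoC s)%C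
      (fun s => w * E s - - w * E' s - RtoC 2 * w)%C).
    intros s Hs. rewrite !Rminus_0_r, Rabs_R1 in Hs. split.
    - apply cder_minus. apply cder_minus; auto.
      eapply cder_ext; [|apply (cder_line (RtoC 0) (RtoC 2 * w)%C)]. intros; simpl; ring.
    - replace (w * E s - - w * E' s - RtoC 2 * w)%C with (w * (E s + E' s - RtoC 2))%C by ring.
      rewrite Cmod_mult. fold r. apply Rmult_le_compat_l; auto. }
  replace (csh w - RtoC 2 * w)%C with ((E 1%R - E' 1%R - RtoC 2 * w * RtoC 1) - (E 0%R - E' 0%R - RtoC 2 * w * RtoC 0))%C.
  - eapply Rle_trans. apply K. rewrite Rminus_0_r, Rabs_R1. right. ring.
  - unfold E, E', csh. replace (w * RtoC 1)%C with w by ring. replace (- w * RtoC 1)%C with (- w)%C by ring.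
    replace (w * RtoC 0)%C with (RtoC 0) by ring. replace (- w * RtoC 0)%C with (RtoC 0) by ring. ring.
Qed.

(** Near 0 the difference factors through (csh w - 2 w) (csh w + 2 w), which is at most 48 r^3 times
    52 r, over a denominator of at least (4/9) r^2 times 4 r^2; this gives 48 * 52 * 9 / 16 = 1404.
    For r > 1 both terms are bounded separately. *)
Lemma csh_inv_bound w : w <> RtoC 0 -> Rabs (Im w) <= PI / 2 ->
  Cmod (/ csh w ^ 2 - / (RtoC 2 * w) ^ 2)%C <= 1500.
Proof.
  intros Hw Hb. assert (L := csh_lower w Hb).
  assert (Hr : 0 < Cmod w) by (apply Cmod_gt_0; auto).
  assert (Hs : csh w <> RtoC 0) by (apply Cmod_gt_0; lra).
  assert (H2 : RtoC 2 <> RtoC 0) by (intros E; apply RtoC_inj in E; lra).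
  assert (M2 : Cmod (RtoC 2) = 2) by (rewrite Cmod_R, Rabs_pos_eq; lra).
  set (r := Cmod w) in *. set (s := Cmod (csh w)) in *.
  destruct (Rle_dec r 1) as [H|H].
  - assert (A := csh_approx w H). fold r in A.
    replace (/ csh w ^ 2 - / (RtoC 2 * w) ^ 2)%C with
      (- ((csh w - RtoC 2 * w) * (csh w - RtoC 2 * w + RtoC 4 * w)) * / (csh w * csh w * (RtoC 4 * w * w)))%C.
    2:{ replace (RtoC 4) with (RtoC 2 * RtoC 2)%C by (rewrite <- RtoC_mult; f_equal; ring).
        field. auto. }
    assert (M4 : Cmod (RtoC 4) = 4) by (rewrite Cmod_R, Rabs_pos_eq; lra).
    assert (H4 : RtoC 4 <> RtoC 0) by (intros E; apply RtoC_inj in E; lra).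
    rewrite Cmod_mult, Cmod_opp, Cmod_mult, Cmod_inv by (repeat apply Cmult_neq_0; auto).
    rewrite !Cmod_mult, M4. fold r s.
    assert (A2 : Cmod (csh w - RtoC 2 * w + RtoC 4 * w)%C <= 52 * r).
    { eapply Rle_trans. apply Cmod_triangle. rewrite (Cmod_mult (RtoC 4)), M4. fold r.
      assert (r ^ 3 <= r) by (simpl; assert (r * r <= 1) by nra; nra). lra. }
    assert (P0 : 0 < s * s * (4 * r * r)) by (repeat apply Rmult_lt_0_compat; lra).
    apply Rmult_le_reg_r with (s * s * (4 * r * r)); auto.
    rewrite Rmult_assoc, Rinv_l, Rmult_1_r by lra.
    apply Rle_trans with ((48 * r ^ 3) * (52 * r)).
    { apply Rmult_le_compat; auto using Cmod_ge_0. }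
    assert (4 / 9 * r * r <= s * s) by nra.
    assert (0 < r * r) by nra. assert (0 < r * r * (r * r)) by nra. simpl.
    assert (4/9 * r * r * (4 * r * r) <= s * s * (4 * r * r)) by (apply Rmult_le_compat_r; nra). nra.
  - eapply Rle_trans. apply Cmod_triangle. rewrite Cmod_opp.
    rewrite !Cmod_inv, !Cmod_pow, Cmod_mult, M2 by (apply Cpow_nz; auto using Cmult_neq_0). fold r s.
    assert (/ s ^ 2 <= / (1/3) ^ 2) by (apply Rinv_le_contravar; [lra|apply pow_incr; lra]).
    assert (/ (2 * r) ^ 2 <= / 1 ^ 2) by (apply Rinv_le_contravar; [lra|apply pow_incr; lra]).
    lra.
Qed.

Lemma usum_off_zero z : 0 < Im z -> z <> RtoC 0 ->
  usum (fun n => if Z.eqb n 0 then RtoC 0 else Sterm 2 z n) (tsum (Sterm 2 z) - / z ^ 2)%C.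
Proof.
  intros Hz Hnz.
  assert (SG : usum (fun n => if Z.eqb n 0 then Sterm 2 z 0 else RtoC 0) (Sterm 2 z 0)).
  { apply (usum_single (fun n => if Z.eqb n 0 then Sterm 2 z 0 else RtoC 0) 0%Z).
    intros t Ht. apply Z.eqb_neq in Ht. rewrite Ht. reflexivity. }
  assert (U := usum_minus _ _ _ _ (Sterm_usum 2 z ltac:(lia) Hz) SG).
  replace (/ z ^ 2)%C with (Sterm 2 z 0).
  - eapply usum_ext; [|apply U]. intros n. cbv beta. destruct (Z.eqb_spec n 0); subst; ring.
  - unfold Sterm. rewrite Cplus_0_r. reflexivity.
Qed.

(** In the strip |Re z| <= 1/2 the only unbounded term of the lattice sum is that of n = 0. It
    equals -4 pi^2 / (2 w)^2 with w = pi i z and cancels the pole of the trigonometric side. *)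
Lemma LD_bounded : exists B, forall z, 0 < Im z -> Rabs (Re z) <= 1 / 2 -> Cmod (LD z) <= B.
Proof.
  assert (HW : rsummable (fun n => 16 * wZ n)) by (apply rsummable_scal; [lra|apply rsummable_wZ]).
  destruct HW as [_ [W HW]].
  exists (W + 4 * PI ^ 2 * 1500). intros z Hz Hx.
  assert (hp := PI_RGT_0).
  assert (Hnz : z <> RtoC 0) by (intros ->; simpl in Hz; lra).
  set (w := (RtoC PI * Ci * z)%C).
  assert (HP : RtoC PI <> RtoC 0) by (intros E; apply RtoC_inj in E; lra).
  assert (H2 : RtoC 2 <> RtoC 0) by (intros E; apply RtoC_inj in E; lra).
  assert (Hw : w <> RtoC 0) by (repeat apply Cmult_neq_0; auto using Ci_nz).
  assert (Hb : Rabs (Im w) <= PI / 2).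
  { unfold w. simpl. match goal with |- Rabs ?a <= _ => replace a with (PI * Re z) by (unfold Re; ring) end.
    rewrite Rabs_mult, (Rabs_pos_eq PI) by lra. nra. }
  assert (K := csh_inv_bound w Hw Hb).
  assert (L := csh_lower w Hb). assert (Hr : 0 < Cmod w) by (apply Cmod_gt_0; auto).
  assert (Hs : csh w <> RtoC 0) by (apply Cmod_gt_0; lra).
  assert (Eq : ec z = (cexp w * cexp w)%C).
  { rewrite <- cexp_add. unfold ec, w. f_equal. rewrite RtoC_mult.
    replace (RtoC 2) with (RtoC 1 + RtoC 1)%C by (rewrite <- RtoC_plus; f_equal; ring). ring. }
  assert (E1 : (ec z / (1 - ec z) ^ 2 = / csh w ^ 2)%C).
  { assert (N := ec_ne1 z Hz). assert (NE := cexp_nz w).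
    unfold csh in *. rewrite cexp_opp in *. rewrite Eq in *. set (e := cexp w) in *.
    assert (X : (e - / e = - (1 - e * e) * / e)%C) by (field; auto).
    rewrite X. field. auto. }
  assert (Ci2 : (Ci * Ci = - RtoC 1)%C) by (apply C_eq; simpl; ring).
  assert (E2 : (/ z ^ 2 = - (RtoC (4 * PI ^ 2) * / (RtoC 2 * w) ^ 2))%C).
  { unfold w. replace (RtoC (4 * PI ^ 2)) with ((RtoC 2 * RtoC PI) * (RtoC 2 * RtoC PI))%C
      by (rewrite <- !RtoC_mult; f_equal; ring).
    replace ((RtoC 2 * (RtoC PI * Ci * z)) ^ 2)%C with
      ((RtoC 2 * RtoC PI) * (RtoC 2 * RtoC PI) * (Ci * Ci) * (z * z))%C by ring.
    rewrite Ci2. field. auto. }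
  unfold LD. rewrite E1.
  replace (tsum (Sterm 2 z) + RtoC (4 * PI ^ 2) * / csh w ^ 2)%C with
    ((tsum (Sterm 2 z) - / z ^ 2) + RtoC (4 * PI ^ 2) * (/ csh w ^ 2 - / (RtoC 2 * w) ^ 2))%C
    by (rewrite E2; ring).
  eapply Rle_trans. apply Cmod_triangle. apply Rplus_le_compat.
  - apply (usum_norm _ (fun n => 16 * wZ n) _ _ (usum_off_zero z Hz Hnz)); auto.
    intros n. destruct (Z.eqb_spec n 0).
    + rewrite Cmod_0. assert (h := wZ_pos n). lra.
    + apply Rle_trans with (16 * / (1 + Rabs (IZR n)) ^ 2).
      2:{ apply Rmult_le_compat_l. lra. apply wZ_ge. }
      assert (Hn : 1 <= Rabs (IZR n)) by (rewrite <- abs_IZR; apply IZR_le; lia).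
      unfold Sterm. assert (N := shift_nz z n Hz).
      rewrite Cmod_inv, Cmod_pow by (apply Cpow_nz; auto).
      set (a := Rabs (IZR n)) in *.
      (* |z + n| >= |n| - 1/2, which is at least (1 + |n|) / 4 for |n| >= 1. Squaring gives the
         factor 16. *)
      assert (A : (1 + a) / 4 <= Cmod (z + RtoC (IZR n))%C).
      { eapply Rle_trans; [|apply Re_le_Cmod]. rewrite Re_plus. simpl.
        assert (h := Rabs_triang (Re z + IZR n) (- Re z)). rewrite Rabs_Ropp in h.
        replace (Re z + IZR n + - Re z) with (IZR n) in h by ring. fold a in h. lra. }
      apply Rle_trans with (/ ((1 + a) / 4) ^ 2).
      * apply Rinv_le_contravar. apply pow_lt; lra. apply pow_incr; lra.
      * right. field. lra.
  - assert (0 <= PI ^ 2) by (apply pow_le; lra).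
    rewrite Cmod_mult, Cmod_R, Rabs_pos_eq by lra.
    apply Rmult_le_compat_l; lra.
Qed.

Lemma LD_zero z : 0 < Im z -> LD z = RtoC 0.
Proof.
  destruct LD_bounded as [B0 HB0].
  assert (HB : forall z, 0 < Im z -> Cmod (LD z) <= B0).
  { intros y Hy. set (m := Int_part (Re y + 1 / 2)).
    rewrite <- (LD_shift y (- m)). apply HB0.
    - rewrite Im_plus. simpl. lra.
    - rewrite Re_plus, opp_IZR. simpl. destruct (base_Int_part (Re y + 1 / 2)) as [b1 b2].
      fold m in b1, b2. apply Rabs_le. lra. }
  assert (HI : forall n z, 0 < Im z -> Cmod (LD z) <= B0 / 2 ^ n).
  { induction n; intros y Hy. simpl. rewrite Rdiv_1_r. auto.
    assert (E := LD_double y Hy).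
    assert (M4 : Cmod (RtoC 4 * LD y)%C = 4 * Cmod (LD y)) by (rewrite Cmod_mult, Cmod_R, Rabs_pos_eq; lra).
    rewrite E in M4.
    assert (T := Cmod_triangle (LD ((y + RtoC 0) / RtoC 2)%C) (LD ((y + RtoC 1) / RtoC 2)%C)).
    assert (h1 := IHn ((y + RtoC 0) / RtoC 2)%C ltac:(rewrite Im_half; lra)).
    assert (h2 := IHn ((y + RtoC 1) / RtoC 2)%C ltac:(rewrite Im_half; lra)).
    assert (0 < 2 ^ n) by (apply pow_lt; lra).
    replace (B0 / 2 ^ S n) with ((B0 / 2 ^ n) / 2) by (simpl; field; lra). lra. }
  intros Hz. apply Cmod_eq_0. apply Rle_antisym; [|apply Cmod_ge_0].
  apply Rnot_lt_le. intros Hp.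
  assert (hB : 0 < B0) by (specialize (HB z Hz); lra).
  destruct (Pow_x_infinity 2 ltac:(rewrite Rabs_pos_eq; lra) (B0 / Cmod (LD z) + 1)) as [n Hn].
  specialize (Hn n (Nat.le_refl _)). specialize (HI n z Hz).
  assert (P2 : 0 < 2 ^ n) by (apply pow_lt; lra).
  rewrite Rabs_pos_eq in Hn by lra.
  assert (Cmod (LD z) * 2 ^ n <= B0).
  { apply Rle_div_r in HI; auto. }
  assert (B0 < Cmod (LD z) * 2 ^ n); [|lra].
  replace B0 with (Cmod (LD z) * (B0 / Cmod (LD z))) at 1 by (field; lra).
  apply Rmult_lt_compat_l; auto. lra.
Qed.

(** Each derivative along a horizontal line raises the weight by one. The constant stays existential
    because only the shape of the right-hand side is used. *)
Lemma lipschitz j : exists c, forall z, 0 < Im z -> tsum (Sterm (S (S j)) z) = (c * tsum (Lterm (S j) z))%C.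
Proof.
  induction j as [|j [c IH]].
  - exists (- RtoC (4 * PI ^ 2))%C. intros z Hz. assert (H := LD_zero z Hz).
    unfold LD in H. rewrite <- tsum_Lterm_1 in H by auto.
    match goal with |- ?a = _ => replace a with (a + RtoC (4 * PI ^ 2) * tsum (Lterm 1 z) + - RtoC (4 * PI ^ 2) * tsum (Lterm 1 z))%C by ring end.
    rewrite H. ring.
  - set (x := RtoC (- INR (S (S j)))).
    assert (Hx : x <> RtoC 0).
    { intros E; apply RtoC_inj in E. assert (h : 0 < INR (S (S j))) by (apply lt_0_INR; lia). lra. }
    exists (/ x * c * (RtoC (2 * PI) * Ci))%C. intros z Hz.
    assert (D1 := cder_tsum_S (S j) z ltac:(lia) Hz).
    assert (D2 := cder_scal c _ _ _ (cder_tsum_L (S j) z Hz)).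
    apply (cder_ext _ (fun s => tsum (Sterm (S (S j)) (z + RtoC s)))) in D2.
    2:{ intros s. symmetry. apply IH. rewrite Im_plus. simpl. lra. }
    assert (E := cder_unique _ _ _ _ D1 D2). fold x in E.
    set (A := tsum (Sterm (S (S (S j))) z)) in *.
    replace A with (/ x * (x * A))%C by (field; auto). rewrite E. ring.
Qed.

Lemma Sterm_decay j : (2 <= j)%nat -> exists B, 0 < B /\
  forall z, 1 <= Im z -> Cmod (tsum (Sterm j z)) <= B * exp (- (2 * PI * Im z)).
Proof.
  intros Hj. destruct j as [|[|j]]; try lia.
  destruct (lipschitz j) as [c Hc]. destruct (Lterm_bound (S j) 1 ltac:(lra)) as [B [HB H]].
  destruct rsummable_wN as [_ [W HW]].
  assert (HW0 : 0 <= W) by (specialize (HW nil (NoDup_nil _)); unfold rsum in HW; simpl in HW; auto).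
  assert (Hcm := Cmod_ge_0 c).
  exists (Cmod c * B * W + 1). split.
  { assert (0 <= Cmod c * B * W) by (repeat apply Rmult_le_pos; lra). lra. }
  intros z Hz. rewrite Hc, Cmod_mult by lra.
  assert (K : Cmod (tsum (Lterm (S j) z)) <= B * exp (- (2 * PI * Im z)) * W).
  { apply (usum_norm _ _ _ _ (Lterm_usum (S j) z ltac:(lra)) (fun d => H z d Hz)).
    intros l Hl. rewrite rsum_scal. apply Rmult_le_compat_l; auto.
    apply Rmult_le_pos. lra. left; apply exp_pos. }
  assert (he := exp_pos (- (2 * PI * Im z))).
  apply Rmult_le_compat_l with (r := Cmod c) in K; auto. nra.
Qed.

Lemma Cpow_opp z j : ((- z) ^ j = (RtoC (-1)) ^ j * z ^ j)%C.
Proof. rewrite <- Cpow_mult_l. f_equal. ring. Qed.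

Lemma Cpow_m1_sq j : (RtoC (-1) ^ j * RtoC (-1) ^ j = RtoC 1)%C.
Proof.
  rewrite <- Cpow_mult_l. replace (RtoC (-1) * RtoC (-1))%C with (RtoC 1) by (apply C_eq; simpl; ring).
  apply Cpow_1_l.
Qed.

(** Carries the rows with m < 0, whose points lie in the lower half-plane, to the upper one. *)
Lemma Sterm_reflect j z n : Im z <> 0 -> Sterm j (- z)%C (- n) = (RtoC (-1) ^ j * Sterm j z n)%C.
Proof.
  intros Hz. unfold Sterm.
  replace (- z + RtoC (IZR (- n)))%C with (- (z + RtoC (IZR n)))%C by (rewrite opp_IZR, RtoC_opp; ring).
  rewrite Cpow_opp.
  assert (N : (z + RtoC (IZR n))%C <> RtoC 0).
  { intros E. apply Hz. apply (f_equal Im) in E. rewrite Im_plus in E. simpl in E. lra. }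
  assert (NP : ((z + RtoC (IZR n)) ^ j)%C <> RtoC 0) by (apply Cpow_nz; auto).
  assert (Q := Cpow_m1_sq j). set (e := (RtoC (-1) ^ j)%C) in *.
  assert (Ne : e <> RtoC 0).
  { intros X. rewrite X, Cmult_0_l in Q. apply RtoC_inj in Q. lra. }
  set (u := ((z + RtoC (IZR n)) ^ j)%C) in *.
  replace (/ (e * u))%C with (e * e * / (e * u))%C by (rewrite Q; ring). field. auto.
Qed.

(** * The Poisson sum *)

Definition pois (Y t : R) : R := Y / (t ^ 2 + Y ^ 2).

(** [pois Y] is the derivative of s |-> atan (s / Y). The error of one step of the Riemann sum is
    relative to the increment [d], so the errors add up to 2 / Y times the total increment, which is
    PI. *)
Lemma pois_step Y t : 1 <= Y -> exists d,
  atan ((t + 1) / Y) - atan (t / Y) = d /\ 0 <= d /\ Rabs (pois Y t - d) <= 2 / Y * d.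
Proof.
  intros HY.
  destruct (MVT_gen (fun s => atan (s / Y)) t (t + 1) (fun s => pois Y s)) as [x [Hx E]].
  - intros x _. unfold pois. auto_derive. auto. unfold Rsqr. field. split; nra.
  - intros x _. apply derivable_continuous_pt.
    apply ex_derive_Reals_0. auto_derive. auto.
  - rewrite Rmin_left, Rmax_right in Hx by lra.
    replace (t + 1 - t) with 1 in E by ring. rewrite Rmult_1_r in E.
    exists (pois Y x). split; auto.
    assert (P : forall s, 0 < pois Y s) by (intros s; unfold pois; apply Rdiv_lt_0_compat; nra).
    assert (Px := P x). assert (Pt := P t). split. lra.
    (* |x^2 - t^2| <= |x| + |t| for points at distance at most 1, and 2 Y |x| <= x^2 + Y^2. As Y >=
       1 this also gives pois t <= 3 pois x, hence the final factor 4 / (2 Y). *)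
    assert (D : Rabs (pois Y t - pois Y x) <= / (2 * Y) * (pois Y t + pois Y x)).
    { assert (Nt : 0 < t ^ 2 + Y ^ 2) by nra. assert (Nx : 0 < x ^ 2 + Y ^ 2) by nra.
      assert (En : pois Y t - pois Y x = Y * ((x - t) * (x + t)) * / ((t ^ 2 + Y ^ 2) * (x ^ 2 + Y ^ 2)))
        by (unfold pois; field; lra).
      assert (Es : / (2 * Y) * (pois Y t + pois Y x) = (x ^ 2 + Y ^ 2 + (t ^ 2 + Y ^ 2)) / 2 * / ((t ^ 2 + Y ^ 2) * (x ^ 2 + Y ^ 2)))
        by (unfold pois; field; lra).
      rewrite En, Es, Rabs_mult.
      assert (PN : 0 < / ((t ^ 2 + Y ^ 2) * (x ^ 2 + Y ^ 2))) by (apply Rinv_0_lt_compat, Rmult_lt_0_compat; auto).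
      rewrite (Rabs_pos_eq (/ _)) by lra. apply Rmult_le_compat_r. lra.
      rewrite Rabs_mult, (Rabs_pos_eq Y), Rabs_mult, (Rabs_pos_eq (x - t)) by lra.
      assert (Rabs (x + t) <= Rabs x + Rabs t) by apply Rabs_triang.
      assert (0 <= Rabs (x + t)) by apply Rabs_pos.
      rewrite <- (pow2_abs x), <- (pow2_abs t).
      set (p := Rabs x) in *. set (q := Rabs t) in *.
      assert (A : (x - t) * Rabs (x + t) <= 1 * (p + q)) by (apply Rmult_le_compat; lra).
      rewrite Rmult_1_l in A. apply Rmult_le_compat_l with (r := Y) in A; [|lra].
      assert (h1 := Rle_0_sqr (p - Y)). assert (h2 := Rle_0_sqr (q - Y)). unfold Rsqr in h1, h2. lra. }
    assert (HY2 : / (2 * Y) <= 1 / 2).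
    { replace (1 / 2) with (/ (2 * 1)) by field. apply Rinv_le_contravar; lra. }
    assert (D2 : pois Y t <= 3 * pois Y x).
    { assert (h := Rle_abs (pois Y t - pois Y x)).
      assert (/ (2 * Y) * (pois Y t + pois Y x) <= 1 / 2 * (pois Y t + pois Y x)) by (apply Rmult_le_compat_r; lra). lra. }
    eapply Rle_trans. apply D.
    replace (2 / Y * pois Y x) with (/ (2 * Y) * (4 * pois Y x)) by (field; lra).
    apply Rmult_le_compat_l; [|lra]. left. apply Rinv_0_lt_compat. lra.
Qed.

Lemma lsum_Zrange_telescope (f : Z -> R) n :
  lsum (fun i => RtoC (f (i + 1)%Z - f i)) (map (fun i => (Z.of_nat i - Z.of_nat n)%Z) (seq 0 (2 * n)))
  = RtoC (f (Z.of_nat n) - f (- Z.of_nat n)%Z).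
Proof.
  rewrite lsum_map.
  assert (H : forall m c, lsum (fun u => RtoC (f (Z.of_nat u - c + 1)%Z - f (Z.of_nat u - c)%Z)) (seq 0 m)
    = RtoC (f (Z.of_nat m - c)%Z - f (- c)%Z)).
  { induction m; intros c.
    - unfold lsum; simpl. f_equal. ring.
    - rewrite seq_S, lsum_app, IHm. unfold lsum; simpl fold_right. rewrite Cplus_0_r, <- RtoC_plus.
      f_equal. replace (Z.of_nat (S m) - c)%Z with (Z.of_nat (0 + m) - c + 1)%Z by lia.
      simpl. ring. }
  rewrite H. f_equal. f_equal. f_equal. lia.
Qed.

(** The domination provides a sum; its value is then read off along the ranges -n <= i < n, over
    which the terms telescope to f n - f (-n). *)
Lemma usum_Z_telescope (f : Z -> R) (M : Z -> R) (a b : R) :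
  (forall i, Rabs (f (i + 1)%Z - f i) <= M i) -> rsummable M ->
  (forall eps : posreal, exists n0, forall n, (n0 <= n)%nat ->
     Rabs (f (Z.of_nat n) - b) < eps /\ Rabs (f (- Z.of_nat n)%Z - a) < eps) ->
  usum (fun i => RtoC (f (i + 1)%Z - f i)) (RtoC (b - a)).
Proof.
  intros HM HS Hl. destruct (usum_exists (fun i => RtoC (f (i + 1)%Z - f i)) M) as [S HU]; auto.
  { intros i. rewrite Cmod_R. auto. }
  replace (RtoC (b - a)) with S; auto.
  apply NNPP. intros Hne.
  assert (Hp : 0 < Cmod (S - RtoC (b - a))%C) by (apply Cmod_gt_0; intros E; apply Hne, Ceq_minus; auto).
  assert (Hp3 : 0 < Cmod (S - RtoC (b - a))%C / 3) by lra.
  destruct (HU (mkposreal _ Hp3)) as [l0 H0]. destruct (Hl (mkposreal _ Hp3)) as [n0 Hn].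
  set (n := (n0 + Datatypes.S (list_max (map Z.abs_nat l0)))%nat).
  destruct (Hn n ltac:(unfold n; lia)) as [h1 h2]. simpl in h1, h2.
  specialize (H0 (map (fun i => (Z.of_nat i - Z.of_nat n)%Z) (seq 0 (2 * n)))).
  rewrite lsum_Zrange_telescope in H0. simpl in H0.
  assert (X : Cmod (RtoC (f (Z.of_nat n) - f (- Z.of_nat n)%Z) - S)%C < Cmod (S - RtoC (b - a))%C / 3).
  { apply H0.
    - apply FinFun.Injective_map_NoDup. intros x y; lia. apply seq_NoDup.
    - intros z Hz. apply in_map_iff. exists (Z.to_nat (z + Z.of_nat n)).
      assert (Z.abs_nat z <= list_max (map Z.abs_nat l0))%nat.
      { assert (h := proj1 (list_max_le (map Z.abs_nat l0) _) (Nat.le_refl _)).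
        rewrite Forall_forall in h. apply h. apply in_map; auto. }
      assert (Z.abs z < Z.of_nat n)%Z by (unfold n; lia).
      split. rewrite Z2Nat.id; lia. apply in_seq. lia. }
  assert (Cmod (S - RtoC (b - a))%C <= Cmod (RtoC (f (Z.of_nat n) - f (- Z.of_nat n)%Z) - S)%C
     + Cmod (RtoC (f (Z.of_nat n) - f (- Z.of_nat n)%Z - (b - a)))).
  { rewrite <- (Cmod_opp (_ - S)%C).
    eapply Rle_trans; [|apply Cmod_triangle]. right. f_equal.
    rewrite !RtoC_minus. ring. }
  rewrite Cmod_R in H.
  replace (f (Z.of_nat n) - f (- Z.of_nat n)%Z - (b - a)) with ((f (Z.of_nat n) - b) + - (f (- Z.of_nat n)%Z - a)) in H by ring.
  assert (h3 := Rabs_triang (f (Z.of_nat n) - b) (- (f (- Z.of_nat n)%Z - a))).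
  rewrite Rabs_Ropp in h3. lra.
Qed.

Lemma atan_lim (eps : posreal) : exists K, 0 < K /\ forall x, K <= x -> Rabs (atan x - PI / 2) < eps.
Proof.
  exists (/ eps + 1). assert (he := Rinv_0_lt_compat _ (cond_pos eps)). split. lra.
  intros x Hx. assert (Hxp : 0 < x) by lra.
  assert (E := atan_inv x Hxp).
  assert (B1 : 0 < atan (/ x)). { rewrite <- atan_0. apply atan_increasing. apply Rinv_0_lt_compat; auto. }
  assert (B2 : atan (/ x) <= / x).
  { assert (Hi : 0 < / x) by (apply Rinv_0_lt_compat; auto).
    destruct (MVT_gen atan 0 (/ x) (fun s => / (1 + s ^ 2))) as [c [Hc Ec]].
    - intros s _. auto_derive. auto. field. nra.
    - intros s _. apply derivable_continuous_pt, derivable_pt_atan.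
    - rewrite atan_0 in Ec. assert (/ (1 + c ^ 2) <= 1).
      { rewrite <- Rinv_1. apply Rinv_le_contravar; nra. } nra. }
  assert (/ x < eps).
  { rewrite <- (Rinv_inv eps). apply Rinv_lt_contravar. apply Rmult_lt_0_compat; auto. lra. }
  apply Rabs_def1; lra.
Qed.

Lemma pois_usum X Y : 1 <= Y -> exists S,
  usum (fun n => RtoC (pois Y (X + IZR n))) (RtoC S) /\ Rabs (S - PI) <= 2 * PI / Y.
Proof.
  intros HY. assert (hp := PI_RGT_0).
  set (w := (X, Y) : C).
  assert (P : forall s, 0 < pois Y s) by (intros s; unfold pois; apply Rdiv_lt_0_compat; nra).
  assert (HM : rsummable (fun n => pois Y (X + IZR n))).
  (* [pois Y (X + n)] is Y / |w + n|^2. *)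
  { destruct (Sterm_bound 2 Y (Cmod w) ltac:(lia) ltac:(lra)) as [B [HB H]].
    apply (rsummable_le _ (fun n => Y * (B * wZ n))).
    - intros n. split. left; auto. unfold pois, Rdiv. apply Rmult_le_compat_l. lra.
      specialize (H w n ltac:(simpl; lra) ltac:(lra)). unfold Sterm in H.
      rewrite Cmod_inv in H by (apply Cpow_nz, shift_nz; simpl; lra).
      rewrite Cmod_pow in H. eapply Rle_trans; [|apply H].
      right. f_equal. unfold Cmod. rewrite pow2_sqrt. simpl. ring.
      apply Rplus_le_le_0_compat; apply pow2_ge_0.
    - apply rsummable_scal. lra. apply rsummable_scal. lra. apply rsummable_wZ. }
  set (f := fun i : Z => atan ((X + IZR i) / Y)).
  assert (Hstep : forall i, 0 <= f (i + 1)%Z - f i /\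
     Rabs (pois Y (X + IZR i) - (f (i + 1)%Z - f i)) <= 2 / Y * (f (i + 1)%Z - f i)).
  { intros i. destruct (pois_step Y (X + IZR i) HY) as [d [E [Hd Hd']]].
    unfold f. rewrite plus_IZR. replace (X + (IZR i + 1)) with (X + IZR i + 1) by ring.
    rewrite E. auto. }
  assert (HM2 : rsummable (fun i => f (i + 1)%Z - f i)).
  { split. apply Hstep. exists PI. intros l Hl.
    assert (B : forall x, - PI / 2 < atan x < PI / 2) by apply atan_bound.
    set (n := S (list_max (map Z.abs_nat l))).
    eapply Rle_trans. apply (rsum_incl _ l (map (fun i => (Z.of_nat i - Z.of_nat n)%Z) (seq 0 (2 * n)))); auto.
    - apply Hstep.
    - intros z Hz. apply in_map_iff. exists (Z.to_nat (z + Z.of_nat n)).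
      assert (Z.abs_nat z <= list_max (map Z.abs_nat l))%nat.
      { assert (h := proj1 (list_max_le (map Z.abs_nat l) _) (Nat.le_refl _)).
        rewrite Forall_forall in h. apply h. apply in_map; auto. }
      assert (Z.abs z < Z.of_nat n)%Z by (unfold n; lia).
      split. rewrite Z2Nat.id; lia. apply in_seq. lia.
    - assert (E := lsum_Zrange_telescope f n). rewrite lsum_RtoC in E. apply RtoC_inj in E.
      rewrite E. unfold f.
      assert (b1 := B ((X + IZR (Z.of_nat n)) / Y)). assert (b2 := B ((X + IZR (- Z.of_nat n)) / Y)). lra. }
  assert (U2 : usum (fun i => RtoC (f (i + 1)%Z - f i)) (RtoC (PI / 2 - - (PI / 2)))).
  { apply (usum_Z_telescope f (fun i => f (i + 1)%Z - f i)); auto.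
    - intros i. rewrite Rabs_pos_eq; [lra|apply Hstep].
    - intros eps. destruct (atan_lim eps) as [K [HK1 HK2]].
      destruct (INR_unbounded (K * Y + Rabs X)) as [n0 Hn0].
      exists n0. intros n Hn. apply le_INR in Hn.
      assert (h := Rle_abs X). assert (h' := Rle_abs (- X)). rewrite Rabs_Ropp in h'.
      unfold f. rewrite opp_IZR, <- INR_IZR_INZ. split.
      + apply HK2. apply Rle_div_r; lra.
      + replace ((X + - INR n) / Y) with (- ((INR n - X) / Y)) by (field; lra).
        rewrite atan_opp.
        replace (- atan ((INR n - X) / Y) - - (PI / 2)) with (- (atan ((INR n - X) / Y) - PI / 2)) by ring.
        rewrite Rabs_Ropp. apply HK2. apply Rle_div_r; lra. }
  destruct (rsummable_sum _ HM) as [S [US _]]. exists S. split; auto.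
  assert (UD := usum_minus _ _ _ _ US U2).
  rewrite <- Cmod_R. replace (RtoC (S - PI)) with (RtoC S - RtoC (PI / 2 - - (PI / 2)))%C.
  2:{ rewrite <- RtoC_minus. f_equal. field. }
  apply (usum_norm _ (fun i => 2 / Y * (f (i + 1)%Z - f i)) _ _ UD).
  - intros i. cbv beta. rewrite <- RtoC_minus, Cmod_R. apply Hstep.
  - intros l Hl. rewrite rsum_scal. replace (2 * PI / Y) with (2 / Y * PI) by (field; lra).
    apply Rmult_le_compat_l. left; apply Rdiv_lt_0_compat; lra.
    destruct (rsummable_sum _ HM2) as [S2 [US2 [_ [HS2 _]]]].
    replace PI with S2; auto. assert (E := usum_unique _ _ _ US2 U2). apply RtoC_inj in E. rewrite E. field.
Qed.

(** * The q-expansion of the Eisenstein series *)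

Lemma rsum_nonzero {T} (M : T -> R) l : NoDup l -> exists l1, NoDup l1 /\ incl l1 l /\
  (forall u, In u l1 -> M u <> 0) /\ rsum M l = rsum M l1.
Proof.
  induction l as [|a l IH]; intros Hl.
  - exists nil. repeat split; auto. intros u Hu; inversion Hu.
  - inversion Hl; subst. destruct (IH H2) as [l1 [N1 [I1 [Z1 E1]]]].
    destruct (Req_dec (M a) 0) as [E|E].
    + exists l1. repeat split; auto. intros x Hx; simpl; auto. rewrite rsum_cons, E, E1. ring.
    + exists (a :: l1). repeat split.
      * constructor; auto.
      * intros x [<-|Hx]; simpl; auto.
      * intros u [<-|Hu]; auto.
      * rewrite !rsum_cons, E1. reflexivity.
Qed.

Lemma rsummable_graph {T I} (g : T -> I) (M : T -> R) (M' : I * T -> R) :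
  (forall p, 0 <= M' p) -> (forall p, M' p <> 0 -> fst p = g (snd p)) ->
  (forall t, M' (g t, t) = M t) -> rsummable M -> rsummable M'.
Proof.
  intros H0 Hg HM [HM0 [B HB]]. split; auto. exists B. intros l Hl.
  destruct (rsum_nonzero M' l Hl) as [l1 [N1 [I1 [Z1 ->]]]].
  assert (E : l1 = map (fun t => (g t, t)) (map snd l1)).
  { rewrite map_map. rewrite <- (map_id l1) at 1. apply map_ext_in. intros [i t] Hu.
    rewrite <- (Hg (i, t)); auto. }
  assert (NoDup (map snd l1)).
  { rewrite E in N1. apply NoDup_map_inv in N1. auto. }
  rewrite E, rsum_map.
  replace (fun u => M' (g u, u)) with M; auto. apply functional_extensionality. auto.
Qed.

(** Fubini on [nat * T] for the family supported on the graph of [g]. *)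
Lemma usum_regroup {T} (g : T -> nat) (F : T -> C) (M : T -> R) S :
  (forall t, Cmod (F t) <= M t) -> rsummable M -> usum F S ->
  usum (fun n => tsum (fun t => if Nat.eqb (g t) n then F t else RtoC 0)) S.
Proof.
  intros HF HM HS.
  set (F' := fun p : nat * T => if Nat.eqb (g (snd p)) (fst p) then F (snd p) else RtoC 0).
  set (M' := fun p : nat * T => if Nat.eqb (g (snd p)) (fst p) then M (snd p) else 0).
  assert (M0 : forall t, 0 <= M t) by apply HM.
  assert (HF' : forall p, Cmod (F' p) <= M' p).
  { intros p. unfold F', M'. destruct Nat.eqb; auto. rewrite Cmod_0. lra. }
  assert (HM' : rsummable M').
  { apply (rsummable_graph g M); auto.
    - intros p. unfold M'. destruct Nat.eqb; auto. lra.
    - intros p. unfold M'. destruct (Nat.eqb_spec (g (snd p)) (fst p)); auto. intros X; exfalso; auto.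
    - intros t. unfold M'. simpl. rewrite Nat.eqb_refl. reflexivity. }
  assert (HS' : usum F' S).
  { apply (usum_inj (fun t => (g t, t))).
    - intros a b E. congruence.
    - intros [n t] Hu. exists t. unfold F' in Hu. simpl in Hu.
      destruct (Nat.eqb_spec (g t) n); [congruence|]. exfalso; auto.
    - eapply usum_ext; [|apply HS]. intros t. unfold F'. simpl. rewrite Nat.eqb_refl. reflexivity. }
  apply (usum_fubini F' M' S); auto.
  intros n. unfold F'; simpl.
  apply (tsum_spec _ M); auto. intros t. destruct Nat.eqb; auto. rewrite Cmod_0. auto.
Qed.

Lemma tsum_scal {T} (F : T -> C) (M : T -> R) c :
  (forall t, Cmod (F t) <= M t) -> rsummable M -> tsum (fun t => c * F t)%C = (c * tsum F)%C.
Proof. intros H1 H2. apply tsum_eq, usum_scal, (tsum_spec F M); auto. Qed.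

(** On the fibre over n the factor q^n is constant and nonzero, so the coefficients themselves are
    dominated by M / |q|^n and the power can be taken out of the inner sum. *)
Lemma usum_power_series {T} (g : T -> nat) (b : T -> C) (q : C) (M : T -> R) S :
  q <> RtoC 0 -> (forall t, Cmod (b t * q ^ g t)%C <= M t) -> rsummable M ->
  usum (fun t => b t * q ^ g t)%C S ->
  usum (fun n => tsum (fun t => if Nat.eqb (g t) n then b t else RtoC 0) * q ^ n)%C S.
Proof.
  intros Hq HM HS HU. eapply usum_ext; [|apply (usum_regroup g _ M _ HM HS HU)].
  intros n. cbv beta. rewrite Cmult_comm.
  assert (M0 : forall t, 0 <= M t) by apply HS.
  assert (Hqn : (q ^ n)%C <> RtoC 0) by (apply Cpow_nz; auto).
  assert (Hp : 0 < Cmod (q ^ n)%C) by (apply Cmod_gt_0; auto).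
  rewrite <- (tsum_scal _ (fun t => / Cmod (q ^ n)%C * M t)).
  - apply tsum_ext. intros t. destruct (Nat.eqb_spec (g t) n) as [<-|]; ring.
  - intros t. assert (0 <= / Cmod (q ^ n)%C * M t).
    { apply Rmult_le_pos; auto. left; apply Rinv_0_lt_compat; auto. }
    destruct (Nat.eqb_spec (g t) n) as [E|]; [|rewrite Cmod_0; auto].
    specialize (HM t). rewrite E, Cmod_mult in HM.
    apply Rmult_le_reg_l with (Cmod (q ^ n)%C); auto.
    rewrite <- Rmult_assoc, Rinv_r, Rmult_1_l by lra. lra.
  - apply rsummable_scal; auto. left; apply Rinv_0_lt_compat; auto.
Qed.

Lemma Sterm_opp_usum j z : (2 <= j)%nat -> 0 < Im z ->
  usum (Sterm j (- z)%C) (RtoC (-1) ^ j * tsum (Sterm j z))%C.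
Proof.
  intros Hj Hz. apply (usum_bij Z.opp Z.opp); try (intros; lia).
  eapply usum_ext; [|apply usum_scal, Sterm_usum; auto].
  intros n. symmetry. apply Sterm_reflect. lra.
Qed.

Lemma Sterm_usum_nz j z : (2 <= j)%nat -> Im z <> 0 -> usum (Sterm j z) (tsum (Sterm j z)).
Proof.
  intros Hj Hz. destruct (Rlt_dec 0 (Im z)). apply Sterm_usum; auto.
  assert (U := Sterm_opp_usum j (- z)%C Hj ltac:(simpl; unfold Im in *; lra)).
  replace (- - z)%C with z in U by ring. rewrite (tsum_eq _ _ U). auto.
Qed.

(** * Rows of the lattice as arithmetic progressions *)

Definition cong (N : nat) (a b : Z) : bool := ((a - b) mod Z.of_nat N =? 0)%Z.

Lemma cong_spec N a b : (1 <= N)%nat -> cong N a b = true <-> exists l, a = (b + Z.of_nat N * l)%Z.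
Proof.
  intros HN. unfold cong. rewrite Z.eqb_eq, Z.mod_divide by lia. split; intros [l H]; exists l; lia.
Qed.

Lemma usum_progression N d (F : Z -> C) S : (1 <= N)%nat ->
  usum (fun l => F (d + Z.of_nat N * l)%Z) S <-> usum (fun n => if cong N n d then F n else RtoC 0) S.
Proof.
  intros HN.
  rewrite <- (usum_inj (fun l => (d + Z.of_nat N * l)%Z) (fun n => if cong N n d then F n else RtoC 0)).
  - split; apply usum_ext; intros l; cbv beta;
      replace (cong N (d + Z.of_nat N * l) d) with true; auto; symmetry; apply cong_spec; eauto.
  - intros; nia.
  - intros n Hn. destruct (cong N n d) eqn:E; [|congruence]. apply cong_spec in E; auto.
    destruct E as [l ->]. eauto.
Qed.

(* m z + n = N (wpt N d m z + l) for n = d + N l. *)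
Definition wpt (N : nat) (d m : Z) (z : C) : C :=
  ((RtoC (IZR m) * z + RtoC (IZR d)) / RtoC (INR N))%C.

Lemma INR_nz N : (1 <= N)%nat -> RtoC (INR N) <> RtoC 0.
Proof. intros H E. apply RtoC_inj in E. assert (h : 0 < INR N) by (apply lt_0_INR; lia). lra. Qed.

Lemma Im_wpt N d m z : (1 <= N)%nat -> Im (wpt N d m z) = IZR m * Im z / INR N.
Proof.
  intros HN. assert (h : 0 < INR N) by (apply lt_0_INR; lia).
  unfold wpt, Cdiv. rewrite <- RtoC_inv by lra. simpl. unfold Im. field. lra.
Qed.

Lemma wpt_progression N d m z l : (1 <= N)%nat ->
  (RtoC (IZR m) * z + RtoC (IZR (d + Z.of_nat N * l)))%C
  = (RtoC (INR N) * (wpt N d m z + RtoC (IZR l)))%C.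
Proof.
  intros HN. assert (h := INR_nz N HN). unfold wpt.
  rewrite plus_IZR, mult_IZR, <- INR_IZR_INZ, RtoC_plus, RtoC_mult. field. auto.
Qed.

Lemma usum_row N d m z j : (1 <= N)%nat -> (2 <= j)%nat -> m <> 0%Z -> 0 < Im z ->
  usum (fun n => if cong N n d then / (RtoC (IZR m) * z + RtoC (IZR n)) ^ j else RtoC 0)%C
    (/ RtoC (INR N) ^ j * tsum (Sterm j (wpt N d m z)))%C.
Proof.
  intros HN Hj Hm Hz.
  assert (hN : 0 < INR N) by (apply lt_0_INR; lia).
  assert (Hw : Im (wpt N d m z) <> 0).
  { rewrite Im_wpt by auto. intros E. apply Rmult_integral in E.
    assert (/ INR N <> 0) by (apply Rinv_neq_0_compat; lra).
    assert (IZR m <> 0) by (intros X; apply eq_IZR in X; auto).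
    destruct E as [E|E]; auto. apply Rmult_integral in E. destruct E; auto. lra. }
  apply (usum_progression N d (fun n => / (RtoC (IZR m) * z + RtoC (IZR n)) ^ j)%C); auto.
  eapply usum_ext; [|apply usum_scal, Sterm_usum_nz; auto].
  intros l. cbv beta. rewrite wpt_progression by auto. unfold Sterm.
  assert (Nz : (wpt N d m z + RtoC (IZR l))%C <> RtoC 0).
  { intros E. apply Hw. apply (f_equal Im) in E. rewrite Im_plus in E.
    change (Im (RtoC (IZR l))) with 0 in E. change (Im (RtoC 0)) with 0 in E. lra. }
  rewrite Cpow_mult_l. assert (N1 : (RtoC (INR N) ^ j)%C <> RtoC 0) by (apply Cpow_nz, INR_nz; auto).
  assert (N2 : ((wpt N d m z + RtoC (IZR l)) ^ j)%C <> RtoC 0) by (apply Cpow_nz; auto).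
  set (a := (RtoC (INR N) ^ j)%C) in *. set (b := ((wpt N d m z + RtoC (IZR l)) ^ j)%C) in *. field. auto.
Qed.

Definition Gterm (N k : nat) (v : Z * Z) (z : C) (u : Z * Z) : C :=
  if in_class N v u then (/ (lin u z ^ k))%C else RtoC 0.

Lemma in_class_nz N v u : in_class N v u = true -> u <> (0, 0)%Z.
Proof. intros H ->. unfold in_class in H. simpl in H. rewrite Bool.andb_false_r in H. discriminate. Qed.

Lemma lin_nz z u : 0 < Im z -> u <> (0, 0)%Z -> lin u z <> RtoC 0.
Proof.
  intros Hz Hu E. destruct u as [m n]. unfold lin in E. simpl in E.
  assert (E1 := f_equal Im E). assert (E2 := f_equal Re E). simpl in E1, E2. unfold Im in *.
  assert (H : IZR m = 0).
  { assert (X : IZR m * snd z = 0) by lra. apply Rmult_integral in X. destruct X; auto. lra. }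
  rewrite H in E2. assert (IZR n = 0) by lra.
  apply eq_IZR in H, H0. subst. auto.
Qed.

Lemma inv_lin_bound k y0 K : (3 <= k)%nat -> 0 < y0 -> exists B, 0 < B /\ forall z u,
  y0 <= Im z -> Cmod z <= K -> u <> (0, 0)%Z -> / Cmod (lin u z) ^ k <= B * wL u.
Proof.
  intros Hk Hy. destruct (lin_lower y0 K Hy) as [c [[Hc _] H]].
  exists (8 / c ^ k). split. apply Rdiv_lt_0_compat; [lra|apply pow_lt; auto].
  intros z u Hz HK Hu. apply (inv_pow_le_wL u k c); auto. apply H; auto.
Qed.

Lemma Gterm_bound k y0 K : (3 <= k)%nat -> 0 < y0 -> exists B, 0 < B /\ forall N v z u,
  y0 <= Im z -> Cmod z <= K -> Cmod (Gterm N k v z u) <= B * wL u.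
Proof.
  intros Hk Hy. destruct (inv_lin_bound k y0 K Hk Hy) as [B [HB H]]. exists B. split; auto.
  intros N v z u Hz HK. assert (h := wL_pos u). unfold Gterm. destruct (in_class N v u) eqn:E.
  - assert (Hu := in_class_nz _ _ _ E).
    rewrite Cmod_inv, Cmod_pow by (apply Cpow_nz, lin_nz; auto; lra). auto.
  - rewrite Cmod_0. apply Rmult_le_pos; lra.
Qed.

Lemma G_hol_usum N k v z : (3 <= k)%nat -> 0 < Im z -> usum (Gterm N k v z) (G_hol N k v z).
Proof.
  intros Hk Hz. destruct (Gterm_bound k (Im z) (Cmod z) Hk Hz) as [B [HB H]].
  destruct (usum_exists (Gterm N k v z) (fun u => B * wL u)) as [S HS].
  - intros u. apply H; lra.
  - apply rsummable_scal. lra. apply rsummable_wL.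
  - unfold G_hol.
    rewrite (lattice_sum_eq _ S); auto.
Qed.

Lemma in_class_row N v m n : m <> 0%Z -> in_class N v (m, n) = (cong N m (fst v) && cong N n (snd v))%bool.
Proof.
  intros Hm. unfold in_class, cong. simpl. apply Z.eqb_neq in Hm. rewrite Hm. simpl.
  rewrite Bool.andb_true_r. reflexivity.
Qed.

(** The row m = 0. It does not depend on z and is the constant term of the q-expansion. *)
Definition G_const (N k : nat) (v : Z * Z) : C :=
  tsum (fun n => if in_class N v (0%Z, n) then / RtoC (IZR n) ^ k else RtoC 0)%C.

Lemma G_const_usum N k v : (3 <= k)%nat ->
  usum (fun n => if in_class N v (0%Z, n) then / RtoC (IZR n) ^ k else RtoC 0)%C (G_const N k v).
Proof.
  intros Hk. destruct (Gterm_bound k 1 1 Hk ltac:(lra)) as [B [HB H]].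
  apply (tsum_spec _ (fun n => B * wL (0%Z, n))).
  (* On the row m = 0 the term is the same at every point, so any z may be inserted. *)
  - intros n. specialize (H N v Ci (0%Z, n) ltac:(simpl; lra) ltac:(rewrite Cmod_Ci; lra)).
    unfold Gterm, lin in H. simpl fst in H; simpl snd in H.
    replace (RtoC 0 * Ci + RtoC (IZR n))%C with (RtoC (IZR n)) in H by ring. exact H.
  - apply (rsummable_inj (fun n => (0%Z, n)) (fun u => B * wL u)). congruence.
    apply rsummable_scal. lra. apply rsummable_wL.
Qed.

Lemma G_row0 N k v z : (3 <= k)%nat -> usum (fun n => Gterm N k v z (0%Z, n)) (G_const N k v).
Proof.
  intros Hk. eapply usum_ext; [|apply (G_const_usum N k v Hk)].
  intros n. unfold Gterm, lin. simpl fst; simpl snd.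
  replace (RtoC 0 * z + RtoC (IZR n))%C with (RtoC (IZR n)) by ring. reflexivity.
Qed.

Definition sgR (m : Z) : R := IZR (Z.sgn m).

(* The row m <> 0 of the lattice sum is the sum over e of
   [qcoef N k v c (m, e) * qN N z ^ qexponent (m, e)], where [c] is the constant of the Lipschitz
   formula of weight k. *)
Definition qcoef (N k : nat) (v : Z * Z) (c : C) (p : Z * nat) : C :=
  let (m, e) := p in
  if (cong N m (fst v) && negb (Z.eqb m 0))%bool then
    (/ RtoC (INR N) ^ k * RtoC (sgR m) ^ k * c * RtoC (INR (S e) ^ (k - 1))
      * ec (RtoC (sgR m * IZR (snd v)) / RtoC (INR N)) ^ S e)%C
  else RtoC 0.

Definition qexponent (p : Z * nat) : nat := (Z.abs_nat (fst p) * S (snd p))%nat.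

Lemma qN_ec N z : qN N z = ec (z / RtoC (INR N))%C.
Proof. unfold qN, ec. f_equal. unfold Cdiv. ring. Qed.

Lemma Cmod_qN N z : (1 <= N)%nat -> Cmod (qN N z) = exp (- (2 * PI * Im z / INR N)).
Proof.
  intros HN. assert (h : 0 < INR N) by (apply lt_0_INR; lia).
  rewrite qN_ec, Cmod_ec. f_equal. f_equal.
  replace (Im (z / RtoC (INR N))%C) with (Im z / INR N). field; lra.
  unfold Cdiv. rewrite <- RtoC_inv by lra. simpl. unfold Im. field. lra.
Qed.

Lemma sgR_cases m : m <> 0%Z -> (sgR m = 1 /\ (0 < m)%Z) \/ (sgR m = -1 /\ (m < 0)%Z).
Proof. intros H. unfold sgR. destruct m; simpl; [congruence|left|right]; split; auto; lia. Qed.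

(** The point w = sgn(m) [wpt N d m z] lies in the upper half-plane for either sign of m; for m < 0
    the reflection costs the factor (-1)^j. *)
Lemma row_expansion N d m z j : (1 <= N)%nat -> (2 <= j)%nat -> m <> 0%Z -> 0 < Im z ->
  exists w : C, (0 < Im w /\ Im w = IZR (Z.abs m) * Im z / INR N) /\
  tsum (Sterm j (wpt N d m z)) = (RtoC (sgR m) ^ j * tsum (Sterm j w))%C /\
  ec w = (ec (RtoC (sgR m * IZR d) / RtoC (INR N)) * qN N z ^ Z.abs_nat m)%C.
Proof.
  intros HN Hj Hm Hz. assert (h : 0 < INR N) by (apply lt_0_INR; lia).
  assert (hn := INR_nz N HN).
  exists (RtoC (sgR m) * wpt N d m z)%C.
  assert (Hs : sgR m * IZR m = IZR (Z.abs m)).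
  { unfold sgR. rewrite <- mult_IZR. f_equal. destruct m; simpl; lia. }
  assert (EI : Im (RtoC (sgR m) * wpt N d m z)%C = IZR (Z.abs m) * Im z / INR N).
  { replace (Im (RtoC (sgR m) * wpt N d m z)%C) with (sgR m * Im (wpt N d m z)) by (simpl; unfold Im; ring).
    rewrite Im_wpt, <- Hs by auto. field. lra. }
  assert (Pm : 0 < IZR (Z.abs m)) by (apply IZR_lt; lia).
  assert (PI' : 0 < IZR (Z.abs m) * Im z / INR N) by (apply Rdiv_lt_0_compat; auto; apply Rmult_lt_0_compat; auto).
  split; [split; auto; rewrite EI; auto|]. split.
  - destruct (sgR_cases m Hm) as [[E _]|[E _]]; rewrite E in *.
    + rewrite Cpow_1_l, !Cmult_1_l. reflexivity.
    + assert (U := Sterm_opp_usum j (RtoC (-1) * wpt N d m z)%C Hj ltac:(rewrite EI; auto)).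
      replace (- (RtoC (-1) * wpt N d m z))%C with (wpt N d m z) in U by ring.
      apply tsum_eq; auto.
  - rewrite qN_ec. unfold ec at 3. rewrite <- cexp_INR.
    change (ec (RtoC (sgR m) * wpt N d m z) = ec (RtoC (sgR m * IZR d) / RtoC (INR N)) *
       cexp (RtoC (INR (Z.abs_nat m)) * (RtoC (2 * PI) * Ci * (z / RtoC (INR N)))))%C.
    unfold ec at 2. rewrite <- cexp_add. unfold ec. f_equal. unfold wpt.
    rewrite (INR_IZR_INZ (Z.abs_nat m)), Zabs2Nat.id_abs, <- Hs, !RtoC_mult. field. auto.
Qed.

Lemma G_row N k v c z m : (1 <= N)%nat -> (3 <= k)%nat -> 0 < Im z ->
  (forall w, 0 < Im w -> tsum (Sterm k w) = (c * tsum (Lterm (k - 1) w))%C) -> m <> 0%Z ->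
  exists s, usum (fun n => Gterm N k v z (m, n)) s /\
   usum (fun e => qcoef N k v c (m, e) * qN N z ^ qexponent (m, e))%C s.
Proof.
  intros HN Hk Hz Hc Hm.
  destruct (cong N m (fst v)) eqn:E.
  - exists (/ RtoC (INR N) ^ k * tsum (Sterm k (wpt N (snd v) m z)))%C. split.
    + eapply usum_ext; [|apply (usum_row N (snd v) m z k); auto; lia].
      intros n. unfold Gterm. rewrite in_class_row, E by auto. reflexivity.
    + destruct (row_expansion N (snd v) m z k HN ltac:(lia) Hm Hz) as [w [[Hw _] [E1 E2]]].
      rewrite E1, (Hc w Hw).
      replace (/ RtoC (INR N) ^ k * (RtoC (sgR m) ^ k * (c * tsum (Lterm (k - 1) w))))%C with
        (/ RtoC (INR N) ^ k * RtoC (sgR m) ^ k * c * tsum (Lterm (k - 1) w))%C by ring.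
      eapply usum_ext; [|apply usum_scal, Lterm_usum; auto].
      intros e. unfold qcoef, Lterm, qexponent. rewrite E. apply Z.eqb_neq in Hm. rewrite Hm.
      cbn [negb andb fst snd]. rewrite E2, Cpow_mult_l, Cpow_mult_r. ring.
  - exists (RtoC 0). split; (eapply usum_ext; [|apply usum_zero]); intros n; cbv beta.
    + unfold Gterm. rewrite in_class_row, E by auto. reflexivity.
    + unfold qcoef. rewrite E. simpl. ring.
Qed.

Lemma qcoef_bound N k v c y : (1 <= N)%nat -> 0 < y -> exists B, 0 <= B /\
  forall z p, Im z = y -> Cmod (qcoef N k v c p * qN N z ^ qexponent p)%C <= B * (wZ (fst p) * wN (snd p)).
Proof.
  intros HN Hy. assert (h : 0 < INR N) by (apply lt_0_INR; lia). assert (hp := PI_RGT_0).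
  (* The decay rate is 2 t. Since 2 a x >= a + x for a, x >= 1, the exponent 2 t a x splits into t a
     and t x, which leaves one exponential for each index. *)
  set (t := PI * y / INR N).
  assert (Ht : 0 < t) by (apply Rdiv_lt_0_compat; auto; apply Rmult_lt_0_compat; auto).
  destruct (pow_exp_bound (k - 1 + 2) t Ht) as [B1 [HB1 H1]].
  destruct (pow_exp_bound 2 t Ht) as [B2 [HB2 H2]].
  set (A := Cmod (/ RtoC (INR N) ^ k * c)%C). assert (HA : 0 <= A) by apply Cmod_ge_0.
  exists (A * (B1 * (B2 * exp t))).
  assert (HBB : 0 < B1 * (B2 * exp t)) by (repeat apply Rmult_lt_0_compat; auto; apply exp_pos).
  split. apply Rmult_le_pos; lra.
  intros z [m e] Hz. simpl fst; simpl snd.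
  assert (W1 := wZ_pos m). assert (W2 : 0 <= wN e) by apply (proj1 rsummable_wN).
  unfold qcoef. destruct (cong N m (fst v) && negb (Z.eqb m 0))%bool eqn:E.
  2:{ rewrite Cmult_0_l, Cmod_0. assert (0 < exp t) by apply exp_pos; apply Rmult_le_pos; [apply Rmult_le_pos; lra|apply Rmult_le_pos; lra]. }
  apply andb_prop in E. destruct E as [_ E]. apply Bool.negb_true_iff, Z.eqb_neq in E.
  set (x := INR (S e)). assert (Hx : 1 <= x) by (unfold x; rewrite S_INR; assert (q := pos_INR e); lra).
  set (a := Rabs (IZR m)).
  assert (Ha : 1 <= a) by (unfold a; rewrite <- abs_IZR; apply IZR_le; lia).
  rewrite !Cmod_mult, !Cmod_pow.
  replace (Cmod (RtoC (sgR m))) with 1.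
  2:{ rewrite Cmod_R. destruct (sgR_cases m E) as [[-> _]|[-> _]]. rewrite Rabs_R1; auto. rewrite Rabs_left by lra; lra. }
  replace (Cmod (ec (RtoC (sgR m * IZR (snd v)) / RtoC (INR N)))) with 1.
  2:{ rewrite Cmod_ec. unfold Cdiv. rewrite <- RtoC_inv by lra. rewrite <- RtoC_mult. simpl.
      rewrite <- exp_0 at 1. f_equal. ring. }
  rewrite !pow1, !Rmult_1_r. rewrite Cmod_R, Rabs_pos_eq by (apply pow_le; lra).
  replace (Cmod (/ RtoC (INR N) ^ k) * Cmod c) with A by (unfold A; rewrite Cmod_mult; auto).
  rewrite Cmod_qN by auto. rewrite Hz.
  assert (EE : exp (- (2 * PI * y / INR N)) ^ qexponent (m, e) <= exp (- (t * x)) * (exp (- (t * a)))).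
  { assert (forall s n, exp s ^ n = exp (INR n * s)) as ->.
    { intros s n. induction n. simpl. rewrite Rmult_0_l, exp_0. reflexivity.
      simpl pow. rewrite IHn, <- exp_plus, S_INR. f_equal. ring. }
    rewrite <- exp_plus. apply exp_mono. unfold qexponent. simpl fst; simpl snd. rewrite mult_INR. fold x.
    rewrite (INR_IZR_INZ (Z.abs_nat m)), Zabs2Nat.id_abs, abs_IZR. fold a.
    replace (2 * PI * y / INR N) with (2 * t) by (unfold t; field; lra).
    assert (x + a <= 2 * (a * x)) by nra. nra. }
  specialize (H1 x ltac:(lra)). specialize (H2 (1 + a) ltac:(lra)).
  assert (Q1 : x ^ (k - 1) * exp (- (t * x)) <= B1 * wN e).
  { eapply Rle_trans; [|apply Rmult_le_compat_l; [lra|apply wN_ge]]. fold x.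
    apply Rmult_le_reg_r with (x ^ 2). apply pow_lt; lra.
    rewrite Rmult_assoc, (Rmult_assoc B1), Rinv_l, Rmult_1_r by (apply pow_nonzero; lra).
    rewrite pow_add in H1. lra. }
  assert (Q2 : exp (- (t * a)) <= B2 * exp t * wZ m).
  { eapply Rle_trans; [|apply Rmult_le_compat_l; [apply Rmult_le_pos; [lra|left; apply exp_pos]|apply wZ_ge]]. fold a.
    apply Rmult_le_reg_r with ((1 + a) ^ 2). apply pow_lt; lra.
    rewrite (Rmult_assoc (B2 * exp t)), Rinv_l, Rmult_1_r by (apply pow_nonzero; lra).
    replace (- (t * a)) with (- (t * (1 + a)) + t) by ring. rewrite exp_plus.
    assert (0 < exp t) by apply exp_pos.
    replace (exp (- (t * (1 + a))) * exp t * (1 + a) ^ 2) with ((1 + a) ^ 2 * exp (- (t * (1 + a))) * exp t) by ring.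
    apply Rmult_le_compat_r; lra. }
  apply Rle_trans with (A * ((x ^ (k - 1) * exp (- (t * x))) * exp (- (t * a)))).
  - replace (A * (x ^ (k - 1) * exp (- (t * x)) * exp (- (t * a)))) with (A * x ^ (k - 1) * (exp (- (t * x)) * exp (- (t * a)))) by ring.
    apply Rmult_le_compat_l; auto. apply Rmult_le_pos; auto. apply pow_le; lra.
  - replace (A * (B1 * (B2 * exp t)) * (wZ m * wN e)) with (A * ((B1 * wN e) * (B2 * exp t * wZ m))) by ring.
    apply Rmult_le_compat_l; auto. apply Rmult_le_compat; auto.
    apply Rmult_le_pos. apply pow_le; lra. left; apply exp_pos. left; apply exp_pos.
Qed.

(** The lattice sum over (m, n) and the q-series over (m, e) have equal rows for m <> 0 by the
    Lipschitz formula. Fubini on both sides and regrouping by the exponent of q give the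
    expansion. *)
Lemma G_q_expansion N k v : (1 <= N)%nat -> (3 <= k)%nat ->
  exists a, is_q_expansion N (G_hol N k v) a /\ a O = G_const N k v.
Proof.
  intros HN Hk.
  assert (exists c, forall w, 0 < Im w -> tsum (Sterm k w) = (c * tsum (Lterm (k - 1) w))%C) as [c Hc].
  { destruct k as [|[|k]]; try lia. destruct (lipschitz k) as [c Hc]. exists c. intros w Hw.
    rewrite Hc by auto. replace (S (S k) - 1)%nat with (S k) by lia. reflexivity. }
  set (b := qcoef N k v c).
  set (a0 := fun n => tsum (fun t => if Nat.eqb (qexponent t) n then b t else RtoC 0)).
  exists (fun n => a0 n + (if Nat.eqb n 0 then G_const N k v else RtoC 0))%C. split.
  - intros z Hz. apply usum_is_series.
    destruct (qcoef_bound N k v c (Im z) HN Hz) as [B [HB Hb]].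
    assert (HM : rsummable (fun p : Z * nat => B * (wZ (fst p) * wN (snd p)))).
    { apply rsummable_scal; auto. apply rsummable_prod. apply rsummable_wZ. apply rsummable_wN. }
    assert (Hb' : forall p, Cmod (b p * qN N z ^ qexponent p)%C <= B * (wZ (fst p) * wN (snd p))).
    { intros p. apply Hb; auto. }
    destruct (usum_exists _ _ Hb' HM) as [S HS].
    assert (HP := usum_power_series qexponent b (qN N z) _ S ltac:(rewrite qN_ec; apply cexp_nz) Hb' HM HS).
    assert (EG : G_hol N k v z = (S + G_const N k v)%C).
    { destruct (Gterm_bound k (Im z) (Cmod z) Hk Hz) as [B' [HB' H']].
      assert (RW : forall m, exists s, usum (fun n => Gterm N k v z (m, n)) s /\
         usum (fun e => b (m, e) * qN N z ^ qexponent (m, e))%C (s - (if Z.eqb m 0 then G_const N k v else RtoC 0))%C).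
      { intros m. destruct (Z.eqb_spec m 0) as [->|Hm].
        - exists (G_const N k v). split. apply G_row0; auto.
          replace (G_const N k v - G_const N k v)%C with (RtoC 0) by ring.
          eapply usum_ext; [|apply usum_zero]. intros e. unfold b, qcoef.
          rewrite Bool.andb_false_r. ring.
        - destruct (G_row N k v c z m HN Hk Hz Hc Hm) as [s [Hs1 Hs2]]. exists s. split; auto.
          replace (s - 0)%C with s by ring. auto. }
      apply choice in RW. destruct RW as [s Hs].
      assert (U1 : usum s (G_hol N k v z)).
      { apply (usum_fubini (Gterm N k v z) (fun u => B' * wL u)).
        - intros u. apply H'; lra.
        - apply rsummable_scal. lra. apply rsummable_wL.
        - apply G_hol_usum; auto.
        - intros m. apply Hs. }
      assert (U2 : usum (fun m => s m - (if Z.eqb m 0 then G_const N k v else RtoC 0))%C S).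
      { apply (usum_fubini _ _ S _ Hb' HM HS). intros m. apply Hs. }
      assert (U3 : usum (fun m => if Z.eqb m 0 then G_const N k v else RtoC 0) (G_const N k v)).
      { apply (usum_single (fun m => if Z.eqb m 0 then G_const N k v else RtoC 0) 0%Z).
        intros m Hm. apply Z.eqb_neq in Hm. rewrite Hm. auto. }
      apply (usum_unique s); auto. eapply usum_ext; [|apply (usum_plus _ _ _ _ U2 U3)].
      intros m; cbv beta. ring. }
    rewrite EG.
    assert (U4 : usum (fun n => if Nat.eqb n 0 then G_const N k v else RtoC 0) (G_const N k v)).
    { apply (usum_single (fun n => if Nat.eqb n 0 then G_const N k v else RtoC 0) 0%nat).
      intros m Hm. apply Nat.eqb_neq in Hm. rewrite Hm. auto. }
    eapply usum_ext; [|apply (usum_plus _ _ _ _ HP U4)].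
    intros n. cbv beta. fold (a0 n). destruct (Nat.eqb_spec n 0) as [->|]; simpl; ring.
  (* The exponent 0 occurs only for m = 0, where [qcoef] vanishes. *)
  - simpl. replace (a0 O) with (RtoC 0). ring.
    symmetry. apply tsum_eq. eapply usum_ext; [|apply usum_zero].
    intros [m e]. cbv beta. destruct (Nat.eqb_spec (qexponent (m, e)) 0) as [E|]; auto.
    unfold b, qcoef. unfold qexponent in E. simpl in E.
    assert (m = 0%Z) by nia. subst. rewrite Bool.andb_false_r. reflexivity.
Qed.

(** * Decay of q-expansions and the constant term *)

Lemma C_ball_Cmod (z w : C) (eps : posreal) : ball z eps w -> Cmod (w - z)%C < 2 * eps.
Proof.
  intros [H1 H2]. eapply Rle_lt_trans. apply Cmod_le_abs.
  change (Rabs (fst w - fst z) < eps) in H1. change (Rabs (snd w - snd z) < eps) in H2.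
  rewrite Re_minus, Im_minus. unfold Re, Im. lra.
Qed.

Lemma is_series_Cmod (a : nat -> C) (S : C) : is_series a S ->
  forall eps : posreal, exists n0, forall n, (n0 <= n)%nat -> Cmod (sum_n a n - S)%C < eps.
Proof.
  intros H eps.
  destruct (proj1 (filterlim_locally (F := eventually) (sum_n a) S) H (pos_div_2 eps)) as [n0 Hn0]. exists n0. intros n Hn.
  specialize (Hn0 n Hn). apply C_ball_Cmod in Hn0. simpl in Hn0.
  replace (2 * (eps / 2)) with (pos eps) in Hn0 by field. exact Hn0.
Qed.

Lemma series_terms_bounded (a : nat -> C) (S : C) : is_series a S -> exists M, 0 < M /\ forall n, Cmod (a n) <= M.
Proof.
  intros H. destruct (is_series_Cmod a S H (mkposreal 1 Rlt_0_1)) as [n0 Hn0]. simpl in Hn0.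
  assert (P : forall m, exists M, 0 < M /\ forall n, (n <= m)%nat -> Cmod (a n) <= M).
  { induction m.
    - exists (Cmod (a 0%nat) + 1). assert (h := Cmod_ge_0 (a 0%nat)). split. lra.
      intros n Hn. replace n with 0%nat by lia. lra.
    - destruct IHm as [M [HM HM']]. exists (M + Cmod (a (Datatypes.S m))).
      assert (h := Cmod_ge_0 (a (Datatypes.S m))). split. lra.
      intros n Hn. destruct (Nat.eq_dec n (Datatypes.S m)) as [->|]. lra.
      specialize (HM' n ltac:(lia)). lra. }
  destruct (P (Datatypes.S n0)) as [M [HM HM']]. exists (M + 2). split. lra.
  intros n. destruct (le_lt_dec n (Datatypes.S n0)) as [Hn|Hn].
  - specialize (HM' n Hn). lra.
  - destruct n; [lia|].
    assert (h1 := Hn0 n ltac:(lia)). assert (h2 := Hn0 (Datatypes.S n) ltac:(lia)).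
    rewrite sum_Sn in h2. unfold plus in h2; simpl in h2.
    replace (a (Datatypes.S n)) with ((sum_n a n + a (Datatypes.S n) - S) + - (sum_n a n - S))%C by ring.
    eapply Rle_trans. apply Cmod_triangle. rewrite Cmod_opp.
    change (NormedModule.sort C_AbsRing C_NormedModule) with C in *. lra.
Qed.

(** Convergence at one point of smaller height bounds the coefficients, and the series is then
    dominated by a geometric one. An arbitrary expansion is treated because [const_term] quantifies
    over all of them. *)
Lemma q_expansion_decay N f a : (1 <= N)%nat -> is_q_expansion N f a ->
  exists B, 0 < B /\ forall z, 1 <= Im z -> Cmod (f z - a O)%C <= B * exp (- (2 * PI * Im z / INR N)).
Proof.
  intros HN Hf. assert (h : 0 < INR N) by (apply lt_0_INR; lia). assert (hp := PI_RGT_0).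
  (* At height 1/2 one has |q_N| = rho, while |q_N| <= rho^2 for Im z >= 1; so the ratio x of the
     geometric series is at most rho. *)
  set (z0 := (0, 1 / 2) : C).
  destruct (series_terms_bounded _ _ (Hf z0 ltac:(simpl; lra))) as [M [HM Hb]].
  set (s := PI / INR N). assert (Hs : 0 < s) by (apply Rdiv_lt_0_compat; auto).
  set (rho := exp (- s)).
  assert (Hrho : 0 < rho < 1). { split. apply exp_pos. unfold rho. rewrite <- exp_0. apply exp_increasing. lra. }
  assert (Q0 : Cmod (qN N z0) = rho).
  { rewrite Cmod_qN by auto. unfold rho, s. f_equal. simpl. field. lra. }
  exists (M * / rho * / (1 - rho)).
  assert (P1 : 0 < / rho) by (apply Rinv_0_lt_compat; lra). assert (P2 : 0 < / (1 - rho)) by (apply Rinv_0_lt_compat; lra).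
  split. repeat apply Rmult_lt_0_compat; auto.
  intros z Hz. set (r := exp (- (2 * PI * Im z / INR N))).
  assert (Hr : 0 < r) by apply exp_pos.
  assert (Er : Cmod (qN N z) = r) by (apply Cmod_qN; auto).
  set (x := r * / rho). assert (Hx : 0 < x) by (apply Rmult_lt_0_compat; auto).
  assert (Hxr : x <= rho).
  { unfold x. apply Rmult_le_reg_r with rho. lra. rewrite Rmult_assoc, Rinv_l, Rmult_1_r by lra.
    unfold r, rho. rewrite <- exp_plus. apply exp_mono. unfold s.
    replace (2 * PI * Im z / INR N) with (2 * (PI / INR N) * Im z) by (field; lra). fold s. nra. }
  assert (T : forall n, Cmod (a n * qN N z ^ n)%C <= M * x ^ n).
  { intros n. specialize (Hb n). rewrite Cmod_mult, Cmod_pow, Q0 in Hb. rewrite Cmod_mult, Cmod_pow, Er.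
    assert (Hpn : 0 < rho ^ n) by (apply pow_lt; lra).
    unfold x. rewrite Rpow_mult_distr, pow_inv.
    apply Rmult_le_reg_r with (rho ^ n); auto.
    replace (M * (r ^ n * / rho ^ n) * rho ^ n) with (M * r ^ n) by (field; lra).
    replace (Cmod (a n) * r ^ n * rho ^ n) with (Cmod (a n) * rho ^ n * r ^ n) by ring.
    apply Rmult_le_compat_r; auto. apply pow_le; lra. }
  assert (SB : forall n, Cmod (sum_n (fun n => a n * qN N z ^ n)%C n - a O)%C <= M * (x - x ^ S n) / (1 - x)).
  { induction n.
    - rewrite sum_O. replace (a 0%nat * qN N z ^ 0 - a 0%nat)%C with (RtoC 0) by (simpl; ring).
      rewrite Cmod_0. right. simpl. field. lra.
    - rewrite sum_Sn. unfold plus; simpl.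
      match goal with |- Cmod (?A + ?B - ?D)%C <= _ => replace (A + B - D)%C with ((A - D) + B)%C by ring end.
      eapply Rle_trans. apply Cmod_triangle. specialize (T (S n)). simpl in T.
      eapply Rle_trans. apply Rplus_le_compat. apply IHn. apply T.
      right. simpl. field. lra. }
  assert (K : Cmod (f z - a O)%C <= M * x / (1 - x)).
  { apply Rle_plus_epsilon. intros e He.
    destruct (is_series_Cmod _ _ (Hf z ltac:(lra)) (mkposreal e He)) as [n0 Hn0].
    specialize (Hn0 n0 (Nat.le_refl _)). simpl in Hn0. specialize (SB n0).
    replace (f z - a O)%C with ((sum_n (fun n => a n * qN N z ^ n)%C n0 - a O) + - (sum_n (fun n => a n * qN N z ^ n)%C n0 - f z))%C by ring.
    eapply Rle_trans. apply Cmod_triangle. rewrite Cmod_opp.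
    apply Rplus_le_compat; [|left; apply Hn0].
    eapply Rle_trans. apply SB. unfold Rdiv. apply Rmult_le_compat_r.
    left; apply Rinv_0_lt_compat; lra. apply Rmult_le_compat_l. lra.
    assert (0 < x ^ S n0) by (apply pow_lt; lra). lra. }
  eapply Rle_trans. apply K.
  replace (M * / rho * / (1 - rho) * r) with (M * x * / (1 - rho)) by (unfold x; ring).
  unfold Rdiv. apply Rmult_le_compat_l. apply Rmult_le_pos; lra.
  apply Rinv_le_contravar; lra.
Qed.

Lemma exp_decay_small c B (eps : posreal) : 0 < c -> exists T0, 1 <= T0 /\ forall T, T0 <= T -> B * exp (- (c * T)) < eps.
Proof.
  intros Hc. destruct (pow_exp_bound 1 c Hc) as [D [HD H]].
  assert (he := cond_pos eps).
  set (A := Rabs B * D / eps).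
  assert (HA : 0 <= A) by (unfold A, Rdiv; repeat apply Rmult_le_pos; try lra; [apply Rabs_pos|left; apply Rinv_0_lt_compat; auto]).
  exists (A + 1). split. lra.
  intros T HT. specialize (H T ltac:(lra)). rewrite pow_1 in H.
  assert (Hx := exp_pos (- (c * T))). assert (hB := Rle_abs B).
  apply Rle_lt_trans with (Rabs B * exp (- (c * T))). apply Rmult_le_compat_r; lra.
  apply Rmult_lt_reg_l with T. lra.
  replace (T * (Rabs B * exp (- (c * T)))) with (Rabs B * (T * exp (- (c * T)))) by ring.
  apply Rle_lt_trans with (Rabs B * D). apply Rmult_le_compat_l. apply Rabs_pos. auto.
  replace (Rabs B * D) with (A * eps) by (unfold A; field; lra).
  apply Rmult_lt_compat_r; lra.
Qed.

(** [C_iota] demands uniqueness: the constant term of any expansion is the limit of f at the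
    cusp. *)
Lemma const_term_eq N f a : (1 <= N)%nat -> is_q_expansion N f a -> const_term N f = a O.
Proof.
  intros HN Ha. apply C_iota_eq; [|exists a; auto].
  intros y [b [Hb <-]]. apply NNPP. intros Hne.
  assert (h : 0 < INR N) by (apply lt_0_INR; lia). assert (hp := PI_RGT_0).
  assert (Hp : 0 < Cmod (b O - a O)%C) by (apply Cmod_gt_0; intros E; apply Hne, Ceq_minus; auto).
  destruct (q_expansion_decay N f a HN Ha) as [B1 [HB1 H1]].
  destruct (q_expansion_decay N f b HN Hb) as [B2 [HB2 H2]].
  assert (Hc : 0 < 2 * PI / INR N) by (apply Rdiv_lt_0_compat; lra).
  destruct (exp_decay_small _ (B1 + B2) (mkposreal _ Hp) Hc) as [T [HT1 HT]].
  specialize (HT T (Rle_refl _)). simpl in HT.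
  specialize (H1 (0, T) HT1). specialize (H2 (0, T) HT1). simpl in H1, H2.
  replace (2 * PI * T / INR N) with (2 * PI / INR N * T) in H1, H2 by (field; lra).
  assert (Cmod (b O - a O)%C <= Cmod (f (0, T) - a O)%C + Cmod (f (0, T) - b O)%C).
  { replace (b O - a O)%C with ((f (0, T) - a O) + - (f (0, T) - b O))%C by ring.
    eapply Rle_trans. apply Cmod_triangle. rewrite Cmod_opp. lra. }
  lra.
Qed.

(** * Algebra of a single lattice term *)

(* The complete homogeneous symmetric polynomial of degree n in A and B. *)
Fixpoint hs (A B : C) (n : nat) : C :=
  match n with O => RtoC 1 | S n' => (B * hs A B n' + A ^ S n')%C end.

(* [sum_n] leaves equations at the carrier of a structure, which [ring] does not recognise. *)
Ltac ceq := match goal with |- ?a = ?b => change (@eq C a b) end.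

Lemma Csum_mult_l (c : C) (f : nat -> C) n : (c * sum_n f n)%C = sum_n (fun r => c * f r)%C n.
Proof.
  induction n. rewrite !sum_O. reflexivity. rewrite !sum_Sn, <- IHn. unfold plus; simpl. ring.
Qed.

Lemma hs_sum A B n : sum_n (fun r => (A ^ r * B ^ (n - r))%C) n = hs A B n.
Proof.
  induction n.
  - rewrite sum_O. simpl. ring.
  - rewrite sum_Sn, Nat.sub_diag. change (hs A B (S n)) with (B * hs A B n + A ^ S n)%C. rewrite <- IHn.
    rewrite Csum_mult_l. apply (f_equal2 Cplus); [|simpl; ring].
    apply sum_n_ext_loc. intros r Hr. cbv beta. replace (S n - r)%nat with (S (n - r)) by lia.
    rewrite Cpow_S. ceq. ring.
Qed.

Lemma hs_scal c A B n : hs (c * A)%C (c * B)%C n = (c ^ n * hs A B n)%C.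
Proof. induction n. simpl; ring. simpl hs. rewrite IHn. rewrite Cpow_mult_l. simpl. ring. Qed.

Lemma hs_diff A B n : ((A - B) * hs A B n = A ^ S n - B ^ S n)%C.
Proof.
  induction n. simpl; ring.
  replace ((A - B) * hs A B (S n))%C with (B * ((A - B) * hs A B n) + (A - B) * A ^ S n)%C
    by (simpl; ring).
  rewrite IHn. simpl. ring.
Qed.

(* With a = 1 / l and nu = m x + n one has 1 - nu a = m (z - x) / l, so [geo a nu n] is the sum
   of (m (z - x))^j / l^(j+1) for j <= n; unlike (1 - (1 - nu a)^(n+1)) / nu it needs no
   nu <> 0. *)
Definition geo (a nu : C) (n : nat) : C := sum_n (fun j => ((1 - nu * a) ^ j * a)%C) n.

Lemma geo_S a nu n : geo a nu (S n) = (geo a nu n + (1 - nu * a) ^ S n * a)%C.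
Proof. unfold geo. rewrite sum_Sn. reflexivity. Qed.

(** For nu <> 0 this is [hs_diff] divided by nu, since the two arguments of [hs] differ by nu (b -
    a). The induction gives it without the division. *)
Lemma hs_geo a b nu n : ((b - a) * hs (1 - nu * a) (1 - nu * b) n = geo b nu n - geo a nu n)%C.
Proof.
  assert (K : forall n, ((b - a) * (hs (1 - nu * a) (1 - nu * b) (S n) - hs (1 - nu * a) (1 - nu * b) n)
     = (1 - nu * b) ^ S n * b - (1 - nu * a) ^ S n * a)%C).
  { induction n0.
    - simpl. ring.
    - set (p := (1 - nu * a)%C) in *. set (q := (1 - nu * b)%C) in *.
      change (hs p q (S (S n0))) with (q * hs p q (S n0) + p ^ S (S n0))%C.
      assert (E : hs p q (S n0) = (q * hs p q n0 + p ^ S n0)%C) by reflexivity.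
      transitivity (q * ((b - a) * (hs p q (S n0) - hs p q n0)) + (b - a) * (p ^ S n0 * (p - 1)))%C.
      { rewrite E at 2. rewrite (Cpow_S p (S n0)). ring. }
      rewrite IHn0. rewrite (Cpow_S p (S n0)), (Cpow_S q (S n0)).
      set (P := (p ^ S n0)%C). set (Q := (q ^ S n0)%C). unfold p, q. ring. }
  induction n.
  - unfold geo. rewrite !sum_O. simpl. ring.
  - rewrite !geo_S. specialize (K n).
    replace ((b - a) * hs (1 - nu * a) (1 - nu * b) (S n))%C with
      ((b - a) * hs (1 - nu * a) (1 - nu * b) n + (b - a) * (hs (1 - nu * a) (1 - nu * b) (S n) - hs (1 - nu * a) (1 - nu * b) n))%C by ring.
    rewrite K, IHn. ring.
Qed.

Lemma Cconj_plus z w : Cconj (z + w)%C = (Cconj z + Cconj w)%C.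
Proof. apply C_eq; simpl; ring. Qed.
Lemma Cconj_mult z w : Cconj (z * w)%C = (Cconj z * Cconj w)%C.
Proof. apply C_eq; simpl; ring. Qed.
Lemma Cconj_minus z w : Cconj (z - w)%C = (Cconj z - Cconj w)%C.
Proof. apply C_eq; simpl; ring. Qed.
Lemma Cconj_R x : Cconj (RtoC x) = RtoC x.
Proof. apply C_eq; simpl; ring. Qed.
Lemma Cconj_pow z n : Cconj (z ^ n)%C = (Cconj z ^ n)%C.
Proof. induction n. apply Cconj_R. simpl. rewrite Cconj_mult, IHn. reflexivity. Qed.
Lemma Cconj_inv z : Cconj (/ z)%C = (/ Cconj z)%C.
Proof.
  apply C_eq; simpl; [f_equal; ring|]. unfold Rdiv.
  replace (fst z * (fst z * 1) + - snd z * (- snd z * 1)) with (fst z * (fst z * 1) + snd z * (snd z * 1)) by ring.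
  ring.
Qed.
Lemma Cconj_im z : (Cconj z - z = RtoC (-2) * Ci * RtoC (Im z))%C.
Proof. apply C_eq; simpl; unfold Im; ring. Qed.
Lemma Cmod_conj z : Cmod (Cconj z) = Cmod z.
Proof. unfold Cmod. f_equal. simpl. ring. Qed.

Lemma Cconj_geo a nu n : Cconj (geo a (RtoC nu) n) = geo (Cconj a) (RtoC nu) n.
Proof.
  induction n.
  - unfold geo. rewrite !sum_O. simpl. rewrite Cconj_mult, Cconj_R. reflexivity.
  - rewrite !geo_S, Cconj_plus, IHn, Cconj_mult, Cconj_pow, Cconj_minus, Cconj_mult, !Cconj_R. reflexivity.
Qed.

Lemma lin_conj u z : lin u (Cconj z) = Cconj (lin u z).
Proof. unfold lin. rewrite Cconj_plus, Cconj_mult, !Cconj_R. reflexivity. Qed.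

(* The term of the lattice point u on the right-hand side of the theorem, for k = n + 2, at
   X = x, Y = 1. *)
Definition Tt (n : nat) (x : R) (z : C) (u : Z * Z) : C :=
  sum_n (fun r => RtoC (Im z) / (lin u z ^ (r + 1) * lin u (Cconj z) ^ (n - r + 1))
     * ((RtoC x - z) ^ r * (RtoC x - Cconj z) ^ (n - r)))%C n.

(** The real closed form of [Tt]. With w = (x - z) / l and nu = m x + n' for the lattice point (m,
    n'), both cases are - Im (w^(n+1)) / nu where nu <> 0; for m <> 0 one has w = (-1/m) (1 - nu /
    l), and [geo] removes the singularity at nu = 0. *)
Definition Tr (n : nat) (x : R) (z : C) (u : Z * Z) : R :=
  if Z.eqb (fst u) 0 then - (/ IZR (snd u)) ^ (n + 2) * Im ((RtoC x - z) ^ S n)%C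
  else (- / IZR (fst u)) ^ S n * Im (geo (/ lin u z) (RtoC (IZR (fst u) * x + IZR (snd u))) n).

Lemma Tt_hs n x z u : lin u z <> RtoC 0 ->
  Tt n x z u = (RtoC (Im z) * / lin u z * Cconj (/ lin u z) *
    hs ((RtoC x - z) * / lin u z) (Cconj ((RtoC x - z) * / lin u z)) n)%C.
Proof.
  intros Hl. unfold Tt. rewrite lin_conj, <- hs_sum.
  rewrite Csum_mult_l. apply sum_n_ext_loc. intros r Hr. cbv beta.
  rewrite Cconj_mult, Cconj_minus, Cconj_R, Cconj_inv.
  set (l := lin u z) in *. assert (Hlc : Cconj l <> RtoC 0).
  { intros E. apply Hl. rewrite <- (Cconj_conj l), E. apply Cconj_R. }
  set (A := (RtoC x - z)%C). set (B := (RtoC x - Cconj z)%C).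
  rewrite !Cpow_mult_l, !Nat.add_1_r, !Cpow_S, !Cpow_inv by auto.
  assert (N1 : (l ^ r)%C <> RtoC 0) by (apply Cpow_nz; auto).
  assert (N2 : (Cconj l ^ (n - r))%C <> RtoC 0) by (apply Cpow_nz; auto).
  ceq. field. auto.
Qed.

Lemma IZR_nz m : m <> 0%Z -> IZR m <> 0.
Proof. intros H E. apply eq_IZR in E. auto. Qed.

Lemma Tt_Tr n x z u : 0 < Im z -> u <> (0, 0)%Z -> Tt n x z u = RtoC (Tr n x z u).
Proof.
  intros Hz Hu. assert (Hl := lin_nz z u Hz Hu). rewrite Tt_hs by auto.
  destruct u as [m k]. unfold Tr. simpl fst; simpl snd. destruct (Z.eqb_spec m 0) as [->|Hm].
  - assert (Hk : k <> 0%Z) by (intros ->; auto).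
    assert (Hk' : IZR k <> 0) by (apply IZR_nz; auto).
    replace (lin (0%Z, k) z) with (RtoC (IZR k)) by (unfold lin; simpl fst; simpl snd; ring).
    rewrite <- RtoC_inv by auto. set (a := / IZR k).
    rewrite Cconj_mult, !Cconj_R, Cconj_minus, Cconj_R.
    replace ((RtoC x - z) * RtoC a)%C with (RtoC a * (RtoC x - z))%C by ring.
    replace ((RtoC x - Cconj z) * RtoC a)%C with (RtoC a * (RtoC x - Cconj z))%C by ring.
    rewrite hs_scal.
    assert (D := hs_diff (RtoC x - z) (RtoC x - Cconj z) n).
    set (h := hs (RtoC x - z) (RtoC x - Cconj z) n) in *.
    assert (E1 : (RtoC x - z - (RtoC x - Cconj z) = RtoC (-2) * Ci * RtoC (Im z))%C).
    { rewrite <- Cconj_im. ring. }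
    assert (E2 : ((RtoC x - z) ^ S n - (RtoC x - Cconj z) ^ S n = RtoC 2 * Ci * RtoC (Im ((RtoC x - z) ^ S n)))%C).
    { assert (X := Cconj_im ((RtoC x - z) ^ S n)%C).
      rewrite Cconj_pow, Cconj_minus, Cconj_R in X.
      replace ((RtoC x - z) ^ S n - (RtoC x - Cconj z) ^ S n)%C with (- ((RtoC x - Cconj z) ^ S n - (RtoC x - z) ^ S n))%C by ring.
      rewrite X. replace (RtoC (-2)) with (- RtoC 2)%C by (rewrite <- RtoC_opp; f_equal; ring). ring. }
    rewrite E1, E2 in D.
    assert (E3 : (RtoC (Im z) * h = - RtoC (Im ((RtoC x - z) ^ S n)))%C).
    { assert (N2 : (RtoC 2 * Ci)%C <> RtoC 0).
      { apply Cmult_neq_0. intros X; apply RtoC_inj in X; lra. apply Ci_nz. }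
      replace (RtoC (-2)) with (- RtoC 2)%C in D by (rewrite <- RtoC_opp; f_equal; ring).
      set (c := (RtoC 2 * Ci)%C) in *.
      assert (D' : (c * (RtoC (Im z) * h) = c * - RtoC (Im ((RtoC x - z) ^ S n)))%C).
      { replace (c * (RtoC (Im z) * h))%C with (- (- RtoC 2 * Ci * RtoC (Im z) * h))%C by (unfold c; ring).
        rewrite D. ring. }
      replace (RtoC (Im z) * h)%C with (/ c * (c * (RtoC (Im z) * h)))%C by (field; auto).
      rewrite D'. field. auto. }
    transitivity (RtoC a * RtoC a * RtoC a ^ n * (RtoC (Im z) * h))%C. ring.
    rewrite E3. rewrite RtoC_mult, RtoC_opp, RtoC_pow. rewrite Nat.add_comm. simpl. ring.
  - assert (Hm' : IZR m <> 0) by (apply IZR_nz; auto).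
    set (l := lin (m, k) z) in *. set (nu := IZR m * x + IZR k).
    assert (HmC : RtoC (IZR m) <> RtoC 0) by (intros E; apply RtoC_inj in E; auto).
    assert (Ew : ((RtoC x - z) * / l = RtoC (- / IZR m) * (1 - RtoC nu * / l))%C).
    { rewrite RtoC_opp, RtoC_inv by auto. unfold nu. rewrite RtoC_plus, RtoC_mult.
      replace (RtoC (IZR k)) with (l - RtoC (IZR m) * z)%C by (unfold l, lin; simpl fst; simpl snd; ring).
      field. auto. }
    rewrite Ew, Cconj_mult, Cconj_minus, Cconj_mult, !Cconj_R, hs_scal.
    assert (EG := hs_geo (/ l) (Cconj (/ l)) (RtoC nu) n).
    rewrite <- Cconj_geo, (Cconj_im (geo (/ l) (RtoC nu) n)) in EG.
    (* From Im l = m Im z. This is the factor b - a of [hs_geo] for a = 1 / l and b its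
       conjugate. *)
    assert (Ei : (Cconj (/ l) - / l = RtoC 2 * Ci * RtoC (IZR m) * (RtoC (Im z) * / l * Cconj (/ l)))%C).
    { rewrite Cconj_inv. assert (Hlc : Cconj l <> RtoC 0).
      { intros E. apply Hl. rewrite <- (Cconj_conj l), E. apply Cconj_R. }
      assert (X := Cconj_im l). replace (Im l) with (IZR m * Im z) in X.
      2:{ unfold l, lin. simpl. unfold Im. ring. }
      rewrite RtoC_mult in X.
      replace (/ Cconj l - / l)%C with (- (Cconj l - l) * (/ l * / Cconj l))%C by (field; auto).
      rewrite X. replace (RtoC (-2)) with (- RtoC 2)%C by (rewrite <- RtoC_opp; f_equal; ring). ring. }
    rewrite Ei in EG.
    set (h := hs (1 - RtoC nu * / l) (1 - RtoC nu * Cconj (/ l)) n) in *.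
    set (I := Im (geo (/ l) (RtoC nu) n)) in *.
    set (y := (RtoC (Im z) * / l * Cconj (/ l))%C) in *.
    assert (N2 : (RtoC 2 * Ci)%C <> RtoC 0).
    { apply Cmult_neq_0. intros X; apply RtoC_inj in X; lra. apply Ci_nz. }
    replace (RtoC (-2)) with (- RtoC 2)%C in EG by (rewrite <- RtoC_opp; f_equal; ring).
    assert (EH : (y * h = RtoC (- / IZR m) * RtoC I)%C).
    { rewrite RtoC_opp, RtoC_inv by auto.
      set (c := (RtoC 2 * Ci)%C) in *. set (mm := RtoC (IZR m)) in *.
      replace (y * h)%C with (/ c * / mm * (c * mm * y * h))%C by (field; auto).
      rewrite EG. unfold c in *. field. auto using Ci_nz. }
    transitivity (RtoC (- / IZR m) ^ n * (y * h))%C. ring.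
    rewrite EH, RtoC_mult, RtoC_pow. simpl. ring.
Qed.

(** The path of integration of [int_to_ioo], in the same form, so that the two integrands are
    convertible. *)
Definition vl (tau : C) (t : R) : C := (tau + Ci * RtoC t)%C.

Lemma Im_vl tau t : Im (vl tau t) = Im tau + t.
Proof. unfold vl. simpl. unfold Im. ring. Qed.
Lemma Re_vl tau t : Re (vl tau t) = Re tau.
Proof. unfold vl. simpl. unfold Re. ring. Qed.
Lemma Cmod_vl tau t : Cmod (vl tau t) <= Cmod tau + Rabs t.
Proof. unfold vl. eapply Rle_trans. apply Cmod_triangle. rewrite Cmod_mult, Cmod_Ci, Cmod_R. lra. Qed.

Lemma cder_vl tau t : cder (vl tau) t Ci.
Proof. apply cder_line. Qed.

Lemma cder_lin_inv tau t u : lin u (vl tau t) <> RtoC 0 ->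
  cder (fun s => / lin u (vl tau s))%C t (- (RtoC (IZR (fst u)) * Ci * / lin u (vl tau t) ^ 2))%C.
Proof.
  intros Hl. apply (cder_inv (fun s => lin u (vl tau s))); auto.
  unfold lin. eapply cder_eq; [|apply cder_plus; [apply cder_scal, cder_vl|apply cder_const]]. ring.
Qed.

(** The sum collapses: for nu <> 0, [geo] is (1 - (1 - nu / l)^(n+1)) / nu and its derivative is a
    single power. *)
Lemma cder_geo tau t u nu n : lin u (vl tau t) <> RtoC 0 ->
  cder (fun s => geo (/ lin u (vl tau s)) nu n) t
   (- (RtoC (IZR (fst u)) * Ci * RtoC (INR (S n)) * (1 - nu * / lin u (vl tau t)) ^ n * (/ lin u (vl tau t)) ^ 2))%C.
Proof.
  intros Hl. assert (D := cder_lin_inv tau t u Hl).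
  assert (Dr : cder (fun s => 1 - nu * / lin u (vl tau s))%C t
     (0 - nu * (- (RtoC (IZR (fst u)) * Ci * / lin u (vl tau t) ^ 2)))%C).
  { apply cder_minus. apply cder_const. apply cder_scal. auto. }
  induction n.
  - eapply cder_eq; [|eapply cder_ext; [|apply D]].
    + simpl. field. auto.
    + intros s. unfold geo. rewrite sum_O. simpl. ring.
  - eapply cder_eq; [|eapply cder_ext; [|apply (cder_plus _ _ _ _ _ IHn (cder_mult _ _ _ _ _ (cder_pow _ _ _ n Dr) D))]].
    + cbv beta. rewrite (S_INR (S n)), RtoC_plus. set (q := RtoC (INR (S n))). rewrite !(Cpow_S _ n).
      set (l := lin u (vl tau t)) in *. set (P := ((1 - nu * / l) ^ n)%C). field. auto.
    + intros s. rewrite geo_S. reflexivity.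
Qed.

Lemma is_derive_Tr n x tau t u : 0 < Im tau + t -> u <> (0, 0)%Z ->
  is_derive (fun s => Tr n x (vl tau s) u) t
   (INR (S n) * Re ((RtoC x - vl tau t) ^ n * / lin u (vl tau t) ^ (n + 2))%C).
Proof.
  intros Ht Hu. assert (Hl : lin u (vl tau t) <> RtoC 0) by (apply lin_nz; auto; rewrite Im_vl; auto).
  unfold Tr. destruct (Z.eqb_spec (fst u) 0) as [E|E].
  - assert (D : cder (fun s => (RtoC x - vl tau s) ^ S n)%C t
      (RtoC (INR (S n)) * (RtoC x - vl tau t) ^ n * (0 - Ci))%C).
    { apply cder_pow, cder_minus. apply cder_const. apply cder_vl. }
    destruct D as [_ D]. apply (is_derive_scal _ _ (- (/ IZR (snd u)) ^ (n + 2))) in D.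
    replace (lin u (vl tau t)) with (RtoC (IZR (snd u))) by (unfold lin; rewrite E; ring).
    assert (Hs : IZR (snd u) <> 0).
    { apply IZR_nz. intros E2. apply Hu. destruct u; simpl in *; subst; auto. }
    assert (EE : (/ RtoC (IZR (snd u)) ^ (n + 2))%C = RtoC ((/ IZR (snd u)) ^ (n + 2))).
    { rewrite RtoC_pow, RtoC_inv by auto. rewrite Cpow_inv; auto.
      intros X; apply RtoC_inj in X; auto. }
    rewrite EE. set (a := (/ IZR (snd u)) ^ (n + 2)) in *. set (P := ((RtoC x - vl tau t) ^ n)%C) in *.
    set (q := INR (S n)) in *.
    replace (q * Re (P * RtoC a)%C) with (- a * Im (RtoC q * P * (0 - Ci))%C); auto.
    simpl. unfold Re, Im. ring.
  - assert (D := cder_geo tau t u (RtoC (IZR (fst u) * x + IZR (snd u))) n Hl).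
    destruct D as [_ D]. apply (is_derive_scal _ _ ((- / IZR (fst u)) ^ S n)) in D.
    assert (Hm' : IZR (fst u) <> 0) by (apply IZR_nz; auto).
    assert (HmC : RtoC (IZR (fst u)) <> RtoC 0) by (intros X; apply RtoC_inj in X; auto).
    set (l := lin u (vl tau t)) in *. set (m := IZR (fst u)) in *. set (nu := RtoC (m * x + IZR (snd u))) in *.
    assert (Ew : (RtoC (- / m) * (1 - nu * / l) = (RtoC x - vl tau t) * / l)%C).
    { unfold nu. rewrite RtoC_opp, RtoC_inv, RtoC_plus, RtoC_mult by auto.
      replace (RtoC (IZR (snd u))) with (l - RtoC m * vl tau t)%C by (unfold l, lin, m; ring).
      field. auto. }
    replace ((RtoC x - vl tau t) ^ n * / l ^ (n + 2))%C with (((RtoC x - vl tau t) * / l) ^ n * / l ^ 2)%C.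
    2:{ rewrite Cpow_mult_l, Cpow_add_r, Cpow_inv by auto.
        assert (N1 : (l ^ n)%C <> RtoC 0) by (apply Cpow_nz; auto). field. auto. }
    rewrite <- Ew, Cpow_mult_l, <- RtoC_pow, <- Cpow_inv by auto.
    set (P := ((1 - nu * / l) ^ n)%C) in *. set (Q := ((/ l) ^ 2)%C) in *.
    set (q := INR (S n)) in *.
    replace (q * Re (RtoC ((- / m) ^ n) * P * Q)%C) with ((- / m) ^ S n * Im (- (RtoC m * Ci * RtoC q * P * Q))%C); auto.
    set (b := (- / m) ^ n). change ((- / m) ^ S n) with (- / m * b).
    replace (RtoC b * P * Q)%C with (RtoC b * (P * Q))%C by ring.
    replace (- (RtoC m * Ci * RtoC q * P * Q))%C with (RtoC (- m * q) * (Ci * (P * Q)))%C.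
    2:{ rewrite RtoC_mult, RtoC_opp. ring. }
    generalize (P * Q)%C. intros PQ. simpl. unfold Re, Im. field. auto.
Qed.

(** * The lattice sum of the terms [Tr] and its derivative *)

Lemma Cmod_hs A B r n : Cmod A = r -> Cmod B = r -> Cmod (hs A B n) <= INR (S n) * r ^ n.
Proof.
  intros HA HB. assert (Hr : 0 <= r) by (rewrite <- HA; apply Cmod_ge_0).
  induction n. simpl. rewrite Cmod_1. lra.
  change (hs A B (S n)) with (B * hs A B n + A ^ S n)%C.
  eapply Rle_trans. apply Cmod_triangle. rewrite Cmod_mult, Cmod_pow, HA, HB.
  rewrite (S_INR (S n)), Rmult_plus_distr_r, Rmult_1_l. apply Rplus_le_compat_r.
  apply Rle_trans with (r * (INR (S n) * r ^ n)). apply Rmult_le_compat_l; auto.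
  right. change (r ^ S n) with (r * r ^ n). ring.
Qed.

Lemma Cmod_xminus_le x z K : Cmod z <= K -> Cmod (RtoC x - z)%C <= Rabs x + K.
Proof.
  intros H. unfold Cminus. eapply Rle_trans. apply Cmod_triangle.
  rewrite Cmod_opp, Cmod_R. lra.
Qed.

Lemma Tr_bound n x y0 K : (1 <= n)%nat -> 0 < y0 -> exists B, 0 < B /\ forall z u,
  y0 <= Im z -> Cmod z <= K -> u <> (0, 0)%Z -> Rabs (Tr n x z u) <= B * wL u.
Proof.
  intros Hn Hy. destruct (inv_lin_bound (n + 2) y0 K ltac:(lia) Hy) as [B [HB H]].
  set (K' := Rmax K 1). assert (HK' : 1 <= K') by apply Rmax_r.
  set (E := K' * (INR (S n) * (Rabs x + K') ^ n)).
  assert (hx := Rabs_pos x).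
  assert (hn : 0 < INR (S n)) by (apply lt_0_INR; lia).
  assert (HE : 0 < E).
  { unfold E. apply Rmult_lt_0_compat. lra. apply Rmult_lt_0_compat; auto. apply pow_lt; lra. }
  exists (E * B). split. apply Rmult_lt_0_compat; auto.
  intros z u Hz HK Hu. specialize (H z u Hz HK Hu).
  assert (Hz0 : 0 < Im z) by lra. assert (Hl := lin_nz z u Hz0 Hu).
  (* The bound is taken on [Tt], where the decay |l|^(-(n+2)) is visible; the summands of [geo]
     decay only like 1 / |l|. *)
  rewrite <- Cmod_R, <- Tt_Tr, Tt_hs by auto.
  set (l := lin u z) in *. set (r := Cmod (/ l)%C).
  assert (Hr : 0 <= r) by apply Cmod_ge_0.
  rewrite !Cmod_mult, Cmod_conj. fold r.
  set (w := ((RtoC x - z) * / l)%C).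
  assert (Hw : Cmod w <= (Rabs x + K') * r).
  { unfold w. rewrite Cmod_mult. fold r. apply Rmult_le_compat_r; auto.
    apply Cmod_xminus_le. eapply Rle_trans; [apply HK|apply Rmax_l]. }
  assert (Hh := Cmod_hs w (Cconj w) (Cmod w) n eq_refl (Cmod_conj w)).
  assert (Hw0 := Cmod_ge_0 w).
  assert (Hh2 : Cmod (hs w (Cconj w) n) <= INR (S n) * ((Rabs x + K') * r) ^ n).
  { eapply Rle_trans. apply Hh. apply Rmult_le_compat_l. lra. apply pow_incr. auto. }
  assert (Hy' : Cmod (RtoC (Im z)) <= K').
  { rewrite Cmod_R. eapply Rle_trans. apply Im_le_Cmod. eapply Rle_trans; [apply HK|apply Rmax_l]. }
  apply Rle_trans with (K' * r * r * (INR (S n) * ((Rabs x + K') * r) ^ n)).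
  - apply Rmult_le_compat; auto using Cmod_ge_0.
    + repeat apply Rmult_le_pos; auto using Cmod_ge_0.
    + repeat apply Rmult_le_compat_r; auto.
  - replace (K' * r * r * (INR (S n) * ((Rabs x + K') * r) ^ n)) with (E * r ^ (n + 2)).
    2:{ unfold E. rewrite Rpow_mult_distr, pow_add. ring. }
    rewrite Rmult_assoc. apply Rmult_le_compat_l. lra.
    unfold r. rewrite Cmod_inv, pow_inv by auto. auto.
Qed.

Lemma usum_Re {T} (F : T -> C) S : usum F S -> usum (fun t => RtoC (Re (F t))) (RtoC (Re S)).
Proof.
  intros H eps. destruct (H eps) as [l0 H0]. exists l0. intros l Hl Hi.
  eapply Rle_lt_trans; [|apply (H0 l Hl Hi)].
  replace (lsum (fun t => RtoC (Re (F t))) l - RtoC (Re S))%C with (RtoC (Re (lsum F l - S)%C)).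
  - rewrite Cmod_R. apply Re_le_Cmod.
  - rewrite Re_minus, RtoC_minus. f_equal. clear. induction l. reflexivity.
    rewrite !lsum_cons, <- IHl, Re_plus, RtoC_plus. reflexivity.
Qed.

Definition Tcl (N n : nat) (v : Z * Z) (x : R) (z : C) (u : Z * Z) : C :=
  if in_class N v u then RtoC (Tr n x z u) else RtoC 0.

Definition Rsum (N n : nat) (v : Z * Z) (x : R) (z : C) : R := Re (tsum (Tcl N n v x z)).

Lemma Tcl_bound n x y0 K : (1 <= n)%nat -> 0 < y0 -> exists B, 0 < B /\ forall N v z u,
  y0 <= Im z -> Cmod z <= K -> Cmod (Tcl N n v x z u) <= B * wL u.
Proof.
  intros Hn Hy. destruct (Tr_bound n x y0 K Hn Hy) as [B [HB H]]. exists B. split; auto.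
  intros N v z u Hz HK. unfold Tcl. assert (h := wL_pos u). destruct (in_class N v u) eqn:E.
  - rewrite Cmod_R. apply H; auto. apply (in_class_nz N v); auto.
  - rewrite Cmod_0. apply Rmult_le_pos; lra.
Qed.

Lemma Rsum_usum N n v x z : (1 <= n)%nat -> 0 < Im z -> usum (Tcl N n v x z) (RtoC (Rsum N n v x z)).
Proof.
  intros Hn Hz. destruct (Tcl_bound n x (Im z) (Cmod z) Hn Hz) as [B [HB H]].
  assert (U : usum (Tcl N n v x z) (tsum (Tcl N n v x z))).
  { apply (tsum_spec _ (fun u => B * wL u)). intros u; apply H; lra.
    apply rsummable_scal. lra. apply rsummable_wL. }
  eapply usum_ext; [|apply (usum_Re _ _ U)]. intros u. cbv beta. unfold Tcl.
  destruct (in_class N v u); reflexivity.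
Qed.

Lemma Rsum_derive N n v x tau t : (1 <= n)%nat -> 0 < Im tau + t ->
  is_derive (fun s => Rsum N n v x (vl tau s)) t
    (INR (S n) * Re ((RtoC x - vl tau t) ^ n * G_hol N (n + 2) v (vl tau t))%C).
Proof.
  intros Hn Ht. set (delta := (Im tau + t) / 2). assert (Hd : 0 < delta) by (unfold delta; lra).
  set (K := Cmod tau + (Rabs t + delta)).
  destruct (Gterm_bound (n + 2) delta K ltac:(lia) Hd) as [B [HB H]].
  assert (hn : 0 < INR (S n)) by (apply lt_0_INR; lia).
  assert (hx := Rabs_pos x). assert (HK : 0 <= K).
  { unfold K. assert (h := Cmod_ge_0 tau). assert (h' := Rabs_pos t). lra. }
  set (M := INR (S n) * (Rabs x + K) ^ n * B).
  assert (HM : 0 <= M).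
  { unfold M. apply Rmult_le_pos; [|lra]. apply Rmult_le_pos. lra. apply pow_le; lra. }
  assert (Dom : forall s, Rabs (s - t) < delta -> delta <= Im (vl tau s) /\ Cmod (vl tau s) <= K).
  { intros s Hs. split. rewrite Im_vl. apply Rabs_def2 in Hs. unfold delta in *. lra.
    eapply Rle_trans. apply Cmod_vl. unfold K. apply Rplus_le_compat_l.
    assert (h := Rabs_triang (s - t) t). replace (s - t + t) with s in h by ring. lra. }
  assert (D : cder (fun s => RtoC (Rsum N n v x (vl tau s))) t
     (RtoC (INR (S n) * Re ((RtoC x - vl tau t) ^ n * G_hol N (n + 2) v (vl tau t))%C))).
  { apply (cder_usum (fun s => Tcl N n v x (vl tau s))
     (fun s u => RtoC (INR (S n) * Re ((RtoC x - vl tau s) ^ n * Gterm N (n + 2) v (vl tau s) u)%C))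
     (fun u => M * wL u) _ _ delta); auto.
    - apply rsummable_scal; auto. apply rsummable_wL.
    - intros s Hs u. destruct (Dom s Hs) as [h1 h2]. split.
      + unfold Tcl, Gterm. destruct (in_class N v u) eqn:E.
        * apply cder_RtoC. apply is_derive_Tr. rewrite <- Im_vl. lra.
          apply (in_class_nz N v); auto.
        * rewrite Cmult_0_r. simpl Re. rewrite Rmult_0_r. apply cder_const.
      + rewrite Cmod_R, Rabs_mult, (Rabs_pos_eq (INR (S n))) by lra.
        unfold M. rewrite !Rmult_assoc. apply Rmult_le_compat_l. lra.
        eapply Rle_trans. apply Re_le_Cmod. rewrite Cmod_mult, Cmod_pow.
        apply Rmult_le_compat; try apply Cmod_ge_0. apply pow_le, Cmod_ge_0.
        apply pow_incr. split. apply Cmod_ge_0. apply Cmod_xminus_le; auto.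
        apply H; auto.
    - intros s Hs. apply Rsum_usum; auto. destruct (Dom s Hs). lra.
    - destruct (Dom t ltac:(rewrite Rminus_diag, Rabs_R0; auto)) as [h1 _].
      assert (U := usum_scal _ _ (RtoC (INR (S n)))
        (usum_Re _ _ (usum_scal _ _ ((RtoC x - vl tau t) ^ n)%C (G_hol_usum N (n + 2) v (vl tau t) ltac:(lia) ltac:(lra))))).
      rewrite RtoC_mult. eapply usum_ext; [|apply U]. intros u. cbv beta. rewrite RtoC_mult. reflexivity. }
  destruct D as [D _]. exact D.
Qed.

(** Supplies the continuity of the integrand; the value of the derivative is immaterial. *)
Lemma G_line_cder N k v tau t : (3 <= k)%nat -> 0 < Im tau + t ->
  exists d, cder (fun s => G_hol N k v (vl tau s)) t d.
Proof.
  intros Hk Ht. set (delta := (Im tau + t) / 2). assert (Hd : 0 < delta) by (unfold delta; lra).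
  set (K := Cmod tau + (Rabs t + delta)).
  destruct (Gterm_bound k delta K Hk Hd) as [B [HB H]].
  destruct (lin_lower delta K Hd) as [c [[Hc _] HL]].
  assert (Dom : forall s, Rabs (s - t) < delta -> delta <= Im (vl tau s) /\ Cmod (vl tau s) <= K).
  { intros s Hs. split. rewrite Im_vl. apply Rabs_def2 in Hs. unfold delta in *. lra.
    eapply Rle_trans. apply Cmod_vl. unfold K. apply Rplus_le_compat_l.
    assert (h := Rabs_triang (s - t) t). replace (s - t + t) with s in h by ring. lra. }
  destruct k as [|k]; [lia|].
  assert (hk : 0 < INR (S k)) by (apply lt_0_INR; lia).
  set (M := INR (S k) * / c * B). assert (Pc : 0 < / c) by (apply Rinv_0_lt_compat; auto).
  assert (HM : 0 <= M) by (unfold M; repeat apply Rmult_le_pos; lra).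
  set (F := fun s u => (- (RtoC (INR (S k)) * (RtoC (IZR (fst u)) * Ci * / lin u (vl tau s)) * Gterm N (S k) v (vl tau s) u))%C).
  assert (HF : forall s u, Rabs (s - t) < delta -> Cmod (F s u) <= M * wL u).
  { intros s u Hs. destruct (Dom s Hs) as [h1 h2]. unfold F.
    destruct (in_class N v u) eqn:E.
    2:{ unfold Gterm. rewrite E, Cmult_0_r, Cmod_opp, Cmod_0. assert (h := wL_pos u). apply Rmult_le_pos; lra. }
    assert (Hu := in_class_nz _ _ _ E).
    assert (Hl := lin_nz (vl tau s) u ltac:(lra) Hu).
    rewrite Cmod_opp, !Cmod_mult, !Cmod_R, Cmod_Ci, Rmult_1_r, (Rabs_pos_eq (INR (S k))), Cmod_inv by (auto; lra).
    unfold M. rewrite (Rmult_assoc _ B). apply Rmult_le_compat; try apply Cmod_ge_0.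
    - apply Rmult_le_pos. lra. apply Rmult_le_pos. apply Rabs_pos.
      left. apply Rinv_0_lt_compat, Cmod_gt_0; auto.
    - apply Rmult_le_compat_l. lra.
      assert (Hp : 0 < Cmod (lin u (vl tau s))) by (apply Cmod_gt_0; auto).
      apply Rmult_le_reg_r with (c * Cmod (lin u (vl tau s))). apply Rmult_lt_0_compat; auto.
      replace (Rabs (IZR (fst u)) * / Cmod (lin u (vl tau s)) * (c * Cmod (lin u (vl tau s))))
        with (c * Rabs (IZR (fst u))) by (field; lra).
      replace (/ c * (c * Cmod (lin u (vl tau s)))) with (Cmod (lin u (vl tau s))) by (field; lra).
      eapply Rle_trans; [|apply (HL (vl tau s) h1 h2 (IZR (fst u)) (IZR (snd u)))].
      apply Rmult_le_compat_l. lra. assert (h := Rabs_pos (IZR (snd u))). lra.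
    - apply H; auto. }
  assert (H0 : Rabs (t - t) < delta) by (rewrite Rminus_diag, Rabs_R0; auto).
  exists (tsum (F t)).
  apply (cder_usum (fun s => Gterm N (S k) v (vl tau s)) F (fun u => M * wL u) _ _ delta); auto.
  - apply rsummable_scal; auto. apply rsummable_wL.
  - intros s Hs u. split; auto. destruct (Dom s Hs) as [h1 h2]. unfold F, Gterm.
    destruct (in_class N v u) eqn:E.
    + assert (Hu := in_class_nz _ _ _ E).
      assert (Hl := lin_nz (vl tau s) u ltac:(lra) Hu).
      assert (D : cder (fun s => lin u (vl tau s)) s (RtoC (IZR (fst u)) * Ci)%C).
      { unfold lin. eapply cder_eq; [|apply cder_plus; [apply cder_scal, cder_vl|apply cder_const]]. ring. }
      eapply cder_eq; [|apply cder_inv; [apply Cpow_nz; auto|apply cder_pow; apply D]].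
      cbv beta. rewrite !(Cpow_S _ k). assert (N1 : (lin u (vl tau s) ^ k)%C <> RtoC 0) by (apply Cpow_nz; auto).
      set (l := lin u (vl tau s)) in *. set (P := (l ^ k)%C) in *. simpl Cpow. field. auto.
    + eapply cder_eq; [|apply cder_const]. ring.
  - intros s Hs. apply G_hol_usum; auto. destruct (Dom s Hs). lra.
  - apply (tsum_spec _ (fun u => M * wL u)). intros u. apply HF; auto.
    apply rsummable_scal; auto. apply rsummable_wL.
Qed.

(** * Improper integrals of exponentially decaying functions *)

Lemma is_derive_monotone (f df : R -> R) a b :
  a <= b -> (forall t, a <= t <= b -> is_derive f t (df t) /\ 0 <= df t) -> f a <= f b.
Proof.
  intros Hab H.
  destruct (MVT_gen f a b df) as [c [Hc E]].
  - rewrite Rmin_left, Rmax_right by auto. intros t Ht. apply H; lra.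
  - rewrite Rmin_left, Rmax_right by auto. intros t Ht.
    apply derivable_continuous_pt. exists (df t). apply is_derive_Reals. apply H; lra.
  - rewrite Rmin_left, Rmax_right in Hc by auto. destruct (H c Hc) as [_ h].
    assert (0 <= df c * (b - a)) by (apply Rmult_le_pos; lra). lra.
Qed.

(** With E = (B / c) e^(-c t), J - E increases and J + E decreases; they enclose the limit at
    distance at most E on either side. *)
Lemma decaying_primitive_limit (J h : R -> R) B c T1 : 0 < c -> 0 <= T1 ->
  (forall t, 0 <= t -> is_derive J t (h t)) ->
  (forall t, T1 <= t -> Rabs (h t) <= B * exp (- (c * t))) ->
  exists L, forall T, T1 <= T -> Rabs (J T - L) <= B / c * exp (- (c * T)).
Proof.
  intros Hc HT1 HJ Hh.
  assert (HB : 0 <= B).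
  { specialize (Hh T1 (Rle_refl _)). assert (h1 := Rabs_pos (h T1)). assert (h2 := exp_pos (- (c * T1))). nra. }
  set (E := fun t => B / c * exp (- (c * t))).
  assert (DE : forall t, is_derive E t (- (B * exp (- (c * t))))).
  { intros t. unfold E. auto_derive. auto. field. lra. }
  set (U := fun t => J t - E t). set (V := fun t => J t + E t).
  assert (HU : forall s t, T1 <= s -> s <= t -> U s <= U t).
  { intros s t Hs Hst. apply (is_derive_monotone U (fun t => h t - - (B * exp (- (c * t))))); auto.
    intros r Hr. split. apply (is_derive_minus J E); auto. apply HJ; lra.
    specialize (Hh r ltac:(lra)). apply Rabs_le_between in Hh. lra. }
  assert (HV : forall s t, T1 <= s -> s <= t -> V t <= V s).
  { intros s t Hs Hst. apply Ropp_le_cancel.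
    apply (is_derive_monotone (fun t => - V t) (fun t => - (h t + - (B * exp (- (c * t)))))); auto.
    intros r Hr. split. apply (is_derive_opp V). apply (is_derive_plus J E); auto. apply HJ; lra.
    specialize (Hh r ltac:(lra)). apply Rabs_le_between in Hh. lra. }
  assert (EP : forall t, 0 <= E t).
  { intros t. unfold E, Rdiv. repeat apply Rmult_le_pos; auto. left; apply Rinv_0_lt_compat; auto. left; apply exp_pos. }
  assert (HUV : forall s t, T1 <= s -> T1 <= t -> U s <= V t).
  { intros s t Hs Ht. destruct (Rle_dec s t).
    - assert (a := HU s t Hs r). assert (b := EP t). unfold U, V in *. lra.
    - assert (a := HV t s Ht ltac:(lra)). assert (b := EP s). unfold U, V in *. lra. }
  destruct (completeness (fun y => exists s, T1 <= s /\ y = U s)) as [L [L1 L2]].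
  - exists (V T1). intros y [s [Hs ->]]. apply HUV; lra.
  - exists (U T1), T1. split; auto. lra.
  - exists L. intros T HT. fold (E T).
    assert (a : U T <= L) by (apply L1; eauto).
    assert (b : L <= V T). { apply L2. intros y [s [Hs ->]]. auto. }
    unfold U, V in *. apply Rabs_le. lra.
Qed.

(** The margin [delta] to the left of 0 makes the primitive differentiable at the endpoint 0 too. *)
Lemma improper_integral (g : R -> C) delta B c T1 : 0 < delta -> 0 < c -> 0 <= T1 ->
  (forall t, - delta < t -> exists d, cder g t d) ->
  (forall t, T1 <= t -> Cmod (g t) <= B * exp (- (c * t))) ->
  exists (J : R -> C) (L : C), J 0 = RtoC 0 /\ (forall t, 0 <= t -> cder J t (g t)) /\
   (forall eps : posreal, exists T0, forall T, T0 <= T -> Cmod (J T - L)%C < eps) /\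
   RInt_gen (V := C_R_CompleteNormedModule) g (at_point 0) (Rbar_locally p_infty) = L.
Proof.
  intros Hd Hc HT1 Hg Hb.
  assert (CR : forall t, - delta < t -> continuous (fun s => Re (g s)) t).
  { intros t Ht. destruct (Hg t Ht) as [d [D _]]. apply (ex_derive_continuous (V := R_NormedModule)). eexists; apply D. }
  assert (CI : forall t, - delta < t -> continuous (fun s => Im (g s)) t).
  { intros t Ht. destruct (Hg t Ht) as [d [_ D]]. apply (ex_derive_continuous (V := R_NormedModule)). eexists; apply D. }
  assert (IR : forall t, - delta < t -> is_RInt (fun s => Re (g s)) 0 t (RInt (fun s => Re (g s)) 0 t)).
  { intros t Ht. apply (RInt_correct (V := R_CompleteNormedModule)). apply (ex_RInt_continuous (V := R_CompleteNormedModule)). intros z Hz. apply CR.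
    eapply Rlt_le_trans; [|apply Hz]. apply Rmin_case; lra. }
  assert (II : forall t, - delta < t -> is_RInt (fun s => Im (g s)) 0 t (RInt (fun s => Im (g s)) 0 t)).
  { intros t Ht. apply (RInt_correct (V := R_CompleteNormedModule)). apply (ex_RInt_continuous (V := R_CompleteNormedModule)). intros z Hz. apply CI.
    eapply Rlt_le_trans; [|apply Hz]. apply Rmin_case; lra. }
  set (J := fun t => (RInt (fun s => Re (g s)) 0 t, RInt (fun s => Im (g s)) 0 t) : C).
  assert (DJ : forall t, 0 <= t -> cder J t (g t)).
  { intros t Ht. split.
    - apply (is_derive_RInt (fun s => Re (g s)) (fun t => RInt (fun s => Re (g s)) 0 t) 0).
      exists (mkposreal _ Hd). intros s Hs. apply IR.
      assert (Hs' : Rabs (s - t) < delta) by exact Hs. apply Rabs_def2 in Hs'. lra.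
      apply CR. lra.
    - apply (is_derive_RInt (fun s => Im (g s)) (fun t => RInt (fun s => Im (g s)) 0 t) 0).
      exists (mkposreal _ Hd). intros s Hs. apply II.
      assert (Hs' : Rabs (s - t) < delta) by exact Hs. apply Rabs_def2 in Hs'. lra.
      apply CI. lra. }
  destruct (decaying_primitive_limit (fun t => Re (J t)) (fun t => Re (g t)) B c T1) as [L1 HL1]; auto.
  { intros t Ht. apply (DJ t Ht). }
  { intros t Ht. eapply Rle_trans. apply Re_le_Cmod. auto. }
  destruct (decaying_primitive_limit (fun t => Im (J t)) (fun t => Im (g t)) B c T1) as [L2 HL2]; auto.
  { intros t Ht. apply (DJ t Ht). }
  { intros t Ht. eapply Rle_trans. apply Im_le_Cmod. auto. }
  assert (LIM : forall eps : posreal, exists T0, forall T, T0 <= T -> Cmod (J T - (L1, L2))%C < eps).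
  { intros eps. destruct (exp_decay_small c (2 * (B / c)) eps Hc) as [T0 [H1 HT0]].
    exists (Rmax T0 T1). intros T HT.
    specialize (HL1 T (Rle_trans _ _ _ (Rmax_r _ _) HT)). specialize (HL2 T (Rle_trans _ _ _ (Rmax_r _ _) HT)).
    specialize (HT0 T (Rle_trans _ _ _ (Rmax_l _ _) HT)).
    eapply Rle_lt_trans. apply Cmod_le_abs. rewrite Re_minus, Im_minus.
    change (Re (L1, L2)) with L1. change (Im (L1, L2)) with L2. lra. }
  exists J, (L1, L2). split; [|split; [|split]]; auto.
  - unfold J. rewrite !RInt_point. reflexivity.
  - apply is_RInt_gen_unique. intros P [eps HP].
    destruct (LIM eps) as [T0 HT0].
    apply (Filter_prod _ _ _ (fun a => a = 0) (fun b => Rmax T0 0 < b)).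
    + reflexivity.
    + exists (Rmax T0 0). auto.
    + intros a b -> Hb'. exists (J b). split.
      * simpl. apply (is_RInt_fct_extend_pair g 0 b).
        -- apply IR. assert (h := Rmax_r T0 0). lra.
        -- apply II. assert (h := Rmax_r T0 0). lra.
      * apply HP. apply Cball. apply HT0. assert (h := Rmax_l T0 0). lra.
Qed.

(** * The constant [A_G] *)

Lemma usum_Z_signs (F : Z -> C) A B : F 0%Z = RtoC 0 ->
  usum (fun d => F (Z.of_nat (S d))) A -> usum (fun d => F (- Z.of_nat (S d))%Z) B -> usum F (A + B)%C.
Proof.
  intros H0 HA HB.
  assert (UA : usum (fun n => if Z.ltb 0 n then F n else RtoC 0) A).
  { apply (usum_inj (fun d => Z.of_nat (S d))).
    - intros; lia.
    - intros u Hu. destruct (Z.ltb_spec 0 u); [|congruence]. exists (Z.to_nat (u - 1)). lia.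
    - eapply usum_ext; [|apply HA]. intros d. cbv beta. destruct (Z.ltb_spec 0 (Z.of_nat (S d))); auto; lia. }
  assert (UB : usum (fun n => if Z.ltb n 0 then F n else RtoC 0) B).
  { apply (usum_inj (fun d => (- Z.of_nat (S d))%Z)).
    - intros; lia.
    - intros u Hu. destruct (Z.ltb_spec u 0); [|congruence]. exists (Z.to_nat (- u - 1)). lia.
    - eapply usum_ext; [|apply HB]. intros d. cbv beta. destruct (Z.ltb_spec (- Z.of_nat (S d)) 0); auto; lia. }
  eapply usum_ext; [|apply (usum_plus _ _ _ _ UA UB)]. intros n. cbv beta.
  destruct (Z.ltb_spec 0 n), (Z.ltb_spec n 0); try lia; try ring.
  replace n with 0%Z by lia. rewrite H0. ring.
Qed.

Lemma usum_sum_n {T} (F : nat -> T -> C) (S : nat -> C) n :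
  (forall b, (b <= n)%nat -> usum (F b) (S b)) -> usum (fun t => sum_n (fun b => F b t) n) (sum_n S n).
Proof.
  induction n; intros H.
  - rewrite sum_O. eapply usum_ext; [|apply (H 0%nat); auto]. intros t. rewrite sum_O. reflexivity.
  - rewrite sum_Sn. eapply usum_ext; [|apply (usum_plus _ _ _ _ (IHn ltac:(intros; apply H; lia)) (H (Datatypes.S n) (Nat.le_refl _)))].
    intros t. cbv beta. rewrite sum_Sn. reflexivity.
Qed.

Lemma Re_sum_n (f : nat -> C) n : Re (sum_n f n) = sum_n (fun i => Re (f i)) n.
Proof.
  induction n. rewrite !sum_O; reflexivity. rewrite !sum_Sn, <- IHn. reflexivity.
Qed.

Lemma RtoC_sum_n (f : nat -> R) n : RtoC (sum_n f n) = sum_n (fun i => RtoC (f i)) n.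
Proof.
  induction n. rewrite !sum_O; reflexivity. rewrite !sum_Sn, <- IHn. unfold plus; simpl. apply RtoC_plus.
Qed.

Lemma geometric_sum (w : C) n : ((1 - w) * sum_n (fun b => w ^ b) n = 1 - w ^ S n)%C.
Proof.
  induction n. rewrite sum_O. simpl. ring.
  rewrite sum_Sn. unfold plus; simpl. rewrite Cmult_plus_distr_l.
  match goal with |- (?A + _ = _)%C => change A with ((1 - w) * sum_n (fun b => w ^ b) n)%C end.
  rewrite IHn. simpl. ring.
Qed.

Lemma ec_R y : ec (RtoC y) = (cos (2 * PI * y), sin (2 * PI * y)).
Proof.
  unfold ec, cexp. simpl.
  replace ((2 * PI * 0 - 0 * 1) * y - (2 * PI * 1 + 0 * 0) * 0) with 0 by ring.
  replace ((2 * PI * 0 - 0 * 1) * 0 + (2 * PI * 1 + 0 * 0) * y) with (2 * PI * y) by ring.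
  rewrite exp_0, !Rmult_1_l. reflexivity.
Qed.

Lemma ec_pow y b : (ec (RtoC y) ^ b)%C = ec (RtoC (y * INR b)).
Proof.
  unfold ec. rewrite <- cexp_INR. f_equal. rewrite (RtoC_mult y). ring.
Qed.

Lemma cos_orthogonality N (t : Z) : (1 <= N)%nat ->
  sum_n (fun b => cos (2 * PI * (IZR t / INR N * INR b))) (N - 1) = if cong N t 0 then INR N else 0.
Proof.
  intros HN. assert (h : 0 < INR N) by (apply lt_0_INR; lia). assert (hp := PI_RGT_0).
  set (w := ec (RtoC (IZR t / INR N))).
  assert (E : sum_n (fun b => cos (2 * PI * (IZR t / INR N * INR b))) (N - 1) = Re (sum_n (fun b => w ^ b)%C (N - 1))).
  { rewrite Re_sum_n. apply sum_n_ext. intros b. unfold w. rewrite ec_pow, ec_R. reflexivity. }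
  destruct (cong N t 0) eqn:Ec.
  - apply cong_spec in Ec; auto. destruct Ec as [l ->].
    rewrite (sum_n_ext _ (fun _ => 1)).
    + rewrite sum_n_const. replace (S (N - 1)) with N by lia. apply Rmult_1_r.
    + intros b. rewrite Z.add_0_l, mult_IZR, <- INR_IZR_INZ.
      replace (2 * PI * (INR N * IZR l / INR N * INR b)) with (2 * PI * IZR (l * Z.of_nat b)).
      2:{ rewrite mult_IZR, <- INR_IZR_INZ. field. lra. }
      assert (X := ec_Z (l * Z.of_nat b)). rewrite ec_R in X. apply (f_equal Re) in X. exact X.
  - rewrite E.
    assert (G := geometric_sum w (N - 1)). replace (S (N - 1)) with N in G by lia.
    assert (WN : (w ^ N)%C = RtoC 1).
    { unfold w. rewrite ec_pow. replace (IZR t / INR N * INR N) with (IZR t) by (field; lra). apply ec_Z. }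
    rewrite WN in G.
    assert (W1 : (1 - w)%C <> RtoC 0).
    { intros X. assert (X' : w = RtoC 1) by (replace w with (1 - (1 - w))%C by ring; rewrite X; ring).
      unfold w in X'. rewrite ec_R in X'. apply (f_equal Re) in X'. simpl in X'.
      assert (Y : sin (PI * (IZR t / INR N)) = 0).
      { replace (2 * PI * (IZR t / INR N)) with (2 * (PI * (IZR t / INR N))) in X' by ring.
        rewrite cos_2a_sin in X'. nra. }
      apply sin_eq_0_0 in Y. destruct Y as [l Hl].
      assert (Z1 : IZR t = IZR (Z.of_nat N * l)).
      { rewrite mult_IZR, <- INR_IZR_INZ. apply Rmult_eq_reg_l with (PI / INR N).
        2:{ apply Rgt_not_eq, Rdiv_lt_0_compat; auto. }
        transitivity (PI * (IZR t / INR N)). field; lra. rewrite Hl. field. lra. }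
      apply eq_IZR in Z1. assert (cong N t 0 = true) by (apply cong_spec; auto; exists l; lia). congruence. }
    set (s := sum_n (fun b => w ^ b)%C (N - 1)) in *.
    replace s with (/ (1 - w) * ((1 - w) * s))%C by (ceq; field; auto).
    rewrite G. replace (/ (1 - w) * (1 - 1))%C with (RtoC 0) by ring. reflexivity.
Qed.

(** Serves both the coefficients c_u of weight k and the Clausen function of order k - 1, whose
    parity convention is the opposite one. *)
Definition trig (k : nat) (t : R) : R := if Nat.even k then cos t else sin t.

(** The sign in - b lets one formula hold for both parities; it is also the sign of the pairing of
    (0, b) with v. *)
Lemma trig_product k a b : trig k a * trig k (- b) = / 2 * (cos (a + b) + (-1) ^ k * cos (a - b)).
Proof.
  unfold trig. destruct (Nat.even k) eqn:E.
  - apply Nat.even_spec in E. destruct E as [m ->]. rewrite pow_1_even, cos_neg, cos_plus, cos_minus. field.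
  - assert (O : Nat.odd k = true) by (rewrite <- Nat.negb_even, E; auto).
    apply Nat.odd_spec in O. destruct O as [m ->]. rewrite Nat.add_1_r, pow_1_odd, sin_neg, cos_plus, cos_minus. field.
Qed.

Lemma usum_Im {T} (F : T -> C) S : usum F S -> usum (fun t => RtoC (Im (F t))) (RtoC (Im S)).
Proof.
  intros H. apply (usum_scal _ _ (- Ci)%C) in H. apply usum_Re in H.
  replace (Im S) with (Re (- Ci * S)%C) by (simpl; unfold Im; ring).
  eapply usum_ext; [|apply H]. intros t. cbv beta. f_equal. simpl. unfold Im. ring.
Qed.

Lemma Clausen_usum n x : (1 <= n)%nat ->
  usum (fun d => RtoC (trig (n + 2) (INR (S d) * x) * / INR (S d) ^ S n)) (RtoC (Clausen (S n) x)).
Proof.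
  intros Hn.
  set (F := fun d => (cexp (Ci * RtoC x) ^ S d / RtoC (INR (S d) ^ S n))%C).
  assert (Ez : forall d, (cexp (Ci * RtoC x) ^ S d)%C = (cos (INR (S d) * x), sin (INR (S d) * x))).
  { intros d. rewrite <- cexp_INR. set (q := INR (S d)). unfold cexp. simpl.
    replace (q * (0 * x - 1 * 0) - 0 * (0 * 0 + 1 * x)) with 0 by ring.
    replace (q * (0 * 0 + 1 * x) + 0 * (0 * x - 1 * 0)) with (q * x) by ring.
    rewrite exp_0, !Rmult_1_l. reflexivity. }
  assert (Hq : forall d, 0 < INR (S d)) by (intros; apply lt_0_INR; lia).
  assert (EF : forall d, F d = (cos (INR (S d) * x) * / INR (S d) ^ S n, sin (INR (S d) * x) * / INR (S d) ^ S n)).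
  { intros d. unfold F, Cdiv. rewrite Ez, <- RtoC_inv by (apply pow_nonzero; specialize (Hq d); lra).
    set (q := / INR (S d) ^ S n). apply C_eq; simpl; ring. }
  assert (HB : forall d, Cmod (F d) <= wN d).
  { intros d. unfold F, Cdiv. rewrite Cmod_mult, Cmod_pow, Cmod_cexp, Cmod_inv, Cmod_R.
    2:{ intros X; apply RtoC_inj in X. revert X. apply pow_nonzero. specialize (Hq d). lra. }
    replace (Re (Ci * RtoC x)%C) with 0 by (simpl; unfold Re; ring).
    rewrite exp_0, pow1, Rmult_1_l, Rabs_pos_eq by (apply pow_le; specialize (Hq d); lra).
    eapply Rle_trans; [|apply wN_ge]. apply Rinv_le_contravar. apply pow_lt; auto.
    apply Rle_pow. rewrite S_INR. assert (h := pos_INR d). lra. lia. }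
  destruct (usum_exists F wN HB rsummable_wN) as [S0 HS].
  assert (EP : polylog (S n) (cexp (Ci * RtoC x)) = S0).
  { apply C_iota_eq. intros y Hy. apply (is_series_C_unique F); auto. apply usum_is_series; auto.
    apply usum_is_series; auto. }
  unfold Clausen, trig. rewrite EP, Nat.odd_succ, Nat.even_add. simpl Nat.even at 3.
  destruct (Nat.even n); simpl Bool.eqb; cbv iota.
  - eapply usum_ext; [|apply (usum_Re _ _ HS)]. intros d. cbv beta. rewrite EF. reflexivity.
  - eapply usum_ext; [|apply (usum_Im _ _ HS)]. intros d. cbv beta. rewrite EF. reflexivity.
Qed.

(** The row m of the lattice sum [Rsum] tends at the cusp to - PI / N times this term. *)
Definition sgn_power_term (N n : nat) (c : Z) (m : Z) : R :=
  if (cong N m c && negb (Z.eqb m 0))%bool then (- / IZR m) ^ S n * sgR m else 0.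

Lemma sgn_power_term_bound N n c m : (1 <= n)%nat -> Rabs (sgn_power_term N n c m) <= 4 * wZ m.
Proof.
  intros Hn. assert (h := wZ_pos m). unfold sgn_power_term.
  destruct (cong N m c && negb (Z.eqb m 0))%bool eqn:E; [|rewrite Rabs_R0; lra].
  apply andb_prop in E. destruct E as [_ E]. apply Bool.negb_true_iff, Z.eqb_neq in E.
  assert (Hs : Rabs (sgR m) = 1).
  { destruct (sgR_cases m E) as [[-> _]|[-> _]]. apply Rabs_R1. rewrite Rabs_left; lra. }
  rewrite Rabs_mult, Hs, Rmult_1_r, <- RPow_abs, Rabs_Ropp, Rabs_inv.
  set (a := Rabs (IZR m)). assert (Ha : 1 <= a) by (unfold a; rewrite <- abs_IZR; apply IZR_le; lia).
  rewrite pow_inv. apply Rle_trans with (/ a ^ 2).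
  - apply Rinv_le_contravar. apply pow_lt; lra. apply Rle_pow; auto. lia.
  - apply Rle_trans with (4 * / (1 + a) ^ 2).
    + apply Rmult_le_reg_r with (a ^ 2 * (1 + a) ^ 2). apply Rmult_lt_0_compat; apply pow_lt; lra.
      replace (/ a ^ 2 * (a ^ 2 * (1 + a) ^ 2)) with ((1 + a) ^ 2) by (field; lra).
      replace (4 * / (1 + a) ^ 2 * (a ^ 2 * (1 + a) ^ 2)) with (4 * a ^ 2) by (field; lra). nra.
    + apply Rmult_le_compat_l. lra. apply wZ_ge.
Qed.

Lemma rsummable_4wZ : rsummable (fun m => 4 * wZ m).
Proof. apply rsummable_scal. lra. apply rsummable_wZ. Qed.

Definition sgn_power_sum (N n : nat) (c : Z) : R := Re (tsum (fun m => RtoC (sgn_power_term N n c m))).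

Lemma sigma_usum N n c : (1 <= n)%nat -> usum (fun m => RtoC (sgn_power_term N n c m)) (RtoC (sgn_power_sum N n c)).
Proof.
  intros Hn. assert (U : usum (fun m => RtoC (sgn_power_term N n c m)) (tsum (fun m => RtoC (sgn_power_term N n c m)))).
  { apply (tsum_spec _ (fun m => 4 * wZ m)). intros m. rewrite Cmod_R. apply sgn_power_term_bound; auto.
    apply rsummable_4wZ. }
  apply (usum_Re _ _) in U. exact U.
Qed.

Lemma cong_add0 N p c : (1 <= N)%nat -> cong N (p + c) 0 = cong N (- p) c /\ cong N (p - c) 0 = cong N p c.
Proof.
  intros HN. split; apply Bool.eq_true_iff_eq; rewrite !cong_spec by auto; split; intros [l Hl];
    (exists l; lia) || (exists (- l)%Z; lia).
Qed.

(** For each positive p the finite sum over b selects p congruent to -c or to c, and these yield the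
    terms of index -p and p on the right. The factor N is the orthogonality relation and 1/2 the
    product formula. *)
Lemma Clausen_fourier N n c : (1 <= N)%nat -> (1 <= n)%nat ->
  sum_n (fun b => Clausen (S n) (2 * PI * INR b / INR N) * trig (n + 2) (- (2 * PI * (INR b * IZR c) / INR N))) (N - 1)
  = - (INR N / 2) * sgn_power_sum N n c.
Proof.
  intros HN Hn. assert (h : 0 < INR N) by (apply lt_0_INR; lia).
  set (th := fun b : nat => 2 * PI * INR b / INR N).
  set (tg := fun b : nat => trig (n + 2) (- (2 * PI * (INR b * IZR c) / INR N))).
  assert (U : usum (fun d => sum_n (fun b => RtoC (tg b) * RtoC (trig (n + 2) (INR (S d) * th b) * / INR (S d) ^ S n))%C (N - 1))
     (sum_n (fun b => RtoC (tg b) * RtoC (Clausen (S n) (th b)))%C (N - 1))).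
  { apply usum_sum_n. intros b _. apply usum_scal, Clausen_usum; auto. }
  assert (Ed : forall d, sum_n (fun b => RtoC (tg b) * RtoC (trig (n + 2) (INR (S d) * th b) * / INR (S d) ^ S n))%C (N - 1)
     = (RtoC (- (INR N / 2)) * (RtoC (sgn_power_term N n c (Z.of_nat (S d))) + RtoC (sgn_power_term N n c (- Z.of_nat (S d)))))%C).
  { intros d. rewrite <- RtoC_plus, <- RtoC_mult.
    rewrite (sum_n_ext _ (fun b => RtoC (tg b * (trig (n + 2) (INR (S d) * th b) * / INR (S d) ^ S n)))).
    2:{ intros b. symmetry. apply RtoC_mult. }
    rewrite <- RtoC_sum_n. f_equal.
    set (p := Z.of_nat (S d)). assert (Ep : INR (S d) = IZR p) by apply INR_IZR_INZ.
    assert (Hp' : (0 < p)%Z) by (unfold p; lia).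
    assert (Hp : 0 < IZR p) by (apply IZR_lt; auto). clearbody p.
    set (q := / INR (S d) ^ S n).
    rewrite (sum_n_ext _ (fun b => q / 2 * (cos (2 * PI * (IZR (p + c) / INR N * INR b)) + (-1) ^ (n + 2) * cos (2 * PI * (IZR (p - c) / INR N * INR b))))).
    2:{ intros b. unfold tg. assert (T := trig_product (n + 2) (INR (S d) * th b) (2 * PI * (INR b * IZR c) / INR N)).
        replace (INR (S d) * th b + 2 * PI * (INR b * IZR c) / INR N) with (2 * PI * (IZR (p + c) / INR N * INR b)) in T
          by (rewrite plus_IZR, <- Ep; unfold th; field; lra).
        replace (INR (S d) * th b - 2 * PI * (INR b * IZR c) / INR N) with (2 * PI * (IZR (p - c) / INR N * INR b)) in T
          by (rewrite minus_IZR, <- Ep; unfold th; field; lra).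
        match goal with |- ?a = ?b => change (@eq R a b) end.
        rewrite <- Rmult_assoc, (Rmult_comm (trig _ _)), T. unfold Rdiv. ring. }
    rewrite (sum_n_mult_l (K := R_Ring)). unfold mult; simpl.
    rewrite (sum_n_plus (G := R_AbelianGroup)). unfold plus; simpl.
    rewrite (sum_n_mult_l (K := R_Ring)). unfold mult; simpl.
    rewrite !cos_orthogonality by auto.
    destruct (cong_add0 N p c HN) as [-> ->].
    unfold sgn_power_term.
    assert (B1 : (p =? 0)%Z = false) by (apply Z.eqb_neq; lia).
    assert (B2 : (- p =? 0)%Z = false) by (apply Z.eqb_neq; lia).
    rewrite B1, B2. simpl negb. rewrite !Bool.andb_true_r.
    assert (S1 : sgR p = 1). { destruct (sgR_cases p ltac:(lia)) as [[-> _]|[_ X]]; auto; lia. }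
    assert (S2 : sgR (- p) = -1). { destruct (sgR_cases (- p) ltac:(lia)) as [[_ X]|[-> _]]; auto; lia. }
    rewrite S1, S2, opp_IZR, Rinv_opp, Ropp_involutive.
    assert (Eq : q = (/ IZR p) ^ S n) by (unfold q; rewrite Ep, pow_inv; reflexivity).
    replace ((- / IZR p) ^ S n) with ((-1) ^ S n * q) by (rewrite Eq, <- Rpow_mult_distr; f_equal; ring).
    rewrite <- Eq. replace (n + 2)%nat with (S (S n)) by lia.
    change ((-1) ^ S (S n)) with (-1 * (-1) ^ S n). set (e := (-1) ^ S n).
    destruct (cong N (- p) c), (cong N p c); field. }
  assert (SP : rsummable (fun d => 4 * wZ (Z.of_nat (S d)))).
  { apply (rsummable_inj (fun d => Z.of_nat (S d)) (fun m => 4 * wZ m)). intros; lia. apply rsummable_4wZ. }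
  assert (SM : rsummable (fun d => 4 * wZ (- Z.of_nat (S d)))).
  { apply (rsummable_inj (fun d => (- Z.of_nat (S d))%Z) (fun m => 4 * wZ m)). intros; lia. apply rsummable_4wZ. }
  assert (SB : forall m, Cmod (RtoC (sgn_power_term N n c m)) <= 4 * wZ m).
  { intros m. rewrite Cmod_R. apply sgn_power_term_bound; auto. }
  destruct (usum_exists (fun d => RtoC (sgn_power_term N n c (Z.of_nat (S d)))) (fun d => 4 * wZ (Z.of_nat (S d)))
     (fun d => SB _) SP) as [A HA].
  destruct (usum_exists (fun d => RtoC (sgn_power_term N n c (- Z.of_nat (S d)))) (fun d => 4 * wZ (- Z.of_nat (S d)))
     (fun d => SB _) SM) as [B HB].
  assert (AB : RtoC (sgn_power_sum N n c) = (A + B)%C).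
  { apply (usum_unique (fun m => RtoC (sgn_power_term N n c m))). apply sigma_usum; auto.
    apply usum_Z_signs; auto. unfold sgn_power_term. rewrite Bool.andb_false_r. reflexivity. }
  apply RtoC_inj. rewrite RtoC_sum_n, RtoC_mult, AB.
  rewrite (sum_n_ext _ (fun b => RtoC (tg b) * RtoC (Clausen (S n) (th b)))%C).
  2:{ intros b. ceq. rewrite <- RtoC_mult. f_equal. unfold tg, th. ring. }
  apply (usum_unique _ _ _ U).
  eapply usum_ext; [|apply usum_scal, (usum_plus _ _ _ _ HA HB)].
  intros d. cbv beta. rewrite Ed. reflexivity.
Qed.

Lemma sum_n_first (f : nat -> R) n : (forall i, (0 < i)%nat -> f i = 0) -> sum_n f n = f 0%nat.
Proof.
  intros H. induction n. apply sum_O. rewrite sum_Sn, IHn, (H (S n)) by lia. unfold plus; simpl. ring.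
Qed.

(** The Kronecker symbol in [A_xi] leaves a = 0, where the pairing depends on the first coordinate
    of v only. *)
Lemma A_G_eq N n v : (1 <= N)%nat -> (1 <= n)%nat ->
  A_G N (n + 2) v = 2 * PI ^ 2 / (INR N * INR (S n)) * sgn_power_sum N n (fst v).
Proof.
  intros HN Hn. assert (h : 0 < INR N) by (apply lt_0_INR; lia). assert (hp := PI_RGT_0).
  unfold A_G. rewrite sum_n_first.
  2:{ intros i Hi. rewrite (sum_n_ext _ (fun _ => 0)).
      - rewrite sum_n_const. ring.
      - intros b. unfold A_xi. replace (Nat.eqb i 0) with false by (symmetry; apply Nat.eqb_neq; lia).
        match goal with |- ?a = ?b => change (@eq R a b) end. ring. }
  set (s := (-1) ^ (n + 2 - 1 + Nat.div2 (n + 2 + 1)) * (INR (fact n) / (2 * PI) ^ n)).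
  rewrite (sum_n_ext _ (fun b => s * (Clausen (S n) (2 * PI * INR b / INR N) * trig (n + 2) (- (2 * PI * (INR b * IZR (fst v)) / INR N))))).
  2:{ intros b. unfold A_xi. rewrite Nat.eqb_refl. replace (n + 2 - 1)%nat with (S n) by lia.
      replace (n + 2 - 2)%nat with n by lia. unfold s. replace (n + 2 - 1)%nat with (S n) by lia.
      match goal with |- ?a = ?b => change (@eq R a b) end. unfold trig.
      replace (2 * PI * IZR (pairing (Z.of_nat 0, Z.of_nat b) v) / INR N) with (- (2 * PI * (INR b * IZR (fst v)) / INR N)).
      2:{ unfold pairing. simpl fst; simpl snd. rewrite minus_IZR, !mult_IZR, <- INR_IZR_INZ. field. lra. }
      ring. }
  rewrite (sum_n_mult_l (K := R_Ring)).
  match goal with |- context [mult ?a ?b] => change (mult a b) with (Rmult a b) end.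
  rewrite Clausen_fourier by auto. unfold s.
  replace (n + 2 - 1)%nat with (S n) by lia.
  rewrite fact_simpl, mult_INR.
  assert (hf : 0 < INR (fact n)) by apply INR_fact_lt_0.
  assert (hs : 0 < INR (S n)) by (apply lt_0_INR; lia).
  (* Floor and ceiling of k/2 add up to k, so the total exponent is 2 k - 1; the resulting -1
     cancels the sign in [Clausen_fourier]. *)
  assert (SGN : (-1) ^ Nat.div2 (n + 2) * (-1) ^ (S n + Nat.div2 (n + 2 + 1)) = -1).
  { rewrite <- pow_add.
    assert (DD : (Nat.div2 (n + 2) + Nat.div2 (n + 2 + 1) = n + 2)%nat).
    { rewrite !Nat.div2_div.
      assert (E1 := Nat.div_mod (n + 2) 2 ltac:(lia)). assert (E2 := Nat.div_mod (n + 2 + 1) 2 ltac:(lia)).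
      assert (B1 := Nat.mod_upper_bound (n + 2) 2 ltac:(lia)). assert (B2 := Nat.mod_upper_bound (n + 2 + 1) 2 ltac:(lia)). lia. }
    replace (Nat.div2 (n + 2) + (S n + Nat.div2 (n + 2 + 1)))%nat with (S (2 * (n + 1)))%nat by lia.
    apply pow_1_odd. }
  set (e1 := (-1) ^ Nat.div2 (n + 2)) in *. set (e2 := (-1) ^ (S n + Nat.div2 (n + 2 + 1))) in *.
  assert (hP : 0 < (2 * PI) ^ n) by (apply pow_lt; lra).
  replace ((2 * PI) ^ (n + 2)) with ((2 * PI) ^ n * (2 * PI) ^ 2) by (rewrite <- pow_add; reflexivity).
  set (F := INR (fact n)) in *. set (q := INR (S n)) in *. set (P := (2 * PI) ^ n) in *.
  transitivity (- (e1 * e2) * (2 * PI ^ 2 / (INR N * q)) * sgn_power_sum N n (fst v)).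
  - unfold Rdiv. simpl. field. repeat split; lra.
  - rewrite SGN. ring.
Qed.

(** * The behaviour at the cusp *)

Lemma Im_inv z : Im (/ z)%C = - (Im z / (Re z ^ 2 + Im z ^ 2)).
Proof. simpl. unfold Im, Re, Rdiv. simpl. ring. Qed.

(** Over a row the real parts of 1 / l are not absolutely summable, but the imaginary parts form a
    Poisson kernel of parameter Y = |m| Im z / N. The height N ensures Y >= 1, and |m| >= 1 makes
    the error uniform in m. *)
Lemma row_poisson N d m z : (1 <= N)%nat -> m <> 0%Z -> INR N <= Im z ->
  exists e, usum (fun k => if cong N k d then RtoC (Im (/ lin (m, k) z)%C) else RtoC 0) (RtoC e)
    /\ Rabs (e + sgR m * (PI / INR N)) <= 2 * PI / Im z.
Proof.
  intros HN Hm Hz. assert (h : 0 < INR N) by (apply lt_0_INR; lia). assert (hp := PI_RGT_0).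
  assert (Hm1 : 1 <= IZR (Z.abs m)) by (apply IZR_le; lia).
  set (Y := IZR (Z.abs m) * Im z / INR N).
  assert (HY : 1 <= Y).
  { unfold Y. apply Rle_div_r; auto. nra. }
  set (w := wpt N d m z).
  assert (HI : Im w = sgR m * Y).
  { assert (E : sgR m * IZR (Z.abs m) = IZR m).
    { unfold sgR. rewrite <- mult_IZR. f_equal. destruct m; simpl; lia. }
    unfold w. rewrite Im_wpt, <- E by auto. unfold Y. field. lra. }
  destruct (pois_usum (Re w) Y HY) as [S [HS HB]].
  exists (- (sgR m / INR N) * S).
  assert (Hs : sgR m = 1 \/ sgR m = -1) by (destruct (sgR_cases m Hm) as [[-> _]|[-> _]]; auto).
  split.
  - apply (usum_progression N d (fun k => RtoC (Im (/ lin (m, k) z)%C))); auto.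
    rewrite RtoC_mult. eapply usum_ext; [|apply usum_scal, HS].
    intros l. cbv beta. rewrite <- RtoC_mult. f_equal.
    unfold lin. simpl fst; simpl snd. rewrite wpt_progression by auto. fold w.
    rewrite Im_inv.
    replace (Im (RtoC (INR N) * (w + RtoC (IZR l)))%C) with (INR N * (sgR m * Y)) by (rewrite <- HI; simpl; unfold Im; ring).
    replace (Re (RtoC (INR N) * (w + RtoC (IZR l)))%C) with (INR N * (Re w + IZR l)) by (simpl; unfold Re; ring).
    unfold pois.
    assert (0 < (Re w + IZR l) ^ 2 + Y ^ 2).
    { assert (h1 := pow2_ge_0 (Re w + IZR l)). assert (0 < Y ^ 2) by (apply pow_lt; lra). lra. }
    assert (E : (INR N * (Re w + IZR l)) ^ 2 + (INR N * (sgR m * Y)) ^ 2 = INR N ^ 2 * ((Re w + IZR l) ^ 2 + Y ^ 2)).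
    { destruct Hs as [-> | ->]; ring. }
    rewrite E. field. lra.
  - replace (- (sgR m / INR N) * S + sgR m * (PI / INR N)) with (- (sgR m / INR N) * (S - PI)) by (field; lra).
    rewrite Rabs_mult, Rabs_Ropp. unfold Rdiv at 1. rewrite Rabs_mult.
    assert (Hs1 : Rabs (sgR m) = 1). { destruct Hs as [-> | ->]. apply Rabs_R1. rewrite Rabs_left; lra. }
    rewrite Hs1, Rmult_1_l, (Rabs_pos_eq (/ INR N)) by (left; apply Rinv_0_lt_compat; auto).
    apply Rle_trans with (/ INR N * (2 * PI / Y)).
    apply Rmult_le_compat_l; auto. left; apply Rinv_0_lt_compat; auto.
    unfold Y. replace (/ INR N * (2 * PI / (IZR (Z.abs m) * Im z / INR N))) with (2 * PI / (IZR (Z.abs m) * Im z)) by (field; lra).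
    unfold Rdiv. apply Rmult_le_compat_l. lra. apply Rinv_le_contravar; nra.
Qed.

(** With W = |m| Im z the prefactor grows at most like W^j and the row sum decays like e^(-2 pi W /
    N). As m enters through W >= Im z only, the bound is uniform in m. *)
Lemma row_power N j d x tau : (1 <= N)%nat -> (1 <= j)%nat -> exists C0, 0 <= C0 /\
  forall m T, m <> 0%Z -> INR N <= Im (vl tau T) -> exists e,
  usum (fun k => if cong N k d then
     RtoC (Im ((RtoC (IZR m) * (vl tau T - RtoC x)) ^ j * (/ lin (m, k) (vl tau T)) ^ S j)%C) else RtoC 0) (RtoC e)
  /\ Rabs e <= C0 / Im (vl tau T).
Proof.
  intros HN Hj. assert (h : 0 < INR N) by (apply lt_0_INR; lia). assert (hp := PI_RGT_0).
  assert (h1 : 1 <= INR N) by (apply (le_INR 1); auto).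
  destruct (Sterm_decay (S j) ltac:(lia)) as [B [HB HD]].
  assert (Hc : 0 < 2 * PI / INR N) by (apply Rdiv_lt_0_compat; lra).
  destruct (pow_exp_bound (S j) _ Hc) as [B2 [HB2 HD2]].
  (* On the vertical line |z - x| <= |Re tau - x| + y <= D y, because y >= 1. *)
  set (D := Rabs (Re tau - x) + 1). assert (HDp : 1 <= D) by (unfold D; assert (q := Rabs_pos (Re tau - x)); lra).
  assert (HDj : 0 < D ^ j) by (apply pow_lt; lra).
  exists (D ^ j * B * B2). split. { left. repeat apply Rmult_lt_0_compat; auto. }
  intros m T Hm HT. set (z := vl tau T) in *. set (y := Im z) in *. assert (Hy : 0 < y) by lra.
  set (P := ((RtoC (IZR m) * (z - RtoC x)) ^ j)%C).
  assert (U := usum_row N d m z (S j) HN ltac:(lia) Hm Hy).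
  set (V := tsum (Sterm (S j) (wpt N d m z))) in *.
  exists (Im (P * (/ RtoC (INR N) ^ S j * V))%C). split.
  - eapply usum_ext; [|apply (usum_Im _ _ (usum_scal _ _ P U))].
    intros k. cbv beta. destruct (cong N k d).
    + f_equal. f_equal. f_equal. rewrite Cpow_inv. reflexivity.
      apply lin_nz; auto. congruence.
    + rewrite Cmult_0_r. reflexivity.
  - eapply Rle_trans. apply Im_le_Cmod. rewrite !Cmod_mult.
    destruct (row_expansion N d m z (S j) HN ltac:(lia) Hm Hy) as [w [[Hw1 Hw2] [E1 _]]].
    fold V in E1. fold y in Hw2.
    assert (Hm1 : 1 <= IZR (Z.abs m)) by (apply IZR_le; lia).
    set (a := IZR (Z.abs m)) in *. set (W := a * y). assert (HW : y <= W) by (unfold W; nra).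
    assert (EW : Im w = W / INR N) by (rewrite Hw2; reflexivity).
    assert (Hw : 1 <= Im w) by (rewrite EW; apply Rle_div_r; lra).
    assert (HV : Cmod V <= B * exp (- (2 * PI / INR N * W))).
    { rewrite E1, Cmod_mult, Cmod_pow, Cmod_R.
      assert (Hs1 : Rabs (sgR m) = 1). { destruct (sgR_cases m Hm) as [[-> _]|[-> _]]. apply Rabs_R1. rewrite Rabs_left; lra. }
      rewrite Hs1, pow1, Rmult_1_l. eapply Rle_trans. apply HD; auto.
      right. f_equal. f_equal. rewrite EW. field. lra. }
    assert (HP : Cmod P <= (D * W) ^ j).
    { unfold P. rewrite Cmod_pow, Cmod_mult, Cmod_R, <- abs_IZR. fold a. apply pow_incr. split.
      apply Rmult_le_pos. lra. apply Cmod_ge_0.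
      unfold W. replace (D * (a * y)) with (a * (D * y)) by ring. apply Rmult_le_compat_l. lra.
      eapply Rle_trans. apply Cmod_le_abs. rewrite Re_minus, Im_minus.
      unfold z at 1. rewrite Re_vl. simpl (Re (RtoC x)). simpl (Im (RtoC x)). fold y.
      rewrite Rminus_0_r, (Rabs_pos_eq y) by lra. unfold D.
      assert (q := Rabs_pos (Re tau - x)). nra. }
    assert (HNi : Cmod (/ RtoC (INR N) ^ S j)%C <= 1).
    { assert (NZ := INR_nz N HN). rewrite Cmod_inv, Cmod_pow, Cmod_R, Rabs_pos_eq by (try apply Cpow_nz; auto; lra).
      rewrite <- Rinv_1. apply Rinv_le_contravar. lra. apply pow_R1_Rle. lra. }
    specialize (HD2 W ltac:(lra)).
    assert (he := exp_pos (- (2 * PI / INR N * W))).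
    apply Rle_trans with ((D * W) ^ j * (1 * (B * exp (- (2 * PI / INR N * W))))).
    + apply Rmult_le_compat; auto using Cmod_ge_0. apply Rmult_le_pos; apply Cmod_ge_0.
      apply Rmult_le_compat; auto using Cmod_ge_0.
    + rewrite Rmult_1_l, Rpow_mult_distr.
      apply Rmult_le_reg_r with W. lra.
      replace (D ^ j * W ^ j * (B * exp (- (2 * PI / INR N * W))) * W) with (D ^ j * B * (W ^ S j * exp (- (2 * PI / INR N * W)))) by (simpl; ring).
      apply Rle_trans with (D ^ j * B * B2).
      * apply Rmult_le_compat_l; auto. apply Rmult_le_pos; lra.
      * assert (0 < D ^ j * B * B2) by (repeat apply Rmult_lt_0_compat; auto).
        replace (D ^ j * B * B2) with (D ^ j * B * B2 / y * y) at 1 by (field; lra).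
        apply Rmult_le_compat_l; auto. left; apply Rdiv_lt_0_compat; auto.
Qed.

Lemma row_estimate N n d x tau : (1 <= N)%nat -> exists C0, 0 <= C0 /\
  forall m T, m <> 0%Z -> INR N <= Im (vl tau T) -> exists e,
  usum (fun k => if cong N k d then
     RtoC (Im (geo (/ lin (m, k) (vl tau T)) (RtoC (IZR m * x + IZR k)) n)) else RtoC 0) (RtoC e)
  /\ Rabs (e + sgR m * (PI / INR N)) <= C0 / Im (vl tau T).
Proof.
  intros HN. assert (h : 0 < INR N) by (apply lt_0_INR; lia). assert (hp := PI_RGT_0).
  induction n as [|n [C1 [HC1 IH]]].
  - exists (2 * PI). split. lra. intros m T Hm HT.
    destruct (row_poisson N d m (vl tau T) HN Hm HT) as [e [U B]]. exists e. split; auto.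
    eapply usum_ext; [|apply U]. intros k. cbv beta. destruct (cong N k d); auto.
    unfold geo. rewrite sum_O. simpl Cpow. rewrite Cmult_1_l. reflexivity.
  - destruct (row_power N (S n) d x tau HN ltac:(lia)) as [C2 [HC2 HP]].
    exists (C1 + C2). split. lra. intros m T Hm HT.
    destruct (IH m T Hm HT) as [e1 [U1 B1]]. destruct (HP m T Hm HT) as [e2 [U2 B2]].
    exists (e1 + e2). split.
    + rewrite RtoC_plus. eapply usum_ext; [|apply (usum_plus _ _ _ _ U1 U2)].
      intros k. cbv beta. destruct (cong N k d); [|ring].
      rewrite geo_S, Im_plus, (RtoC_plus (Im _)). f_equal. f_equal. f_equal.
      set (z := vl tau T) in *. assert (Hl : lin (m, k) z <> RtoC 0) by (apply lin_nz; [lra|congruence]).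
      replace (1 - RtoC (IZR m * x + IZR k) * / lin (m, k) z)%C with
        (RtoC (IZR m) * (z - RtoC x) * / lin (m, k) z)%C.
      * rewrite (Cpow_mult_l (RtoC (IZR m) * (z - RtoC x)) (/ lin (m, k) z)), (Cpow_S (/ lin (m, k) z) (S n)). ring.
      * rewrite RtoC_plus, RtoC_mult.
        replace (RtoC (IZR k)) with (lin (m, k) z - RtoC (IZR m) * z)%C by (unfold lin; simpl fst; simpl snd; ring).
        set (l := lin (m, k) z) in *. field. auto.
    + replace (e1 + e2 + sgR m * (PI / INR N)) with ((e1 + sgR m * (PI / INR N)) + e2) by ring.
      eapply Rle_trans. apply Rabs_triang. rewrite Rdiv_plus_distr. lra.
Qed.

Lemma G_const_real N k v : (3 <= k)%nat -> G_const N k v = RtoC (Re (G_const N k v)).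
Proof.
  intros Hk. assert (U := G_const_usum N k v Hk).
  apply (usum_unique _ _ _ U). eapply usum_ext; [|apply (usum_Re _ _ U)].
  intros n. cbv beta. destruct (in_class N v (0%Z, n)) eqn:E; auto.
  assert (Hn : n <> 0%Z) by (intros ->; apply (in_class_nz _ _ _ E); auto).
  assert (Hq : IZR n <> 0) by (apply IZR_nz; auto).
  rewrite <- RtoC_pow, <- RtoC_inv by (apply pow_nonzero; auto). reflexivity.
Qed.

(* The primitive of (x - z)^n vanishing at z = 0. *)
Definition Qpol (n : nat) (x : R) (z : C) : C :=
  ((RtoC x ^ S n - (RtoC x - z) ^ S n) / RtoC (INR (S n)))%C.

(** Each row m <> 0 is within C0 / Im z of its limit before the weight (-1/m)^(n+1), which
    [4 * wZ m] dominates; the total error is O(1 / Im z). *)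
Lemma Rsum_limit N n v x tau : (1 <= N)%nat -> (1 <= n)%nat -> forall eps : posreal,
  exists T0, forall T, T0 <= T ->
  Rabs (- (2 * PI / INR (S n)) * Rsum N n v x (vl tau T)
    - Re (RtoC (2 * PI) * Ci * (G_const N (n + 2) v * Qpol n x (vl tau T)))%C - A_G N (n + 2) v) < eps.
Proof.
  intros HN Hn eps. assert (h : 0 < INR N) by (apply lt_0_INR; lia). assert (hp := PI_RGT_0).
  assert (hn : 0 < INR (S n)) by (apply lt_0_INR; lia).
  destruct (row_estimate N n (snd v) x tau HN) as [C0 [HC0 HR]].
  destruct rsummable_4wZ as [W0 [W HW]].
  assert (HWp : 0 <= W) by (specialize (HW nil (NoDup_nil _)); unfold rsum in HW; simpl in HW; auto).
  set (al := Re (G_const N (n + 2) v)).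
  assert (EA : G_const N (n + 2) v = RtoC al) by (apply G_const_real; lia).
  set (A := 2 * PI / INR (S n) * (C0 * W)).
  assert (HA : 0 <= A).
  { unfold A. apply Rmult_le_pos. left; apply Rdiv_lt_0_compat; lra. apply Rmult_le_pos; auto. }
  exists (Rmax (INR N) (A / eps + 1) - Im tau). intros T HT.
  set (z := vl tau T).
  assert (Hy1 : INR N <= Im z). { unfold z. rewrite Im_vl. assert (q := Rmax_l (INR N) (A / eps + 1)). lra. }
  assert (Hy2 : A / eps + 1 <= Im z). { unfold z. rewrite Im_vl. assert (q := Rmax_r (INR N) (A / eps + 1)). lra. }
  assert (Hz : 0 < Im z) by lra.
  assert (EX : forall m, exists e, m <> 0%Z ->
    usum (fun k => if cong N k (snd v) then
     RtoC (Im (geo (/ lin (m, k) z) (RtoC (IZR m * x + IZR k)) n)) else RtoC 0) (RtoC e)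
    /\ Rabs (e + sgR m * (PI / INR N)) <= C0 / Im z).
  { intros m. destruct (Z.eq_dec m 0) as [->|Hm]. exists 0. intros X; congruence.
    destruct (HR m T Hm Hy1) as [e He]. exists e. auto. }
  apply choice in EX. destruct EX as [e He].
  set (P := ((RtoC x - z) ^ S n)%C).
  (* The row m = 0, which grows with Im z; it is the part that the regularising term [Qpol]
     removes. *)
  set (r0 := - (al * Im P)).
  set (r := fun m => if Z.eqb m 0 then RtoC r0 else if cong N m (fst v) then RtoC ((- / IZR m) ^ S n * e m) else RtoC 0).
  assert (UR : usum r (RtoC (Rsum N n v x z))).
  { destruct (Tcl_bound n x (Im z) (Cmod z) Hn Hz) as [B [HB HBd]].
    apply (usum_fubini (Tcl N n v x z) (fun u => B * wL u)).
    - intros u. apply HBd; lra.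
    - apply rsummable_scal. lra. apply rsummable_wL.
    - apply Rsum_usum; auto.
    - intros m. unfold r. destruct (Z.eqb_spec m 0) as [->|Hm].
      + assert (U := G_const_usum N (n + 2) v ltac:(lia)). rewrite EA in U.
        replace (RtoC r0) with (RtoC (- Im P) * RtoC al)%C by (rewrite <- RtoC_mult; f_equal; unfold r0; ring).
        eapply usum_ext; [|apply usum_scal, U]. intros k. cbv beta. unfold Tcl, Tr. simpl fst; simpl snd.
        destruct (in_class N v (0%Z, k)) eqn:E; [|ring].
        assert (Hk : k <> 0%Z) by (intros ->; apply (in_class_nz _ _ _ E); auto).
        assert (Hq : IZR k <> 0) by (apply IZR_nz; auto).
        rewrite <- RtoC_pow, <- RtoC_inv, <- RtoC_mult by (apply pow_nonzero; auto). f_equal.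
        fold P. simpl (Z.eqb 0 0). cbv iota. rewrite pow_inv. ring.
      + destruct (cong N m (fst v)) eqn:E.
        * destruct (He m Hm) as [U _]. rewrite RtoC_mult.
          eapply usum_ext; [|apply usum_scal, U]. intros k. cbv beta. unfold Tcl, Tr.
          rewrite in_class_row, E by auto. simpl fst; simpl snd. apply Z.eqb_neq in Hm. rewrite Hm.
          simpl andb. destruct (cong N k (snd v)); [|ring]. rewrite <- RtoC_mult. reflexivity.
        * eapply usum_ext; [|apply usum_zero]. intros k. unfold Tcl. rewrite in_class_row, E by auto. reflexivity. }
  assert (U0 : usum (fun m => if Z.eqb m 0 then RtoC r0 else RtoC 0) (RtoC r0)).
  { apply (usum_single (fun m => if Z.eqb m 0 then RtoC r0 else RtoC 0) 0%Z).
    intros m Hm. apply Z.eqb_neq in Hm. rewrite Hm. reflexivity. }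
  assert (US := usum_scal _ _ (RtoC (PI / INR N)) (sigma_usum N n (fst v) Hn)).
  assert (UT := usum_plus _ _ _ _ (usum_minus _ _ _ _ UR U0) US).
  assert (KB : Rabs (Rsum N n v x z - r0 + PI / INR N * sgn_power_sum N n (fst v)) <= C0 / Im z * W).
  { rewrite <- Cmod_R. rewrite RtoC_plus, RtoC_minus, RtoC_mult.
    apply (usum_norm _ (fun m => C0 / Im z * (4 * wZ m)) _ _ UT).
    - intros m. cbv beta. assert (Wm := wZ_pos m).
      assert (HCz : 0 <= C0 / Im z) by (unfold Rdiv; apply Rmult_le_pos; auto; left; apply Rinv_0_lt_compat; auto).
      unfold r, sgn_power_term.
      destruct (Z.eqb_spec m 0) as [->|Hm].
      + rewrite Bool.andb_false_r. replace (RtoC r0 - RtoC r0 + RtoC (PI / INR N) * RtoC 0)%C with (RtoC 0) by ring.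
        rewrite Cmod_0. apply Rmult_le_pos; lra.
      + assert (SBm := sgn_power_term_bound N n (fst v) m Hn). unfold sgn_power_term in SBm.
        assert (Hm2 := Hm). apply Z.eqb_neq in Hm2. rewrite Hm2 in SBm. simpl negb in *. rewrite Bool.andb_true_r in *.
        destruct (cong N m (fst v)).
        * rewrite <- RtoC_minus, <- RtoC_mult, <- RtoC_plus, Cmod_R.
          assert (Hs1 : Rabs (sgR m) = 1). { destruct (sgR_cases m Hm) as [[-> _]|[-> _]]. apply Rabs_R1. rewrite Rabs_left; lra. }
          replace ((- / IZR m) ^ S n * e m - 0 + PI / INR N * ((- / IZR m) ^ S n * sgR m)) with
            ((- / IZR m) ^ S n * (e m + sgR m * (PI / INR N))) by ring.
          rewrite Rabs_mult, Hs1, Rmult_1_r in SBm. rewrite Rabs_mult, Rmult_comm.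
          apply Rmult_le_compat; try apply Rabs_pos; auto. apply He; auto.
        * replace (0 - 0 + RtoC (PI / INR N) * RtoC 0)%C with (RtoC 0) by ring.
          rewrite Cmod_0. apply Rmult_le_pos; lra.
    - intros l Hl. rewrite rsum_scal. apply Rmult_le_compat_l; auto.
      unfold Rdiv; apply Rmult_le_pos; auto; left; apply Rinv_0_lt_compat; auto. }
  (* The summand x^(n+1) of [Qpol] is real, hence purely imaginary after the factor 2 pi i, and
     drops out. What remains is exactly the row m = 0. *)
  assert (EQ : Re (RtoC (2 * PI) * Ci * (G_const N (n + 2) v * Qpol n x z))%C = 2 * PI * al * Im P / INR (S n)).
  { rewrite EA. unfold Qpol, Cdiv. fold P. rewrite <- RtoC_inv, <- RtoC_pow by lra.
    set (p := x ^ S n). set (q := INR (S n)) in *.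
    replace (RtoC (2 * PI) * Ci * (RtoC al * ((RtoC p - P) * RtoC (/ q))))%C with
      (RtoC (2 * PI * al * / q) * (Ci * (RtoC p - P)))%C by (rewrite !RtoC_mult; ring).
    generalize P; intros P'. simpl. unfold Im, Rdiv. ring. }
  rewrite EQ, A_G_eq by auto. fold z.
  replace (- (2 * PI / INR (S n)) * Rsum N n v x z - 2 * PI * al * Im P / INR (S n) - 2 * PI ^ 2 / (INR N * INR (S n)) * sgn_power_sum N n (fst v))
    with (- (2 * PI / INR (S n)) * (Rsum N n v x z - r0 + PI / INR N * sgn_power_sum N n (fst v)))
    by (unfold r0; field; lra).
  rewrite Rabs_mult, Rabs_Ropp, (Rabs_pos_eq (2 * PI / INR (S n))) by (left; apply Rdiv_lt_0_compat; lra).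
  assert (he := cond_pos eps).
  apply Rle_lt_trans with (2 * PI / INR (S n) * (C0 / Im z * W)).
  { apply Rmult_le_compat_l; auto. left; apply Rdiv_lt_0_compat; lra. }
  replace (2 * PI / INR (S n) * (C0 / Im z * W)) with (A / Im z) by (unfold A; field; lra).
  apply Rlt_div_l; auto.
  assert (A / eps * eps = A) by (field; lra).
  assert (A < (A / eps + 1) * eps) by lra.
  apply Rlt_le_trans with ((A / eps + 1) * eps); auto.
  rewrite Rmult_comm. apply Rmult_le_compat_l; lra.
Qed.

(** * The identity at a real point *)

Lemma Csum_S (f : nat -> C) n : sum_n f (S n) = (sum_n f n + f (S n))%C.
Proof. rewrite sum_Sn. reflexivity. Qed.

Lemma Csum_0 (f : nat -> C) : sum_n f 0 = f 0%nat.
Proof. apply sum_O. Qed.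

Lemma Csum_ext (f g : nat -> C) n : (forall i, (i <= n)%nat -> f i = g i) -> sum_n f n = sum_n g n.
Proof. intros H. apply sum_n_ext_loc. auto. Qed.

Lemma Csum_shift (f : nat -> C) n : sum_n f (S n) = (f 0%nat + sum_n (fun i => f (S i)) n)%C.
Proof.
  induction n. rewrite Csum_S, !Csum_0. reflexivity.
  rewrite Csum_S, IHn, Csum_S. ceq. ring.
Qed.

Lemma Csum_plus (f g : nat -> C) n : sum_n (fun i => f i + g i)%C n = (sum_n f n + sum_n g n)%C.
Proof. induction n. rewrite !Csum_0. reflexivity. rewrite !Csum_S, IHn. ceq. ring. Qed.

Lemma C_n_0 n : Binomial.C n 0 = 1.
Proof. unfold Binomial.C. rewrite Nat.sub_0_r. simpl. field. apply INR_fact_neq_0. Qed.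

Lemma C_n_n n : Binomial.C n n = 1.
Proof. unfold Binomial.C. rewrite Nat.sub_diag. simpl. field. apply INR_fact_neq_0. Qed.

Lemma Cbinom (a b : C) n :
  sum_n (fun p => RtoC (Binomial.C n p) * a ^ (n - p) * b ^ p)%C n = ((a + b) ^ n)%C.
Proof.
  induction n as [|n IH].
  - rewrite Csum_0, C_n_0. ceq. simpl. ring.
  - destruct n as [|n].
    + rewrite Csum_S, Csum_0, C_n_0, C_n_n. ceq. simpl. ring.
    + set (m := S n) in *.
      set (g := fun p => (RtoC (Binomial.C m p) * a ^ (m - p) * b ^ p)%C) in *.
      assert (E1 : sum_n g m = (sum_n g n + g m)%C) by apply Csum_S.
      assert (E2 : sum_n g m = (g 0%nat + sum_n (fun i => g (S i)) n)%C) by apply Csum_shift.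
      transitivity (a * (g 0%nat + sum_n (fun i => g (S i)) n) + b * (sum_n g n + g m))%C.
      2:{ rewrite <- E1, <- E2, IH. ceq. simpl. ring. }
      rewrite Csum_shift.
      change (sum_n ?f m) with (sum_n f (S n)). rewrite Csum_S. fold m.
      rewrite (Csum_ext _ (fun i => (a * g (S i) + b * g i)%C) n).
      2:{ intros i Hi. rewrite <- pascal by (unfold m; lia). rewrite RtoC_plus. unfold g.
          replace (S m - S i)%nat with (S (m - S i)) by (unfold m; lia).
          replace (m - i)%nat with (S (m - S i)) by (unfold m; lia). simpl Cpow. ceq. ring. }
      assert (G0 : g 0%nat = (a ^ m)%C) by (unfold g; rewrite C_n_0, Nat.sub_0_r; simpl; ring).
      assert (Gm : g m = (b ^ m)%C) by (unfold g; rewrite C_n_n, Nat.sub_diag; simpl; ring).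
      rewrite G0, Gm, Csum_plus, <- !Csum_mult_l.
      rewrite !C_n_0, !C_n_n, !Nat.sub_diag, !Nat.sub_0_r.
      ceq. set (s1 := sum_n (fun i => g (S i)) n). change (sum_n (fun i => g i) n) with (sum_n g n).
      set (s2 := sum_n g n). rewrite (Cpow_S a), (Cpow_S b). simpl. ring.
Qed.

Lemma C_absorb n p : (p <= n)%nat -> Binomial.C n p * / INR (p + 1) = Binomial.C (S n) (S p) * / INR (S n).
Proof.
  intros Hp. unfold Binomial.C. rewrite Nat.add_1_r. simpl (S n - S p)%nat.
  rewrite !fact_simpl, !mult_INR.
  assert (h1 := INR_fact_neq_0 n). assert (h2 := INR_fact_neq_0 p). assert (h3 := INR_fact_neq_0 (n - p)).
  assert (h4 : INR (S n) <> 0) by (apply not_0_INR; lia).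
  assert (h5 : INR (S p) <> 0) by (apply not_0_INR; lia).
  field. auto.
Qed.

Definition kap (n : nat) (x : R) (p : nat) : C := (RtoC ((-1) ^ p * Binomial.C n p) * RtoC x ^ (n - p))%C.

Lemma kap_sum n x z : sum_n (fun p => kap n x p * z ^ p)%C n = ((RtoC x - z) ^ n)%C.
Proof.
  unfold Cminus. rewrite <- Cbinom. apply Csum_ext. intros p Hp. unfold kap.
  rewrite Cpow_opp, RtoC_mult, RtoC_pow. ceq. ring.
Qed.

(** Collects the boundary terms tau^(p+1) / (p+1) of the regularised integrals. *)
Lemma kap_primitive n x z :
  sum_n (fun p => kap n x p * (z ^ (p + 1) / RtoC (INR (p + 1))))%C n = Qpol n x z.
Proof.
  assert (B := Cbinom (RtoC x) (- z)%C (S n)). rewrite Csum_shift, C_n_0, Nat.sub_0_r in B.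
  assert (hn : INR (S n) <> 0) by (apply not_0_INR; lia).
  unfold Qpol, Cminus. rewrite <- B. unfold Cdiv. rewrite <- RtoC_inv by auto.
  transitivity (RtoC (- / INR (S n)) * sum_n (fun i => RtoC (Binomial.C (S n) (S i)) * RtoC x ^ (S n - S i) * (- z) ^ S i) n)%C.
  - rewrite Csum_mult_l. apply Csum_ext. intros p Hp. unfold kap.
    assert (hp : INR (p + 1) <> 0) by (apply not_0_INR; lia).
    rewrite <- RtoC_inv by auto. rewrite Cpow_opp, <- (RtoC_pow (-1)).
    replace (RtoC ((-1) ^ p * Binomial.C n p) * RtoC x ^ (n - p) * (z ^ (p + 1) * RtoC (/ INR (p + 1))))%C with
      (RtoC ((-1) ^ p) * RtoC (Binomial.C n p * / INR (p + 1)) * RtoC x ^ (n - p) * z ^ (p + 1))%C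
      by (rewrite !RtoC_mult; ring).
    rewrite C_absorb by auto. rewrite !RtoC_mult, RtoC_opp, Nat.add_1_r. simpl (S n - S p)%nat.
    change ((-1) ^ S p) with (-1 * (-1) ^ p). rewrite RtoC_mult. ring.
  - rewrite RtoC_opp. change ((- z) ^ 0)%C with (RtoC 1). ceq. ring.
Qed.

Lemma cder_sum_n (f : nat -> R -> C) (d : nat -> C) t n :
  (forall p, cder (f p) t (d p)) -> cder (fun s => sum_n (fun p => f p s) n) t (sum_n d n).
Proof.
  intros H. induction n.
  - rewrite Csum_0. eapply cder_ext; [|apply (H 0%nat)]. intros s. rewrite Csum_0. reflexivity.
  - rewrite Csum_S. eapply cder_ext; [|apply (cder_plus _ _ _ _ _ IHn (H (S n)))].
    intros s. rewrite Csum_S. reflexivity.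
Qed.

Lemma sum_n_limit (c : nat -> C) (J : nat -> R -> C) (L : nat -> C) n :
  (forall p (eps : posreal), exists T0, forall T, T0 <= T -> Cmod (J p T - L p)%C < eps) ->
  forall eps : posreal, exists T0, forall T, T0 <= T ->
   Cmod (sum_n (fun p => c p * J p T) n - sum_n (fun p => c p * L p) n)%C < eps.
Proof.
  intros H.
  assert (S1 : forall p (eps : posreal), exists T0, forall T, T0 <= T -> Cmod (c p * J p T - c p * L p)%C < eps).
  { intros p eps. assert (hc := Cmod_ge_0 (c p)).
    assert (Hp : 0 < eps / (Cmod (c p) + 1)) by (apply Rdiv_lt_0_compat; [apply cond_pos|lra]).
    destruct (H p (mkposreal _ Hp)) as [T0 HT]. exists T0. intros T HTT. specialize (HT T HTT). simpl in HT.
    replace (c p * J p T - c p * L p)%C with (c p * (J p T - L p))%C by ring. rewrite Cmod_mult.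
    assert (hq := Cmod_ge_0 (J p T - L p)%C).
    apply Rmult_lt_compat_r with (r := Cmod (c p) + 1) in HT; [|lra].
    replace (eps / (Cmod (c p) + 1) * (Cmod (c p) + 1)) with (pos eps) in HT by (field; lra). nra. }
  induction n; intros eps.
  - destruct (S1 0%nat eps) as [T0 HT]. exists T0. intros T HTT. rewrite !Csum_0. auto.
  - destruct (IHn (pos_div_2 eps)) as [T1 H1]. destruct (S1 (S n) (pos_div_2 eps)) as [T2 H2].
    exists (Rmax T1 T2). intros T HT. specialize (H1 T (Rle_trans _ _ _ (Rmax_l _ _) HT)).
    specialize (H2 T (Rle_trans _ _ _ (Rmax_r _ _) HT)). simpl in H1, H2. rewrite !Csum_S.
    match goal with |- Cmod (?a + ?b - (?c + ?d))%C < _ => replace (a + b - (c + d))%C with ((a - c) + (b - d))%C by ring end.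
    eapply Rle_lt_trans. apply Cmod_triangle. lra.
Qed.

Lemma cder_pow_ex f t d p : cder f t d -> exists d', cder (fun s => f s ^ p)%C t d'.
Proof.
  intros H. destruct p. exists (RtoC 0). apply (cder_const (RtoC 1)). eexists. apply cder_pow; eauto.
Qed.

Lemma cusp_integral N k v p tau : (1 <= N)%nat -> (3 <= k)%nat -> 0 < Im tau ->
  exists J : R -> C, exists L : C,
  J 0 = RtoC 0 /\
  (forall t, 0 <= t -> cder J t (Ci * ((G_hol N k v (vl tau t) - G_const N k v) * vl tau t ^ p))%C) /\
  (forall eps : posreal, exists T0, forall T, T0 <= T -> Cmod (J T - L)%C < eps) /\
  int_from_cusp N (G_hol N k v) p tau = (G_const N k v * (tau ^ (p + 1) / RtoC (INR (p + 1))) - L)%C.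
Proof.
  intros HN Hk Hz. assert (h : 0 < INR N) by (apply lt_0_INR; lia). assert (hp := PI_RGT_0).
  destruct (G_q_expansion N k v HN Hk) as [a [Ha Ea]].
  assert (EC := const_term_eq N _ a HN Ha). rewrite Ea in EC.
  destruct (q_expansion_decay N _ a HN Ha) as [B [HB HD]]. rewrite Ea in HD.
  (* Half of the decay rate 2 pi / N; the other half absorbs the growth of z^p. *)
  assert (Hc : 0 < PI / INR N) by (apply Rdiv_lt_0_compat; auto).
  destruct (pow_exp_bound p _ Hc) as [B2 [HB2 HP]].
  set (g := fun t => (Ci * ((G_hol N k v (vl tau t) - G_const N k v) * vl tau t ^ p))%C).
  set (D := Cmod tau + 1). assert (HDp : 1 <= D) by (unfold D; assert (q := Cmod_ge_0 tau); lra).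
  assert (HDj : 0 < D ^ p) by (apply pow_lt; lra).
  destruct (improper_integral g (Im tau) (B * D ^ p * B2) (PI / INR N) 1) as [J [L [J0 [J1 [J2 J3]]]]]; auto.
  - lra.
  - intros t Ht. destruct (G_line_cder N k v tau t Hk ltac:(lra)) as [d1 D1].
    destruct (cder_pow_ex _ t _ p (cder_vl tau t)) as [d2 D2].
    eexists. apply cder_scal. apply cder_mult. apply cder_minus. apply D1. apply cder_const. apply D2.
  - intros t Ht. unfold g. rewrite Cmod_mult, Cmod_Ci, Rmult_1_l, Cmod_mult, Cmod_pow.
    specialize (HD (vl tau t) ltac:(rewrite Im_vl; lra)). specialize (HP t ltac:(lra)).
    assert (X1 : Cmod (G_hol N k v (vl tau t) - G_const N k v)%C <= B * (exp (- (PI / INR N * t)) * exp (- (PI / INR N * t)))).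
    { eapply Rle_trans. apply HD. apply Rmult_le_compat_l. lra. rewrite <- exp_plus. apply exp_mono. rewrite Im_vl.
      replace (2 * PI * (Im tau + t) / INR N) with (2 * (PI / INR N) * (Im tau + t)) by (field; lra). nra. }
    assert (X2 : Cmod (vl tau t) ^ p <= D ^ p * t ^ p).
    { rewrite <- Rpow_mult_distr. apply pow_incr. split. apply Cmod_ge_0.
      eapply Rle_trans. apply Cmod_vl. rewrite Rabs_pos_eq by lra. unfold D. assert (q := Cmod_ge_0 tau). nra. }
    assert (he := exp_pos (- (PI / INR N * t))). set (E := exp (- (PI / INR N * t))) in *.
    apply Rle_trans with (B * (E * E) * (D ^ p * t ^ p)).
    + apply Rmult_le_compat; auto. apply Cmod_ge_0. apply pow_le, Cmod_ge_0.
    + replace (B * (E * E) * (D ^ p * t ^ p)) with (B * D ^ p * (t ^ p * E) * E) by ring.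
      apply Rmult_le_compat_r. lra. apply Rmult_le_compat_l; auto. left; apply Rmult_lt_0_compat; auto.
  - exists J, L. split; [|split; [|split]]; auto.
    unfold int_from_cusp, int_to_cusp, int_to_ioo. rewrite EC.
    change (fun t : R => (Ci * ((G_hol N k v (tau + Ci * RtoC t) - G_const N k v) * (tau + Ci * RtoC t) ^ p))%C) with g.
    rewrite J3. unfold Cdiv. ring.
Qed.

Lemma identity_at_real_point N n v x tau : (1 <= N)%nat -> (1 <= n)%nat -> 0 < Im tau ->
  A_G N (n + 2) v + Re (RtoC (2 * PI) * Ci * sum_n (fun p => kap n x p * int_from_cusp N (G_hol N (n + 2) v) p tau) n)%C
  = - (2 * PI / INR (S n)) * Rsum N n v x tau.
Proof.
  intros HN Hn Hz. assert (hp := PI_RGT_0). assert (hn : 0 < INR (S n)) by (apply lt_0_INR; lia).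
  set (k := (n + 2)%nat). set (f := G_hol N k v). set (a0 := G_const N k v).
  assert (CI : forall p, exists JL : (R -> C) * C,
    fst JL 0 = RtoC 0 /\
    (forall t, 0 <= t -> cder (fst JL) t (Ci * ((f (vl tau t) - a0) * vl tau t ^ p))%C) /\
    (forall eps : posreal, exists T0, forall T, T0 <= T -> Cmod (fst JL T - snd JL)%C < eps) /\
    int_from_cusp N f p tau = (a0 * (tau ^ (p + 1) / RtoC (INR (p + 1))) - snd JL)%C).
  { intros p. destruct (cusp_integral N k v p tau HN ltac:(unfold k; lia) Hz) as [J [L HJL]]. exists (J, L). auto. }
  apply choice in CI. destruct CI as [JL HJL].
  set (J := fun p => fst (JL p)). set (L := fun p => snd (JL p)).
  set (SJ := fun T => sum_n (fun p => kap n x p * J p T)%C n).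
  set (SL := sum_n (fun p => kap n x p * L p)%C n).
  assert (EI : sum_n (fun p => kap n x p * int_from_cusp N f p tau)%C n = (a0 * Qpol n x tau - SL)%C).
  { rewrite (Csum_ext _ (fun p => (a0 * (kap n x p * (tau ^ (p + 1) / RtoC (INR (p + 1)))) + RtoC (-1) * (kap n x p * L p))%C)).
    - rewrite Csum_plus, <- !Csum_mult_l, kap_primitive. unfold SL. ceq. ring.
    - intros p _. destruct (HJL p) as [_ [_ [_ ->]]]. unfold L. ring. }
  rewrite EI.
  set (c := (RtoC (2 * PI) * Ci)%C).
  (* The integral from tau upwards, the lattice sum and the regularising term. By 2 pi i times i =
     -2 pi, the derivatives of the first and the third add up to -2 pi Re ((x - z)^n G), and the
     second contributes the opposite. *)
  set (Phi := fun T => Re (c * SJ T)%C + (2 * PI / INR (S n)) * Rsum N n v x (vl tau T) + Re (c * (a0 * Qpol n x (vl tau T)))%C).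
  assert (DPhi : forall t, 0 <= t -> is_derive Phi t 0).
  { intros t Ht.
    assert (D1 : cder (fun T => c * SJ T)%C t (c * (Ci * ((f (vl tau t) - a0) * (RtoC x - vl tau t) ^ n)))%C).
    { apply cder_scal. eapply cder_eq; [|apply (cder_sum_n (fun p T => kap n x p * J p T)%C
         (fun p => kap n x p * (Ci * ((f (vl tau t) - a0) * vl tau t ^ p)))%C)].
      - rewrite (Csum_ext _ (fun p => (Ci * (f (vl tau t) - a0)) * (kap n x p * vl tau t ^ p))%C) by (intros; ring).
        rewrite <- Csum_mult_l, kap_sum. ring.
      - intros p. apply cder_scal. apply HJL. auto. }
    assert (D2 := Rsum_derive N n v x tau t Hn ltac:(lra)).
    apply (is_derive_scal _ _ (2 * PI / INR (S n))) in D2.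
    assert (D3 : cder (fun T => c * (a0 * Qpol n x (vl tau T)))%C t (c * (a0 * (Ci * (RtoC x - vl tau t) ^ n)))%C).
    { apply cder_scal, cder_scal. unfold Qpol, Cdiv.
      assert (NZ := INR_nz (S n) ltac:(lia)).
      assert (DP : cder (fun s => (RtoC x - vl tau s) ^ S n)%C t
        (RtoC (INR (S n)) * (RtoC x - vl tau t) ^ n * (0 - Ci))%C).
      { apply cder_pow, cder_minus. apply cder_const. apply cder_vl. }
      assert (DQ := cder_scal (/ RtoC (INR (S n)))%C _ _ _ (cder_minus _ _ _ _ _ (cder_const (RtoC x ^ S n)%C t) DP)).
      eapply cder_eq; [|eapply cder_ext; [|exact DQ]].
      - cbv beta. field. auto.
      - intros s. cbv beta. ring. }
    destruct D1 as [D1 _]. destruct D3 as [D3 _].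
    assert (D := is_derive_plus _ _ _ _ _ (is_derive_plus _ _ _ _ _ D1 D2) D3).
    match type of D with is_derive _ _ ?e => replace 0 with e end; [exact D|].
    unfold plus; simpl plus. fold k f. set (P := ((RtoC x - vl tau t) ^ n)%C). set (F := f (vl tau t)).
    replace (2 * PI / INR (S n) * (INR (S n) * Re (P * F)%C)) with (2 * PI * Re (P * F)%C) by (field; lra).
    unfold c. clearbody P F a0. clear. simpl. unfold Re. ring. }
  assert (CPhi : forall T, 0 <= T -> Phi T = Phi 0).
  { intros T HT. apply Rle_antisym.
    - apply Ropp_le_cancel. apply (is_derive_monotone (fun t => - Phi t) (fun _ => 0)); auto.
      intros t Ht. split; [|lra]. replace 0 with (opp 0) by (unfold opp; simpl; ring).
      apply (is_derive_opp Phi). apply DPhi; lra.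
    - apply (is_derive_monotone Phi (fun _ => 0)); auto. intros t Ht. split; [|lra]. apply DPhi; lra. }
  assert (E0 : Phi 0 = 2 * PI / INR (S n) * Rsum N n v x tau + Re (c * (a0 * Qpol n x tau))%C).
  { unfold Phi. replace (vl tau 0) with tau by (unfold vl; ring).
    replace (SJ 0) with (RtoC 0). rewrite Cmult_0_r. simpl (Re (RtoC 0)). ring.
    unfold SJ. rewrite (Csum_ext _ (fun _ => RtoC 0 * RtoC 0)%C).
    rewrite <- Csum_mult_l. ring. intros p _. unfold J. destruct (HJL p) as [-> _]. ring. }
  assert (Cc : 0 < Cmod c). { apply Cmod_gt_0. unfold c. apply Cmult_neq_0. intros X; apply RtoC_inj in X; lra. apply Ci_nz. }
  (* [Phi] is constant, so its value at 0 is its limit at the cusp, where [Rsum_limit] applies. *)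
  assert (LIM : Phi 0 = Re (c * SL)%C - A_G N k v).
  { apply Rminus_diag_uniq. apply NNPP. intros Hne.
    assert (Hp : 0 < Rabs (Phi 0 - (Re (c * SL)%C - A_G N k v))) by (apply Rabs_pos_lt; auto).
    set (G := Rabs (Phi 0 - (Re (c * SL)%C - A_G N k v))) in *.
    assert (Hp1 : 0 < G / 2) by lra. assert (Hp2 : 0 < G / 2 / Cmod c) by (apply Rdiv_lt_0_compat; auto).
    destruct (Rsum_limit N n v x tau HN Hn (mkposreal _ Hp1)) as [T1 H1].
    destruct (sum_n_limit (kap n x) J L n (fun p => proj1 (proj2 (proj2 (HJL p)))) (mkposreal _ Hp2)) as [T2 H2].
    set (T := Rmax 0 (Rmax T1 T2)).
    assert (X0 : 0 <= T) by apply Rmax_l.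
    assert (X1 : T1 <= T) by (eapply Rle_trans; [apply Rmax_l|apply Rmax_r]).
    assert (X2 : T2 <= T) by (eapply Rle_trans; [apply Rmax_r|apply Rmax_r]).
    specialize (H1 T X1). specialize (H2 T X2). simpl in H1, H2. fold k a0 c in H1.
    change (Cmod (SJ T - SL)%C < G / 2 / Cmod c) in H2.
    assert (K : Rabs (Re (c * (SJ T - SL))%C) < G / 2).
    { eapply Rle_lt_trans. apply Re_le_Cmod. rewrite Cmod_mult, Rmult_comm. apply Rlt_div_r; auto. }
    assert (G <= Rabs (Re (c * (SJ T - SL))%C) + Rabs (- (- (2 * PI / INR (S n)) * Rsum N n v x (vl tau T)
       - Re (c * (a0 * Qpol n x (vl tau T)))%C - A_G N k v))).
    { eapply Rle_trans; [|apply Rabs_triang]. right. unfold G. f_equal. rewrite <- (CPhi T X0). unfold Phi.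
      replace (c * (SJ T - SL))%C with (c * SJ T - c * SL)%C by ring. rewrite Re_minus. ring. }
    rewrite Rabs_Ropp in H.
    match type of H1 with Rabs ?a < _ => match type of H with _ <= _ + Rabs ?b => change b with a in H end end.
    lra. }
  rewrite E0 in LIM.
  replace (c * (a0 * Qpol n x tau - SL))%C with (c * (a0 * Qpol n x tau) - c * SL)%C by ring.
  rewrite Re_minus. lra.
Qed.

Ltac cring := ceq; ring.

(** * Homogeneous polynomials are determined by their values at Y = 1 *)

Definition homog (d : nat) (P : poly2) : Prop := forall i j, (i + j <> d)%nat -> P i j = RtoC 0.

(** P(x, 1) for P homogeneous of degree d. A formal series has no value in general; on the
    antidiagonal of degree d finitely many coefficients remain. *)
Definition ev (d : nat) (P : poly2) (x : R) : C := sum_n (fun i => P i (d - i)%nat * RtoC x ^ i)%C d.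

Lemma Csum_zero n : sum_n (fun _ => RtoC 0) n = RtoC 0.
Proof. induction n. apply Csum_0. rewrite Csum_S, IHn. cring. Qed.

Lemma Csum_zero_ext (f : nat -> C) n : (forall i, (i <= n)%nat -> f i = RtoC 0) -> sum_n f n = RtoC 0.
Proof. intros H. rewrite (Csum_ext _ (fun _ => RtoC 0)); auto. apply Csum_zero. Qed.

Lemma Csum_single (f : nat -> C) n b : (forall i, i <> b -> f i = RtoC 0) ->
  sum_n f n = if Nat.leb b n then f b else RtoC 0.
Proof.
  intros H. induction n.
  - rewrite Csum_0. destruct b; simpl; auto.
  - rewrite Csum_S, IHn. destruct (Nat.leb_spec b n), (Nat.leb_spec b (S n)); try lia.
    + rewrite (H (S n)) by lia. cring.
    + replace b with (S n) by lia. cring.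
    + rewrite (H (S n)) by lia. cring.
Qed.

Lemma poly_zero d : forall c : nat -> C,
  (forall x : R, sum_n (fun i => c i * RtoC x ^ i)%C d = RtoC 0) -> forall i, (i <= d)%nat -> c i = RtoC 0.
Proof.
  induction d; intros c H i Hi.
  - specialize (H 1). rewrite Csum_0 in H. replace i with 0%nat by lia.
    rewrite <- H. simpl. cring.
  - (* p(2x) - 2^(d+1) p(x) has degree at most d *)
    assert (K : forall i, (i <= d)%nat -> (c i * RtoC (2 ^ i - 2 ^ S d))%C = RtoC 0).
    { apply (IHd (fun i => c i * RtoC (2 ^ i - 2 ^ S d))%C). intros x.
      assert (H1 := H (2 * x)). assert (H2 := H x). rewrite Csum_S in H1, H2.
      assert (E : (sum_n (fun i => c i * RtoC (2 ^ i - 2 ^ S d) * RtoC x ^ i) d =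
        sum_n (fun i => c i * RtoC (2 * x) ^ i) d + RtoC (- 2 ^ S d) * sum_n (fun i => c i * RtoC x ^ i) d)%C).
      { rewrite Csum_mult_l, <- Csum_plus. apply Csum_ext. intros j _.
        rewrite RtoC_minus, RtoC_opp, RtoC_mult, Cpow_mult_l, <- !RtoC_pow. cring. }
      rewrite E.
      transitivity ((sum_n (fun i => c i * RtoC (2 * x) ^ i) d + c (S d) * RtoC (2 * x) ^ S d)
         + RtoC (- 2 ^ S d) * (sum_n (fun i => c i * RtoC x ^ i) d + c (S d) * RtoC x ^ S d))%C.
      - rewrite RtoC_opp, (RtoC_mult 2 x), Cpow_mult_l, <- (RtoC_pow 2 (S d)). cring.
      - rewrite H1, H2. cring. }
    assert (K' : forall i, (i <= d)%nat -> c i = RtoC 0).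
    { intros j Hj. specialize (K j Hj).
      assert (NZ : RtoC (2 ^ j - 2 ^ S d) <> RtoC 0).
      { intros X. apply RtoC_inj in X. assert (2 ^ j < 2 ^ S d) by (apply Rlt_pow; [lra|lia]). lra. }
      set (q := RtoC (2 ^ j - 2 ^ S d)) in *.
      replace (c j) with (/ q * (c j * q))%C by (field; auto). rewrite K. cring. }
    destruct (Nat.eq_dec i (S d)) as [->|]; [|apply K'; lia].
    specialize (H 1). rewrite Csum_S, Csum_zero_ext, Cpow_1_l in H.
    + rewrite <- H. cring.
    + intros j Hj. rewrite K' by auto. cring.
Qed.

Lemma homog_ext d P Q : homog d P -> homog d Q -> (forall x, ev d P x = ev d Q x) -> P = Q.
Proof.
  intros HP HQ H. apply functional_extensionality. intros i. apply functional_extensionality. intros j.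
  destruct (Nat.eq_dec (i + j) d) as [E|E].
  - assert (K := poly_zero d (fun i => P i (d - i)%nat - Q i (d - i)%nat)%C).
    assert (P i (d - i)%nat - Q i (d - i)%nat = RtoC 0)%C.
    { apply K; [|lia]. intros x. specialize (H x). unfold ev in H.
      rewrite (Csum_ext _ (fun i => P i (d - i)%nat * RtoC x ^ i + RtoC (-1) * (Q i (d - i)%nat * RtoC x ^ i))%C) by (intros; cring).
      rewrite Csum_plus, <- Csum_mult_l, H. cring. }
    apply Ceq_minus in H0. replace j with (d - i)%nat by lia. auto.
  - rewrite HP, HQ; auto.
Qed.

Lemma Csum_delay (g : nat -> C) c M : (c <= M)%nat ->
  sum_n (fun i => if Nat.leb c i then g (i - c)%nat else RtoC 0) M = sum_n g (M - c).
Proof.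
  intros H. induction M.
  - assert (c = 0)%nat by lia. subst. rewrite !Csum_0. reflexivity.
  - rewrite Csum_S. destruct (Nat.eq_dec c (S M)) as [->|].
    + rewrite Csum_zero_ext, Nat.leb_refl, Nat.sub_diag, Csum_0. cring.
      intros i Hi. destruct (Nat.leb_spec (S M) i); auto; lia.
    + rewrite IHM by lia. replace (S M - c)%nat with (S (M - c)) by lia.
      rewrite Csum_S. destruct (Nat.leb_spec c (S M)); [reflexivity|lia].
Qed.

Lemma cauchy_product (u w : nat -> C) e : (forall b, (e < b)%nat -> w b = RtoC 0) ->
  forall d M, (d + e <= M)%nat ->
  sum_n (fun i => sum_n (fun a => (if Nat.leb a d then u a else RtoC 0) * w (i - a)%nat)%C i) M
  = (sum_n u d * sum_n w e)%C.
Proof.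
  intros Hw.
  assert (TR : forall m, (e <= m)%nat -> sum_n w m = sum_n w e).
  { intros m Hm. induction m. replace e with 0%nat by lia. reflexivity.
    destruct (Nat.eq_dec e (S m)) as [<-|]; auto.
    rewrite Csum_S, IHm, Hw by lia. cring. }
  assert (ONE : forall c M, (c + e <= M)%nat ->
    sum_n (fun i => sum_n (fun a => (if Nat.eqb a c then u a else RtoC 0) * w (i - a)%nat)%C i) M = (u c * sum_n w e)%C).
  { intros c M HM. rewrite <- (TR (M - c)%nat) by lia. rewrite Csum_mult_l.
    rewrite <- (Csum_delay (fun i => u c * w i)%C c M) by lia.
    apply Csum_ext. intros i Hi. rewrite (Csum_single _ i c).
    - destruct (Nat.leb c i); auto. rewrite Nat.eqb_refl. reflexivity.
    - intros a Ha. apply Nat.eqb_neq in Ha. rewrite Ha. cring. }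
  induction d; intros M HM.
  - rewrite Csum_0, <- (ONE 0%nat M HM). apply Csum_ext. intros i Hi. apply Csum_ext. intros a Ha.
    destruct a; reflexivity.
  - rewrite Csum_S, Cmult_plus_distr_r, <- (ONE (S d) M HM), <- (IHd M) by lia.
    rewrite <- Csum_plus. apply Csum_ext. intros i Hi. rewrite <- Csum_plus. apply Csum_ext. intros a Ha.
    destruct (Nat.leb_spec a (S d)), (Nat.leb_spec a d), (Nat.eqb_spec a (S d)); try lia; cring.
Qed.

Lemma homog_pmul d e P Q : homog d P -> homog e Q -> homog (d + e) (pmul P Q).
Proof.
  intros HP HQ i j Hij. unfold pmul. apply Csum_zero_ext. intros a Ha. apply Csum_zero_ext. intros b Hb.
  destruct (Nat.eq_dec (a + b) d) as [E|E].
  - rewrite (HQ (i - a)%nat (j - b)%nat) by lia. cring.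
  - rewrite (HP a b) by auto. cring.
Qed.

Lemma ev_pmul d e P Q x : homog d P -> homog e Q -> ev (d + e) (pmul P Q) x = (ev d P x * ev e Q x)%C.
Proof.
  intros HP HQ. unfold ev.
  set (u := fun a => (P a (d - a)%nat * RtoC x ^ a)%C).
  set (w := fun b => (if Nat.leb b e then Q b (e - b)%nat * RtoC x ^ b else RtoC 0)%C).
  replace (sum_n (fun i => Q i (e - i)%nat * RtoC x ^ i)%C e) with (sum_n w e).
  2:{ apply Csum_ext. intros b Hb. unfold w. destruct (Nat.leb_spec b e); auto; lia. }
  rewrite <- (cauchy_product u w e) with (M := (d + e)%nat); auto.
  2:{ intros b Hb. unfold w. destruct (Nat.leb_spec b e); auto; lia. }
  apply Csum_ext. intros i Hi. unfold pmul. rewrite Cmult_comm, Csum_mult_l.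
  apply Csum_ext. intros a Ha.
  destruct (Nat.leb_spec a d) as [Had|Had].
  (* By homogeneity of P only b = d - a survives in the inner sum of [pmul], which thus becomes a
     one-variable convolution. *)
  - rewrite (Csum_single _ _ (d - a)).
    2:{ intros b Hb. rewrite HP by lia. cring. }
    unfold u, w. replace i with (a + (i - a))%nat at 1 by lia. rewrite Cpow_add_r.
    destruct (Nat.leb_spec (d - a) (d + e - i)), (Nat.leb_spec (i - a) e); try lia.
    + replace (d + e - i - (d - a))%nat with (e - (i - a))%nat by lia. cring.
    + cring.
  - rewrite Csum_zero_ext. cring. intros b Hb. rewrite HP by lia. cring.
Qed.

Lemma ev_padd d P Q x : ev d (padd P Q) x = (ev d P x + ev d Q x)%C.
Proof. unfold ev. rewrite <- Csum_plus. apply Csum_ext. intros i _. unfold padd. cring. Qed.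

Lemma ev_pscal d c P x : ev d (pscal c P) x = (c * ev d P x)%C.
Proof. unfold ev. rewrite Csum_mult_l. apply Csum_ext. intros i _. unfold pscal. cring. Qed.

Lemma ev_psum d F n x : ev d (psum F n) x = sum_n (fun r => ev d (F r) x) n.
Proof.
  unfold ev, psum. induction n.
  - rewrite Csum_0. apply Csum_ext. intros i _. rewrite Csum_0. reflexivity.
  - rewrite Csum_S, <- IHn. rewrite <- Csum_plus. apply Csum_ext. intros i _. rewrite Csum_S. cring.
Qed.

(** The point where real x is essential. *)
Lemma ev_pRe d P x : ev d (pRe P) x = RtoC (Re (ev d P x)).
Proof.
  unfold ev. rewrite Re_sum_n, RtoC_sum_n. apply Csum_ext. intros i _. unfold pRe.
  rewrite <- !RtoC_pow, <- RtoC_mult. f_equal. simpl. unfold Re. ring.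
Qed.

Lemma ev_pmono d p x : (p <= d)%nat -> ev d (pmono (d - p) p) x = (RtoC x ^ (d - p))%C.
Proof.
  intros Hp. unfold ev. rewrite (Csum_single _ d (d - p)).
  - destruct (Nat.leb_spec (d - p) d); [|lia]. unfold pmono.
    replace (d - (d - p))%nat with p by lia. rewrite !Nat.eqb_refl. simpl andb. cbv iota. cring.
  - intros i Hi. unfold pmono. apply Nat.eqb_neq in Hi. rewrite Hi. simpl andb. cbv iota. cring.
Qed.

Lemma homog_padd d P Q : homog d P -> homog d Q -> homog d (padd P Q).
Proof. intros H1 H2 i j H. unfold padd. rewrite H1, H2 by auto. cring. Qed.
Lemma homog_pscal d c P : homog d P -> homog d (pscal c P).
Proof. intros H1 i j H. unfold pscal. rewrite H1 by auto. cring. Qed.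
Lemma homog_psum d F n : (forall r, (r <= n)%nat -> homog d (F r)) -> homog d (psum F n).
Proof. intros H1 i j H. unfold psum. apply Csum_zero_ext. intros r Hr. apply H1; auto. Qed.
Lemma homog_pRe d P : homog d P -> homog d (pRe P).
Proof. intros H1 i j H. unfold pRe. rewrite H1 by auto. reflexivity. Qed.
Lemma homog_pmono a b : homog (a + b) (pmono a b).
Proof.
  intros i j H. unfold pmono. destruct (Nat.eqb_spec i a), (Nat.eqb_spec j b); auto. subst. lia.
Qed.

Lemma homog_X_minus z : homog 1 (X_minus z).
Proof. apply homog_padd. apply (homog_pmono 1 0). apply homog_pscal, (homog_pmono 0 1). Qed.

Lemma ev_X_minus z x : ev 1 (X_minus z) x = (RtoC x - z)%C.
Proof.
  unfold X_minus. rewrite ev_padd, ev_pscal.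
  rewrite (ev_pmono 1 0), (ev_pmono 1 1) by lia. simpl. cring.
Qed.

Lemma homog_ppow P n : homog 1 P -> homog n (ppow P n).
Proof.
  intros H. induction n. apply (homog_pmono 0 0). apply (homog_pmul 1 n); auto.
Qed.

Lemma ev_ppow P n x : homog 1 P -> ev n (ppow P n) x = (ev 1 P x ^ n)%C.
Proof.
  intros H. induction n.
  - simpl ppow. rewrite (ev_pmono 0 0) by lia. reflexivity.
  - simpl ppow. rewrite (ev_pmul 1 n) by (auto; apply homog_ppow; auto). rewrite IHn. reflexivity.
Qed.

(** * Assembly of the theorem *)

Lemma G_rs_usum N n r v z : (1 <= n)%nat -> (r <= n)%nat -> 0 < Im z ->
  usum (fun u => if in_class N v u then
      RtoC (Im z) / (lin u z ^ (r + 1) * lin u (Cconj z) ^ (n - r + 1)) else RtoC 0)%C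
    (G_rs N r (n - r) v z).
Proof.
  intros Hn Hr Hz. destruct (inv_lin_bound (n + 2) (Im z) (Cmod z) ltac:(lia) Hz) as [B [HB H]].
  match goal with |- usum ?F _ => destruct (usum_exists F (fun u => Im z * (B * wL u))) as [S HS] end.
  - intros u. destruct (in_class N v u) eqn:E.
    + assert (Hu := in_class_nz _ _ _ E). assert (Hl := lin_nz z u Hz Hu).
      assert (Hlc : Cconj (lin u z) <> RtoC 0).
      { intros X. apply Hl. rewrite <- (Cconj_conj (lin u z)), X. apply Cconj_R. }
      rewrite lin_conj. unfold Cdiv.
      rewrite Cmod_mult, Cmod_R, Rabs_pos_eq by lra. apply Rmult_le_compat_l. lra.
      rewrite Cmod_inv by (apply Cmult_neq_0; apply Cpow_nz; auto).
      rewrite Cmod_mult, !Cmod_pow, Cmod_conj, <- pow_add.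
      replace (r + 1 + (n - r + 1))%nat with (n + 2)%nat by lia. apply H; auto; lra.
    + rewrite Cmod_0. assert (h := wL_pos u). apply Rmult_le_pos; [lra|apply Rmult_le_pos; lra].
  - apply rsummable_scal. lra. apply rsummable_scal. lra. apply rsummable_wL.
  - unfold G_rs. rewrite (lattice_sum_eq _ S); auto.
Qed.

Lemma G_rs_Rsum N n v x z : (1 <= n)%nat -> 0 < Im z ->
  sum_n (fun r => G_rs N r (n - r) v z * ((RtoC x - z) ^ r * (RtoC x - Cconj z) ^ (n - r)))%C n
  = RtoC (Rsum N n v x z).
Proof.
  intros Hn Hz.
  apply (usum_unique (Tcl N n v x z)); [|apply Rsum_usum; auto].
  assert (U : usum (fun u => sum_n (fun r => ((RtoC x - z) ^ r * (RtoC x - Cconj z) ^ (n - r)) *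
      (if in_class N v u then
      RtoC (Im z) / (lin u z ^ (r + 1) * lin u (Cconj z) ^ (n - r + 1)) else RtoC 0))%C n)
     (sum_n (fun r => ((RtoC x - z) ^ r * (RtoC x - Cconj z) ^ (n - r)) * G_rs N r (n - r) v z)%C n)).
  { apply usum_sum_n. intros r Hr. apply usum_scal, G_rs_usum; auto. }
  rewrite (Csum_ext _ (fun r => ((RtoC x - z) ^ r * (RtoC x - Cconj z) ^ (n - r)) * G_rs N r (n - r) v z)%C) by (intros; cring).
  eapply usum_ext; [|apply U]. intros u. cbv beta. unfold Tcl.
  destruct (in_class N v u) eqn:E.
  - rewrite <- Tt_Tr by (auto; apply (in_class_nz N v); auto). unfold Tt. apply Csum_ext. intros; cring.
  - apply Csum_zero_ext. intros; cring.
Qed.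

Theorem theorem6 (N k : nat) (v : Z * Z) (tau : C)
    (hN : (1 <= N)%nat) (hk : (3 <= k)%nat) (htau : (0 < Im tau)%R) :
  calG N k v tau =
  pscal (RtoC (- (2 * PI / INR (k - 1))))
    (psum (fun r =>
       let s := (k - 2 - r)%nat in
       pscal (G_rs N r s v tau)
         (pmul (ppow (X_minus tau) r) (ppow (X_minus (Cconj tau)) s)))
     (k - 2)).
Proof.
  assert (exists n, (1 <= n)%nat /\ k = (n + 2)%nat) as [n [Hn ->]] by (exists (k - 2)%nat; lia).
  unfold calG, P_G, int_form_from_cusp.
  replace (n + 2 - 2)%nat with n by lia. replace (n + 2 - 1)%nat with (S n) by lia.
  (* Both sides are homogeneous of degree k - 2, so it remains to compare their values at Y = 1 and
     real X. *)
  apply (homog_ext n).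
  - apply homog_padd. apply homog_pscal. exact (homog_pmono 0 n).
    apply homog_pRe, homog_psum. intros p Hp. apply homog_pscal.
    replace n with (n - p + p)%nat at 1 by lia. apply homog_pmono.
  - apply homog_pscal, homog_psum. intros r Hr. apply homog_pscal.
    replace n with (r + (n - r))%nat at 1 by lia.
    apply homog_pmul; apply homog_ppow, homog_X_minus.
  - intros x. rewrite ev_padd, ev_pRe, !ev_pscal, !ev_psum.
    replace (ev n (pmono 0 n) x) with (RtoC 1).
    2:{ assert (X := ev_pmono n n x (Nat.le_refl _)). rewrite Nat.sub_diag in X. rewrite X. reflexivity. }
    rewrite (Csum_ext (fun r => ev n (pscal (G_rs N r (n - r) v tau) _) x)
      (fun r => G_rs N r (n - r) v tau * ((RtoC x - tau) ^ r * (RtoC x - Cconj tau) ^ (n - r)))%C).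
    2:{ intros r Hr. rewrite ev_pscal. replace n with (r + (n - r))%nat at 2 by lia.
        rewrite ev_pmul by apply homog_ppow, homog_X_minus.
        rewrite !ev_ppow, !ev_X_minus by apply homog_X_minus. reflexivity. }
    rewrite G_rs_Rsum by auto.
    rewrite <- (RtoC_mult (- (2 * PI / INR (S n)))), <- (identity_at_real_point N n v x tau) by auto.
    rewrite Cmult_1_r, <- RtoC_plus. f_equal. f_equal. f_equal.
    rewrite Csum_mult_l. apply Csum_ext. intros p Hp. rewrite ev_pscal, ev_pmono by auto.
    unfold kap. cring.
Qed.
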